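(* Let $\alpha,\beta>-1$, and let $\Theta=\{\theta_1,\theta_2\}$ and $\Phi=\{\varphi_1,\varphi_2\}$, with $\theta_1,\theta_2,\varphi_1,\varphi_2$ bounded holomorphic functions on the unit disk $\mathbb{D}$, both satisfy the corona condition. Then the quotient Hilbert modules $(A^2_\alpha)_\Theta$ and $(A^2_\beta)_\Phi$ are isomorphic if and only if $\alpha=\beta$ and $$\nabla^2 \log \frac{|\theta_1(z)|^2+|\theta_2(z)|^2}{|\varphi_1(z)|^2+|\varphi_2(z)|^2}=0 \quad\text{for all } z\in\mathbb{D}.$$
   Context: $\mathbb{D}$ is the open unit disk in $\mathbb{C}$. For $\alpha>-1$, $A^2_\alpha$ is the weighted Bergman space of holomorphic $f$ on $\mathbb{D}$ with $\|f\|_{2,\alpha}^2=\frac1\pi\int_{\mathbb{D}}|f(z)|^2(\alpha+1)(1-|z|^2)^\alpha\,dA(z)<\infty$, where $dA$ is area measure. It is a Hilbert module over $\mathbb{C}[z]$ via $p\cdot f=pf$ (i.e. the coordinate function acts by $M_z f=zf$). $\nabla^2=4\partial\bar\partial$ is the Laplacian. A pair $\Theta=\{\theta_1,\theta_2\}$ of bounded holomorphic functions on $\mathbb{D}$ is viewed as the bounded holomorphic function $\Theta(z)=\theta_1(z)\otimes e_1+\theta_2(z)\otimes e_2$ with values in the bounded operators from $\mathbb{C}$ to $\mathbb{C}^2$, where $\{e_1,e_2\}$ is an orthonormal basis of $\mathbb{C}^2$. It satisfies the corona condition if there is $\epsilon>0$ with $|\theta_1(z)|^2+|\theta_2(z)|^2\ge\epsilon$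 for all $z\in\mathbb{D}$. For $\mathcal{H}=A^2_\alpha$ and such $\Theta$, let $M_\Theta:\mathcal{H}\to\mathcal{H}\otimes\mathbb{C}^2$, $M_\Theta f=\theta_1 f\otimes e_1+\theta_2 f\otimes e_2$; under the corona condition its range $\Theta\mathcal{H}$ is closed. The quotient Hilbert module is $\mathcal{H}_\Theta=(\mathcal{H}\otimes\mathbb{C}^2)/\Theta\mathcal{H}$ with the induced action of $\mathbb{C}[z]$; equivalently it is the Hilbert space $(\operatorname{ran} M_\Theta)^\perp\subseteq\mathcal{H}\otimes\mathbb{C}^2$ on which the coordinate function acts by the compression $N_z=P_{(\operatorname{ran} M_\Theta)^\perp}(M_z\otimes I_{\mathbb{C}^2})|_{(\operatorname{ran} M_\Theta)^\perp}$. Two Hilbert modules over $\mathbb{C}[z]$ are isomorphic if there is a unitary operator $X$ between them with $X(p\cdot f)=p\cdot(Xf)$ for all $p\in\mathbb{C}[z]$ and all $f$. *)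

(* Defs.v *)
From HB Require Import structures.
From mathcomp Require Import all_boot all_order all_algebra complex.
From mathcomp Require Import all_classical all_reals all_analysis.
Import numFieldNormedType.Exports.
Import Order.TTheory GRing.Theory Num.Theory.

Set Implicit Arguments.
Unset Strict Implicit.
Unset Printing Implicit Defensive.

Local Open Scope classical_set_scope.
Local Open Scope ring_scope.
Local Open Scope complex_scope.

(* |z|^2 as an element of R; the norm `|z| of R[i] is R[i]-valued. *)
Definition abs2 (R : realType) (z : R[i]) : R :=
  complex.Re z ^+ 2 + complex.Im z ^+ 2.

Definition disk (R : realType) : set R[i] := [set z | `|z| < 1].
Arguments disk {R}.

Definition holomorphic (R : realType) (f : R[i] -> R[i]) : Prop :=
  forall z, disk z -> derivable (f : R[i]^o -> R[i]^o) z 1.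

Definition bounded_holomorphic (R : realType) (f : R[i] -> R[i]) : Prop :=
  holomorphic f /\ exists M : R, forall z, disk z -> `|f z| <= M%:C.

Definition corona (R : realType) (f1 f2 : R[i] -> R[i]) : Prop :=
  exists2 e : R, 0 < e & forall z, disk z -> e <= abs2 (f1 z) + abs2 (f2 z).

(* Derivative at z in the real direction v; the derivative of an R[i]-valued
   function of a real variable is computed on its real and imaginary parts. *)
Definition partial (R : realType) (v : R[i]) (g : R[i] -> R[i]) (z : R[i]) :
    R[i] :=
  derive1 (fun t : R => complex.Re (g (z + t%:C * v))) 0 +i*
  derive1 (fun t : R => complex.Im (g (z + t%:C * v))) 0.

(* Wirtinger derivatives. *)
Definition d_z (R : realType) (g : R[i] -> R[i]) (z : R[i]) : R[i] :=
  (partial 1 g z - 'i%C * partial 'i%C g z) / 2.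

Definition d_zbar (R : realType) (g : R[i] -> R[i]) (z : R[i]) : R[i] :=
  (partial 1 g z + 'i%C * partial 'i%C g z) / 2.

Definition laplacian (R : realType) (g : R[i] -> R[i]) (z : R[i]) : R[i] :=
  4 * d_z (d_zbar g) z.

(* Area integrals are taken over R * R, with (x, y) standing for x + iy. *)
Definition area (R : realType) :
    {measure set (measurableTypeR R * measurableTypeR R) -> \bar R} :=
  (@lebesgue_measure R \x @lebesgue_measure R)%E.
Arguments area {R}.

Definition disk2 (R : realType) : set (measurableTypeR R * measurableTypeR R) :=
  [set p | disk (p.1 +i* p.2)].
Arguments disk2 {R}.

(* Density of the measure (1 / pi) (alpha + 1) (1 - |z|^2)^alpha dA. *)
Definition bergman_weight (R : realType) (alpha : R) (z : R[i]) : R :=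
  pi^-1 * (alpha + 1) * (1 - abs2 z) `^ alpha.

(* Functions on the disk are represented by functions on R[i] that vanish off
   the disk, so that equality of functions is equality on the disk. *)
Definition bergman (R : realType) (alpha : R) : set (R[i] -> R[i]) :=
  [set f | [/\ holomorphic f,
      (forall z, ~ disk z -> f z = 0) &
      (\int[area]_(p in disk2)
         (abs2 (f (p.1 +i* p.2)) * bergman_weight alpha (p.1 +i* p.2))%:E
       < +oo)%E]].

Definition bergman_dot (R : realType) (alpha : R) (f g : R[i] -> R[i]) : R[i] :=
  let h (z : R[i]) := f z * (g z)^*%C * (bergman_weight alpha z)%:C in
  (\int[area]_(p in disk2) complex.Re (h (p.1 +i* p.2))) +i*
  (\int[area]_(p in disk2) complex.Im (h (p.1 +i* p.2))).

(* The data of a Hilbert module over C[z] whose underlying space [hm_space] is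
   a subspace of an ambient vector space; the inner product (linear in its
   first argument) and the action only matter on [hm_space]. *)
Record hilbert_module (R : realType) : Type := HilbertModule {
  hm_ambient :> lmodType R[i];
  hm_space : set hm_ambient;
  hm_dot : hm_ambient -> hm_ambient -> R[i];
  hm_act : {poly R[i]} -> hm_ambient -> hm_ambient }.
Arguments HilbertModule {R}.
Arguments hm_space {R} h.
Arguments hm_dot {R} h.
Arguments hm_act {R} h.

(* X is unitary: it is linear, bijective and preserves inner products. *)
Definition hm_isomorphic (R : realType) (H K : hilbert_module R) : Prop :=
  exists X : H -> K,
    [/\ set_bij (hm_space H) (hm_space K) X,
        (forall (a : R[i]) u v, hm_space H u -> hm_space H v ->
           X (a *: u + v) = a *: X u + X v),
        (forall u v, hm_space H u -> hm_space H v ->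
           hm_dot K (X u) (X v) = hm_dot H u v) &
        (forall (p : {poly R[i]}) u, hm_space H u ->
           X (hm_act H p u) = hm_act K p (X u))].

Definition bergman_module (R : realType) (alpha : R) : hilbert_module R :=
  HilbertModule (R[i] -> R[i] : lmodType R[i]) (bergman alpha)
    (bergman_dot alpha) (fun p f z => p.[z] * f z).

(* H (x) C^2, with f1 (x) e1 + f2 (x) e2 written (f1, f2). *)
Definition tensor_C2 (R : realType) (H : hilbert_module R) : hilbert_module R :=
  HilbertModule (H * H : lmodType R[i])%type
    [set u | hm_space H u.1 /\ hm_space H u.2]
    (fun u v => hm_dot H u.1 v.1 + hm_dot H u.2 v.2)
    (fun p u => (hm_act H p u.1, hm_act H p u.2)).

Definition hm_orth (R : realType) (H : hilbert_module R) (S : set H) : set H :=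
  [set u | hm_space H u /\ forall v, S v -> hm_dot H u v = 0].

Definition hm_proj (R : realType) (H : hilbert_module R) (S : set H) (u : H) :
    H :=
  xget 0 [set v | S v /\ forall w, S w -> hm_dot H (u - v) w = 0].

(* The quotient of H by a closed submodule S, realized on the orthogonal
   complement of S with p acting by the compression of the action of p. *)
Definition hm_quotient (R : realType) (H : hilbert_module R) (S : set H) :
    hilbert_module R :=
  HilbertModule H (hm_orth S) (hm_dot H)
    (fun p u => hm_proj (hm_orth S) (hm_act H p u)).

Definition M_Theta (R : realType) (theta1 theta2 f : R[i] -> R[i]) :
    (R[i] -> R[i]) * (R[i] -> R[i]) :=
  (theta1 \* f, theta2 \* f).

Definition bergman_quotient (R : realType) (alpha : R)
    (theta1 theta2 : R[i] -> R[i]) : hilbert_module R :=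
  @hm_quotient R (tensor_C2 (bergman_module alpha))
    (M_Theta theta1 theta2 @` bergman alpha).

(* Main.v *)
Require Import Defs.
From mathcomp Require Import all_boot all_order all_algebra complex.
From mathcomp Require Import all_classical all_reals all_analysis measurable_realfun.
From mathcomp Require Import ring lra.
Import numFieldNormedType.Exports.
Import Order.TTheory GRing.Theory Num.Theory.
Import ComplexField.

(* The vectors [(- conj (theta2 w)) k_w, (conj (theta1 w)) k_w], where k_w is the
   reproducing kernel of the Bergman space at w, are orthogonal to the range of
   M_Theta and are, up to multiples, the joint eigenvectors of the adjoint of the
   action on the quotient. So a module isomorphism maps them to multiples of one another, which
   means that
     <Theta v, Theta w> K_alpha(v, w) = d(v) conj(d(w)) <Phi v, Phi w> K_beta(v, w)
   for a holomorphic d without zeros. If alpha < beta, then K_alpha / K_beta, hence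
   d, tends to 0 at the unit circle, so d(0) = 0, which is absurd. So alpha = beta,
   |Theta|^2 / |Phi|^2 = |d|^2, and log |d|^2 is harmonic.
   Conversely, if log (|Theta|^2 / |Phi|^2) is harmonic, it is log |d|^2 for a
   holomorphic d without zeros; then Theta and d Phi have the same pointwise norm,
   hence the same Gram matrix of derivatives at 0, so that Theta = U d Phi for a
   constant unitary U, and F |-> U^* F induces the isomorphism. *)

Set Implicit Arguments.
Unset Strict Implicit.
Unset Printing Implicit Defensive.
Local Open Scope classical_set_scope.
Local Open Scope ring_scope.
Local Open Scope complex_scope.
Local Notation normc := Normc.normc.

(** * Wirtinger derivatives *)

(** The weight enters through the moments [mom], the squared norms of the monomials, whose
    reciprocals are the coefficients of the kernel. For alpha < beta the moments of beta are of
    smaller order, because |z|^(2n) concentrates at the unit circle, where (1 - |z|^2)^(beta -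
    alpha) is small; this drives K_alpha / K_beta to 0. Passing from the kernels to d takes an upper
    bound of |Theta|^2, from boundedness, and a lower bound of |Phi|^2, from the corona condition.
    The corona condition acts a second time: it makes the range of [M_Theta] complete, so that the
    projections of the quotient exist; this also rests on the completeness of the Bergman space. One
    notion of real differentiability, [wirt], serves both holomorphy (second coefficient 0) and the
    Laplacian of a logarithm that is not holomorphic. Primitives on the disk and the identity
    theorem come from power series, hence the path through Goursat's lemma. Area integrals stay in
    Cartesian coordinates: rotation invariance takes the place of polar coordinates in the
    orthogonality of monomials. *)

Lemma eqW (R : realType) (x y : R) : x = y -> x <= y.
Proof. by move=> ->. Qed.

Section Modulus.
Context {R : realType}.
Implicit Types z w : R[i].

Lemma normc_ge0 z : 0 <= normc z.
Proof. by case: z => a b /=; exact: sqrtr_ge0. Qed.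

Lemma normc_eq0 z : (normc z == 0) = (z == 0).
Proof. by apply/eqP/eqP => [/Normc.eq0_normc//|->]; rewrite Normc.normc0. Qed.

Lemma normc_gt0 z : (0 < normc z) = (z != 0).
Proof. by rewrite lt_def normc_ge0 andbT normc_eq0. Qed.

Lemma normcM z w : normc (z * w) = normc z * normc w.
Proof. exact: Normc.normcM. Qed.

Lemma normcV z : normc z^-1 = (normc z)^-1.
Proof. exact: Normc.normcV. Qed.

Lemma normcX z n : normc (z ^+ n) = normc z ^+ n.
Proof.
elim: n => [|n ih]; first by rewrite !expr0 Normc.normc1.
by rewrite !exprS normcM ih.
Qed.

Lemma normcD z w : normc (z + w) <= normc z + normc w.
Proof. exact: le_normcD. Qed.

Lemma normcN z : normc (- z) = normc z.
Proof. by case: z => a b /=; rewrite !sqrrN. Qed.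

Lemma normcB z w : normc (z - w) <= normc z + normc w.
Proof. by rewrite -(normcN w); exact: normcD. Qed.

Lemma normcBC z w : normc (z - w) = normc (w - z).
Proof. by rewrite -normcN opprB. Qed.

Lemma normcJ z : normc z^*%C = normc z.
Proof. by case: z => a b /=; rewrite sqrrN. Qed.

Lemma conjcD z w : (z + w)^*%C = z^*%C + w^*%C.
Proof. exact: rmorphD. Qed.

Lemma conjcB z w : (z - w)^*%C = z^*%C - w^*%C.
Proof. exact: rmorphB. Qed.

Lemma conjcN z : (- z)^*%C = - z^*%C.
Proof. exact: rmorphN. Qed.

Lemma conjcM z w : (z * w)^*%C = z^*%C * w^*%C.
Proof. exact: rmorphM. Qed.

Lemma conjcX z n : (z ^+ n)^*%C = z^*%C ^+ n.
Proof. exact: rmorphXn. Qed.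

Lemma normc_real (x : R) : normc x%:C = `|x|.
Proof. by rewrite /= expr0n addr0 sqrtr_sqr. Qed.

Lemma normc_Ci : normc ('i%C : R[i]) = 1.
Proof. by rewrite /= expr0n add0r expr1n sqrtr1. Qed.

Lemma normc_ge_Re z : `|complex.Re z| <= normc z.
Proof.
case: z => a b /=; rewrite -sqrtr_sqr ler_sqrt ?addr_ge0 ?sqr_ge0//.
by rewrite lerDl sqr_ge0.
Qed.

Lemma normc_ge_Im z : `|complex.Im z| <= normc z.
Proof.
case: z => a b /=; rewrite -sqrtr_sqr ler_sqrt ?addr_ge0 ?sqr_ge0//.
by rewrite lerDr sqr_ge0.
Qed.

Lemma normc_le_ReIm z : normc z <= `|complex.Re z| + `|complex.Im z|.
Proof.
rewrite [X in normc X]complexE (le_trans (normcD _ _))// normcM normc_Ci mul1r.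
by rewrite !normc_real.
Qed.

Lemma abs2E z : abs2 z = normc z ^+ 2.
Proof. by case: z => a b /=; rewrite /abs2/= sqr_sqrtr// addr_ge0// sqr_ge0. Qed.

Lemma abs2_mulJ z : (abs2 z)%:C = z * z^*%C.
Proof. by case: z => a b; rewrite /abs2; simpc; congr (_ +i* _); ring. Qed.

Lemma diskE z : disk z = (normc z < 1) :> Prop.
Proof.
rewrite /disk/= normc_def propeqE; case: z => a b /=.
by rewrite (ltcR (Num.sqrt _) 1).
Qed.

Lemma ReD z w : complex.Re (z + w) = complex.Re z + complex.Re w.
Proof. by case: z w => a b []. Qed.

Lemma ImD z w : complex.Im (z + w) = complex.Im z + complex.Im w.
Proof. by case: z w => a b []. Qed.

Lemma ReB z w : complex.Re (z - w) = complex.Re z - complex.Re w.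
Proof. by case: z w => a b []. Qed.

Lemma ImB z w : complex.Im (z - w) = complex.Im z - complex.Im w.
Proof. by case: z w => a b []. Qed.

Lemma ReM_real z (x : R) : complex.Re (z * x%:C) = complex.Re z * x.
Proof. by case: z => a b; simpc. Qed.

Lemma ImM_real z (x : R) : complex.Im (z * x%:C) = complex.Im z * x.
Proof. by case: z => a b; simpc. Qed.

Lemma normc_sum (I : Type) (r : seq I) (P : pred I) (F : I -> R[i]) :
  normc (\sum_(i <- r | P i) F i) <= \sum_(i <- r | P i) normc (F i).
Proof.
elim/big_ind2: _ => [|x u y v xu yv|//]; first by rewrite Normc.normc0.
by rewrite (le_trans (normcD _ _))// lerD.
Qed.

Lemma normc_le0 z : (forall e, 0 < e -> normc z <= e) -> z = 0.
Proof.
move=> h; apply/eqP; rewrite -normc_eq0 eq_le normc_ge0 andbT.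
by apply/ler_addgt0Pl => e e0; rewrite addr0; exact: h.
Qed.

End Modulus.

Arguments Normc.normc : simpl never.

Section Wirtinger.
Context {R : realType}.
Implicit Types (z k a b : R[i]) (f g : R[i] -> R[i]).

(* f(z + k) = f(z) + a k + b k^* + o(k), so that a and b are the Wirtinger
   derivatives of f at z, and f is complex differentiable at z iff b = 0. *)
Definition wirt f z a b := forall e : R, 0 < e -> exists2 d, 0 < d &
  forall k, normc k < d -> normc (f (z + k) - f z - (a * k + b * k^*%C)) <= e * normc k.

Lemma wirt_eq f g z a b : (exists2 d : R, 0 < d &
    forall k, normc k < d -> f (z + k) = g (z + k)) ->
  wirt f z a b -> wirt g z a b.
Proof.
move=> [d d0 fg] h e e0; have [d' d'0 hd'] := h e e0.
exists (Num.min d d'); first by rewrite lt_min d0.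
move=> k; rewrite lt_min => /andP[kd kd'].
have := hd' k kd'; rewrite fg//.
by have := fg 0; rewrite Normc.normc0 addr0 => ->.
Qed.

Lemma wirt_cst c z : wirt (fun=> c) z 0 0.
Proof.
move=> e e0; exists 1 => // k _; rewrite !mul0r addr0 subrr subr0 Normc.normc0.
by rewrite mulr_ge0 ?normc_ge0 ?ltW.
Qed.

Lemma wirt_id z : wirt id z 1 0.
Proof.
move=> e e0; exists 1 => // k _.
rewrite (_ : _ - _ = 0); last by ring.
by rewrite Normc.normc0 mulr_ge0 ?normc_ge0 ?ltW.
Qed.

Lemma wirt_add f g z a b a' b' : wirt f z a b -> wirt g z a' b' ->
  wirt (fun x => f x + g x) z (a + a') (b + b').
Proof.
move=> hf hg e e0; have e20 : 0 < e / 2 by rewrite divr_gt0.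
have [d1 d10 h1] := hf _ e20; have [d2 d20 h2] := hg _ e20.
exists (Num.min d1 d2); first by rewrite lt_min d10.
move=> k; rewrite lt_min => /andP[/h1{}h1 /h2{}h2].
rewrite (_ : _ - _ = (f (z + k) - f z - (a * k + b * k^*%C)) +
   (g (z + k) - g z - (a' * k + b' * k^*%C))); last by ring.
by rewrite (le_trans (normcD _ _))// (splitr e) mulrDl lerD.
Qed.

Lemma wirt_conj f z a b : wirt f z a b ->
  wirt (fun x => (f x)^*%C) z b^*%C a^*%C.
Proof.
move=> hf e /hf[d d0 h]; exists d => // k /h.
by rewrite -normcJ !(conjcD, conjcN, conjcM) conjcK (addrC (_ * k)).
Qed.

Lemma wirt_lip f z a b : wirt f z a b ->
  exists2 d, 0 < d & forall k, normc k < d ->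
    normc (f (z + k) - f z) <= (normc a + normc b + 1) * normc k.
Proof.
move=> /(_ 1 ltr01)[d d0 h]; exists d => // k /h{}h.
rewrite (_ : _ - _ = f (z + k) - f z - (a * k + b * k^*%C) + (a * k + b * k^*%C)).
  rewrite (le_trans (normcD _ _))// addrC mulrDl; apply: lerD => //.
  by rewrite (le_trans (normcD _ _))// !normcM normcJ mulrDl.
by rewrite subrK.
Qed.

Lemma wirt_cont f z a b : wirt f z a b -> forall e, 0 < e ->
  exists2 d, 0 < d & forall k, normc k < d -> normc (f (z + k) - f z) <= e.
Proof.
move=> /wirt_lip[d d0 h] e e0; set N := _ + 1 in h.
have N0 : 0 < N by rewrite ltr_wpDl// addr_ge0 ?normc_ge0.
exists (Num.min d (e / N)); first by rewrite lt_min d0 divr_gt0.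
move=> k; rewrite lt_min => /andP[/h{}h]; rewrite ltr_pdivlMr// => /ltW ke.
by rewrite (le_trans h)// mulrC.
Qed.

(** The increment [h] of [f] is fed into the expansion of [g]; the error of [f] is then carried
    through the real-linear map with coefficients [A] and [B]. Each of the two errors gets half of
    [e]. *)
Lemma wirt_chain g f z a b A B : wirt g (f z) A B -> wirt f z a b ->
  wirt (fun x => g (f x)) z (A * a + B * b^*%C) (A * b + B * a^*%C).
Proof.
move=> hg hf e e0.
set N := normc a + normc b + 1; set M := normc A + normc B + 1.
have N0 : 0 < N by rewrite ltr_wpDl// addr_ge0 ?normc_ge0.
have M0 : 0 < M by rewrite ltr_wpDl// addr_ge0 ?normc_ge0.
have [d1 d10 h1] := hg _ (divr_gt0 e0 (mulr_gt0 (ltr0Sn R 1) N0)).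
have [d2 d20 h2] := hf _ (divr_gt0 e0 (mulr_gt0 (ltr0Sn R 1) M0)).
have [d3 d30 h3] := wirt_lip hf.
exists (Num.min (Num.min d2 d3) (d1 / N)).
  by rewrite !lt_min d20 d30 divr_gt0.
move=> k; rewrite !lt_min => /andP[/andP[/h2{}h2 /h3{}h3]].
rewrite ltr_pdivlMr// => kd1.
set h := f (z + k) - f z in h2 h3.
have hd1 : normc h < d1 by rewrite (le_lt_trans h3)// mulrC.
have {}h1 := h1 _ hd1.
have fE : f (z + k) = f z + h by rewrite /h; ring.
set r := h - _ in h2.
rewrite fE (_ : _ - _ = (g (f z + h) - g (f z) - (A * h + B * h^*%C)) +
   (A * r + B * r^*%C)); last first.
  rewrite /r !(conjcD, conjcN, conjcM) conjcK; ring.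
have r1 : normc (A * r + B * r^*%C) <= M * normc r.
  rewrite (le_trans (normcD _ _))// !normcM normcJ -mulrDl.
  by rewrite ler_wpM2r ?normc_ge0// lerDl.
rewrite (le_trans (normcD _ _))// (splitr e) mulrDl lerD//.
  apply: le_trans h1 _; apply: (@le_trans _ _ (e / (2 * N) * (N * normc k))).
    by rewrite ler_wpM2l// ltW// divr_gt0// mulr_gt0.
  by apply: eqW; field; rewrite gt_eqF.
apply: le_trans r1 _; apply: (@le_trans _ _ (M * (e / (2 * M) * normc k))).
  by rewrite ler_wpM2l// ltW.
by apply: eqW; field; rewrite gt_eqF.
Qed.

Lemma wirt_cplx_chain g f z a A : wirt g (f z) A 0 -> wirt f z a 0 ->
  wirt (fun x => g (f x)) z (A * a) 0.
Proof.
by move=> hg hf; have := wirt_chain hg hf; rewrite conjc0 !mulr0 mul0r !addr0.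
Qed.

Lemma wirt_sqr z : wirt (fun x => x ^+ 2) z (2 * z) 0.
Proof.
move=> e e0; exists e => // k ke.
rewrite (_ : _ - _ = k * k); last by ring.
by rewrite normcM ler_wpM2r ?normc_ge0// ltW.
Qed.

Lemma wirt_scale c z : wirt (fun x => c * x) z c 0.
Proof.
move=> e e0; exists 1 => // k _.
rewrite (_ : _ - _ = 0); last by ring.
by rewrite Normc.normc0 mulr_ge0 ?normc_ge0 ?ltW.
Qed.

Lemma wirt_scaleM c f z a b : wirt f z a b -> wirt (fun x => c * f x) z (c * a) (c * b).
Proof.
by move=> hf; have := wirt_chain (wirt_scale c (f z)) hf; rewrite !mul0r !addr0.
Qed.

Lemma wirt_opp f z a b : wirt f z a b -> wirt (fun x => - f x) z (- a) (- b).
Proof.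
move=> /(wirt_scaleM (-1)); rewrite !mulN1r; apply: wirt_eq; exists 1 => // k _.
by rewrite mulN1r.
Qed.

Lemma wirt_sub f g z a b a' b' : wirt f z a b -> wirt g z a' b' ->
  wirt (fun x => f x - g x) z (a - a') (b - b').
Proof. by move=> hf /wirt_opp hg; exact: wirt_add hf hg. Qed.

(* Polarization: 4 f g = (f + g)^2 - (f - g)^2. *)
Lemma wirt_mul f g z a b a' b' : wirt f z a b -> wirt g z a' b' ->
  wirt (fun x => f x * g x) z (a * g z + f z * a') (b * g z + f z * b').
Proof.
move=> hf hg.
have hp := wirt_chain (wirt_sqr _) (wirt_add hf hg).
have hm := wirt_chain (wirt_sqr _) (wirt_sub hf hg).
have := wirt_scaleM (4^-1) (wirt_sub hp hm).
rewrite !mul0r !addr0.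
rewrite (_ : _^-1 * _ = a * g z + f z * a'); last by field.
rewrite (_ : _^-1 * _ = b * g z + f z * b'); last by field.
by apply: wirt_eq; exists 1 => // k _; field.
Qed.

Lemma wirt_inv z : z != 0 -> wirt (fun x => x^-1) z (- z ^- 2) 0.
Proof.
move=> z0; have nz0 : 0 < normc z by rewrite normc_gt0.
(* The first bound keeps [z + k] at distance at least [normc z / 2] from 0, the second makes
   [k / (z ^ 2 (z + k))] at most [e]. *)
move=> e e0; exists (Num.min (normc z / 2) (e * normc z ^+ 3 / 2)).
  by rewrite lt_min !(divr_gt0, mulr_gt0, exprn_gt0).
move=> k; rewrite lt_min => /andP[k1 k2].
have zk : normc z / 2 <= normc (z + k).
  have := normcB (z + k) k; rewrite addrK; lra.
have zk0 : z + k != 0 by rewrite -normc_gt0 (lt_le_trans _ zk)// divr_gt0.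
rewrite (_ : _ - _ = k * (k * (z ^- 2 * (z + k)^-1))); last by field; rewrite zk0.
rewrite normcM mulrC ler_wpM2r ?normc_ge0// !(normcM, normcV, normcX).
rewrite mulrA ler_pdivrMr ?(lt_le_trans _ zk) ?divr_gt0//.
rewrite ler_pdivrMr ?exprn_gt0//.
apply: (@le_trans _ _ (e * (normc z / 2) * normc z ^+ 2)).
  by apply: le_trans (ltW k2) _; apply: eqW; field.
by rewrite ler_wpM2r ?exprn_ge0 ?normc_ge0// ler_wpM2l// ltW.
Qed.

Lemma wirt_exp n z : wirt (fun x => x ^+ n) z (n%:R * z ^+ n.-1) 0.
Proof.
elim: n => [|n ih]; first by rewrite mul0r; exact: wirt_cst.
have := wirt_mul (wirt_id z) ih; rewrite mul0r mulr0 addr0 mul1r.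
rewrite (_ : z ^+ n + _ = n.+1%:R * z ^+ n).
  by apply: wirt_eq; exists 1 => // k _; rewrite exprS.
case: n {ih} => [|n /=]; first by rewrite mul0r mulr0 addr0 mul1r.
by rewrite !exprS -[in RHS]natr1; ring.
Qed.

Lemma wirt_div f g z a a' : g z != 0 -> wirt f z a 0 -> wirt g z a' 0 ->
  wirt (fun x => f x / g x) z ((a * g z - f z * a') / g z ^+ 2) 0.
Proof.
move=> gz0 hf hg.
have h := wirt_mul hf (wirt_cplx_chain (wirt_inv gz0) hg).
move: h; rewrite mul0r mulr0 addr0.
by rewrite (_ : _ + _ = (a * g z - f z * a') / g z ^+ 2)//; field.
Qed.

Lemma wirt_sum n (F : nat -> R[i] -> R[i]) (A : nat -> R[i]) z :
  (forall i, (i < n)%N -> wirt (F i) z (A i) 0) ->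
  wirt (fun x => \sum_(i < n) F i x) z (\sum_(i < n) A i) 0.
Proof.
elim: n => [_|n ih h].
  rewrite big_ord0; apply: wirt_eq (wirt_cst 0 z); exists 1 => // k _.
  by rewrite big_ord0.
have := wirt_add (ih _) (h n (ltnSn n)).
rewrite addr0 big_ord_recr/=.
move=> H; apply: wirt_eq (H _).
  by exists 1 => // k _; rewrite big_ord_recr.
by move=> i lin; apply: h; exact: ltnW.
Qed.

(** Comparing both expansions along small real multiples of a unit vector [u] gives
    [(a - a') * u + (b - b') * conj u = 0]; the choices [u = 1] and [u = i] separate the
    coefficients. *)
Lemma wirt_uniq f z a b a' b' : wirt f z a b -> wirt f z a' b' ->
  a = a' /\ b = b'.
Proof.
move=> h1 h2.
have key u : normc u = 1 -> (a - a') * u + (b - b') * u^*%C = 0.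
  move=> u1; apply: normc_le0 => e e0.
  have e20 : 0 < e / 2 by rewrite divr_gt0.
  have [d1 d10 {}h1] := h1 _ e20; have [d2 d20 {}h2] := h2 _ e20.
  pose d := Num.min d1 d2 / 2.
  have d0 : 0 < d by rewrite divr_gt0// lt_min d10.
  have ud : normc (d%:C * u) = d by rewrite normcM u1 mulr1 normc_real gtr0_norm.
  have [dd1 dd2] : d < d1 /\ d < d2.
    by apply/andP; rewrite -lt_min /d ltr_pdivrMr// mulr_natr mulr2n ltrDl lt_min d10.
  have := h1 (d%:C * u); have := h2 (d%:C * u).
  rewrite ud => /(_ dd2) k2 /(_ dd1) k1.
  rewrite -(ler_pM2l d0); apply: (@le_trans _ _ (e / 2 * d + e / 2 * d)); last first.
    by apply: eqW; field.
  apply: le_trans (lerD k2 k1); apply: le_trans (normcB _ _).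
  rewrite -{1}(gtr0_norm d0) -normc_real -normcM; apply: eqW; congr (normc _).
  by rewrite !conjcM conjc_real; ring.
have k1 : a - a' + (b - b') = 0.
  by have := key 1 (@Normc.normc1 R); rewrite conjc1 !mulr1.
have k2 : a - a' - (b - b') = 0.
  have := key 'i%C normc_Ci.
  rewrite (_ : ('i%C)^*%C = - 'i%C); last by simpc.
  rewrite mulrN -mulrBl => /eqP; rewrite mulf_eq0 => /orP[/eqP//|].
  by rewrite -normc_eq0 normc_Ci oner_eq0.
have aa : a - a' = 0.
  have -> : a - a' = ((a - a' + (b - b')) + (a - a' - (b - b'))) / 2 by field.
  by rewrite k1 k2 addr0 mul0r.
move: k1; rewrite aa add0r => /eqP; rewrite subr_eq0 => /eqP ->.
by move/eqP: aa; rewrite subr_eq0 => /eqP ->.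
Qed.

End Wirtinger.

(** * Complex-valued functions of a real variable *)

Section Curves.
Context {R : realType}.
Implicit Types (h H : R -> R[i]) (t s : R).

Definition cder h t (h' : R[i]) := forall e : R, 0 < e -> exists2 d, 0 < d &
  forall s, `|s| < d -> normc (h (t + s) - h t - h' * s%:C) <= e * `|s|.

Definition ccont h := forall t (e : R), 0 < e -> exists2 d, 0 < d &
  forall s, `|s| < d -> normc (h (t + s) - h t) <= e.

(** Along the real part, [h' dt] is [h' / 2] times [dz] plus [h' / 2] times the conjugate of [dz].
    This turns the rules for curves into instances of those for [wirt]. *)
Lemma cderP h t (h' : R[i]) :
  cder h t h' <-> wirt (fun z => h (complex.Re z)) t%:C (h' / 2) (h' / 2).
Proof.
have E (k : R[i]) : h' / 2 * k + h' / 2 * k^*%C = h' * (complex.Re k)%:C.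
  by rewrite ReJ_add; field.
split=> H e e0; have [d d0 {}H] := H e e0; exists d => //.
  move=> k kd; rewrite E.
  have Rk := normc_ge_Re k.
  rewrite (_ : complex.Re (t%:C + k) = t + complex.Re k); last by case: k {E kd Rk}.
  apply: le_trans (H _ (le_lt_trans Rk kd)) _.
  by rewrite ler_wpM2l// ltW.
move=> s sd; have := H s%:C; rewrite normc_real => /(_ sd); rewrite E /=.
exact.
Qed.

Lemma cder_wirt g h t (h' : R[i]) A B : wirt g (h t) A B -> cder h t h' ->
  cder (fun s => g (h s)) t (A * h' + B * h'^*%C).
Proof.
move=> hg /cderP hh; apply/cderP.
have := wirt_chain (g := g) hg hh.
have -> : (h' / 2)^*%C = h'^*%C / 2.
  by rewrite conjcM; congr (_ * _); rewrite conjc_inv conjc_nat.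
by rewrite !mulrA -mulrDl.
Qed.

Lemma cder_hol g h t (h' : R[i]) A : wirt g (h t) A 0 -> cder h t h' ->
  cder (fun s => g (h s)) t (A * h').
Proof. by move=> hg /(cder_wirt hg); rewrite mul0r addr0. Qed.

Lemma cder_eq h H t (h' : R[i]) : (forall s, h s = H s) -> cder h t h' -> cder H t h'.
Proof. by move=> hH; have -> : H = h by apply/funext. Qed.

Lemma cderD h H t (h' H' : R[i]) : cder h t h' -> cder H t H' ->
  cder (fun s => h s + H s) t (h' + H').
Proof.
move=> /cderP hh /cderP HH; apply/cderP; rewrite mulrDl.
exact: wirt_add.
Qed.

Lemma cderM h H t (h' H' : R[i]) : cder h t h' -> cder H t H' ->
  cder (fun s => h s * H s) t (h' * H t + h t * H').
Proof.
move=> /cderP hh /cderP HH; apply/cderP; have := wirt_mul hh HH.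
by rewrite /= (mulrAC h') (mulrA (h t)) -mulrDl.
Qed.

Lemma cder_cst c t : cder (fun=> c) t 0.
Proof. by apply/cderP; rewrite mul0r; exact: wirt_cst. Qed.

Lemma cderZ c h t (h' : R[i]) : cder h t h' -> cder (fun s => c * h s) t (c * h').
Proof. exact/cder_hol/wirt_scale. Qed.

Lemma cder_real_id t : cder (fun s => s%:C) t 1.
Proof.
move=> e e0; exists 1 => // s _.
rewrite (_ : _ - _ = 0); last by rewrite rmorphD/=; ring.
by rewrite Normc.normc0 mulr_ge0// ltW.
Qed.

Lemma is_derive1P (f : R -> R) (x : R) f' : is_derive x 1 f f' <->
  forall e, 0 < e -> exists2 d, 0 < d & forall s, `|s| < d ->
    `|f (x + s) - f x - f' * s| <= e * `|s|.
Proof.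
split.
  move=> [df <-] e e0.
  have : h^-1 *: (f (h *: 1 + x) - f x) @[h --> 0^'] --> 'D_1 f x by exact: df.
  move=> /cvgrPdist_le /(_ e e0).
  rewrite near_withinE => /nbhs_ballP [d/= d0 H].
  exists d => // s sd; have [->|s0] := eqVneq s 0.
    by rewrite addr0 subrr mulr0 subr0 normr0 mulr0.
  have := H s; rewrite /ball/= sub0r normrN => /(_ sd s0).
  rewrite [s *: 1]mulr1 (addrC s) distrC -ler_pdivrMr ?normr_gt0// => H1.
  rewrite -normrV ?unitfE// -normrM.
  move: H1; rewrite /GRing.scale/=; apply: le_trans; apply: eqW; congr (`|_|); field.
  exact: s0.
move=> H.
have cv : h^-1 *: (f (h *: 1 + x) - f x) @[h --> 0^'] --> f'.
  apply/cvgrPdist_le => e e0; have [d d0 {}H] := H e e0.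
  rewrite near_withinE; apply/nbhs_ballP; exists d => //= s.
  rewrite /ball/= sub0r normrN => sd s0.
  have := H s sd; rewrite [s *: 1]mulr1 (addrC s) -ler_pdivrMr ?normr_gt0//.
  rewrite distrC -normrV ?unitfE// -normrM; apply: le_trans; apply: eqW; congr (`|_|).
  by rewrite /GRing.scale/=; field.
by apply: DeriveDef; [apply/cvg_ex; exists f'|exact/cvg_lim].
Qed.

Lemma cder_real (f : R -> R) t (f' : R) : is_derive t 1 f f' ->
  cder (fun s => (f s)%:C) t f'%:C.
Proof.
move=> /is_derive1P H e /H[d d0 h]; exists d => // s /h.
rewrite (_ : _ - _ = (f (t + s) - f t - f' * s)%:C); last by rewrite !rmorphB rmorphM.
by rewrite normc_real.
Qed.

Lemma cder_Re h t (h' : R[i]) : cder h t h' ->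
  is_derive t 1 (fun s => complex.Re (h s)) (complex.Re h').
Proof.
move=> H; apply/is_derive1P => e /H[d d0 {}H]; exists d => // s /H.
apply: le_trans; apply: le_trans (normc_ge_Re _); by rewrite !(ReB, ReM_real).
Qed.

Lemma cder_Im h t (h' : R[i]) : cder h t h' ->
  is_derive t 1 (fun s => complex.Im (h s)) (complex.Im h').
Proof.
move=> H; apply/is_derive1P => e /H[d d0 {}H]; exists d => // s /H.
apply: le_trans; apply: le_trans (normc_ge_Im _); by rewrite !(ImB, ImM_real).
Qed.

Lemma cder_ReIm h t (a b : R) : is_derive t 1 (fun s => complex.Re (h s)) a ->
  is_derive t 1 (fun s => complex.Im (h s)) b -> cder h t (a +i* b).
Proof.
move=> /cder_real ha /cder_real hb.
have := cderD ha (cderZ 'i%C hb); rewrite -(complexE (a +i* b)).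
by apply: cder_eq => s; rewrite -complexE.
Qed.

Lemma cder_cont h : (forall t, exists h' : R[i], cder h t h') -> ccont h.
Proof.
move=> H t e e0; have [h' /cderP hh] := H t.
have [d d0 {}H] := wirt_cont hh e0; exists d => // s sd.
by have /= := H s%:C; rewrite normc_real; exact.
Qed.

Lemma ccont_cst c : ccont (fun=> c).
Proof. by apply: cder_cont => t; exists 0; exact: cder_cst. Qed.

Lemma ccontD h H : ccont h -> ccont H -> ccont (fun s => h s + H s).
Proof.
move=> hh HH t e e0; have e20 : 0 < e / 2 by rewrite divr_gt0.
have [d d0 {}hh] := hh t _ e20; have [d' d'0 {}HH] := HH t _ e20.
exists (Num.min d d'); first by rewrite lt_min d0.
move=> s; rewrite lt_min => /andP[/hh h1 /HH h2].
rewrite (_ : _ - _ = h (t + s) - h t + (H (t + s) - H t)); last by ring.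
by rewrite (le_trans (normcD _ _))// (splitr e) lerD.
Qed.

Lemma ccont_comp g h : (forall t, exists a b, wirt g (h t) a b) -> ccont h ->
  ccont (fun s => g (h s)).
Proof.
move=> hg hh t e e0; have [a [b gab]] := hg t.
have [d d0 {}hg] := wirt_cont gab e0.
have [d' d'0 {}hh] := hh t _ (divr_gt0 d0 (ltr0Sn R 1)).
exists d' => // s /hh hs; rewrite (_ : h (t + s) = h t + (h (t + s) - h t)); last by ring.
by apply: hg; apply: le_lt_trans hs _; rewrite ltr_pdivrMr// mulr_natr mulr2n ltrDl.
Qed.

(** Polarization again: [ccont_comp] handles outer functions of one variable, so the product is
    written with squares. *)
Lemma ccontM h H : ccont h -> ccont H -> ccont (fun s => h s * H s).
Proof.
move=> hh HH.
have sq k : ccont k -> ccont (fun s => k s ^+ 2).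
  apply: (@ccont_comp (fun x => x ^+ 2)) => t.
  by exists (2 * k t), 0; exact: wirt_sqr.
have sc c k : ccont k -> ccont (fun s => c * k s).
  by apply: (@ccont_comp (fun x => c * x)) => t; exists c, 0; exact: wirt_scale.
have := sc 4^-1 _ (ccontD (sq _ (ccontD hh HH)) (sc (-1) _ (sq _ (ccontD hh (sc (-1) _ HH))))).
rewrite (_ : (fun s => 4^-1 * _) = fun s => h s * H s)//.
by apply/funext => s; field.
Qed.

Lemma cont_ReP (f : R -> R) : (forall t e, 0 < e -> exists2 d, 0 < d &
  forall s, `|s| < d -> `|f (t + s) - f t| <= e) -> continuous f.
Proof.
move=> H t; apply/cvgrPdist_le => e e0; have [d d0 {}H] := H t e e0.
apply/nbhs_ballP; exists d => // s; rewrite /ball/= => ts.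
have := H (s - t); rewrite distrC => /(_ ts).
by rewrite (addrC t) subrK distrC.
Qed.

Lemma ccont_Re h : ccont h -> continuous (fun s => complex.Re (h s)).
Proof.
move=> hh; apply: cont_ReP => t e /(hh t)[d d0 H]; exists d => // s /H.
apply: le_trans; apply: le_trans (normc_ge_Re _); by rewrite ReB.
Qed.

Lemma ccont_Im h : ccont h -> continuous (fun s => complex.Im (h s)).
Proof.
move=> hh; apply: cont_ReP => t e /(hh t)[d d0 H]; exists d => // s /H.
apply: le_trans; apply: le_trans (normc_ge_Im _); by rewrite ImB.
Qed.

Lemma real_mean_le (f f' : R -> R) (a b M : R) : a <= b ->
  (forall t, a <= t <= b -> is_derive t 1 f (f' t)) ->
  (forall t, a <= t <= b -> `|f' t| <= M) -> `|f b - f a| <= M * (b - a).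
Proof.
move=> ab df fM.
have [||c] := @MVT_segment R f f' a b ab.
- by move=> x; rewrite in_itv/= => /andP[ax xb]; apply: df; rewrite !ltW.
- apply: derivable_within_continuous => x; rewrite in_itv/= => xab.
  by have [] := df x xab.
rewrite in_itv/= => cab ->; rewrite normrM (ger0_norm (_ : 0 <= b - a)) ?subr_ge0//.
by rewrite ler_wpM2r ?subr_ge0// fM.
Qed.

(** The real mean value inequality is applied to real and imaginary parts separately, whence the
    factor 2. *)
Lemma mean_le h (h' : R -> R[i]) (a b M : R) : a <= b ->
  (forall t, a <= t <= b -> cder h t (h' t)) ->
  (forall t, a <= t <= b -> normc (h' t) <= M) ->
  normc (h b - h a) <= 2 * M * (b - a).
Proof.
move=> ab dh hM; apply: le_trans (normc_le_ReIm _) _.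
have -> : 2 * M * (b - a) = M * (b - a) + M * (b - a) by ring.
apply: lerD.
  have := @real_mean_le (fun s => complex.Re (h s)) (fun s => complex.Re (h' s)) a b M ab.
  rewrite -ReB.
  apply=> t tab; first exact: cder_Re (dh t tab).
  by apply: le_trans (normc_ge_Re _) _; exact: hM.
have := @real_mean_le (fun s => complex.Im (h s)) (fun s => complex.Im (h' s)) a b M ab.
rewrite -ImB.
apply=> t tab; first exact: cder_Im (dh t tab).
by apply: le_trans (normc_ge_Im _) _; exact: hM.
Qed.

(** The integral starts at -1 so that the unit interval, which contains all intervals of
    integration, lies in the interior of the domain. Hence the conditions [-1 < t] below. *)
Lemma real_antideriv (f : R -> R) : continuous f ->
  exists F : R -> R, forall t, -1 < t -> is_derive t 1 F (f t).
Proof.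
move=> cf; exists (fun x => \int[@lebesgue_measure R]_(t in `[(-1), x]) f t)%R => t t1.
have tt1 : t < t + 1 by rewrite ltrDl.
have [|d1 d2] := @continuous_FTC1_closed R f (-1) t (t + 1) tt1 _ t1 (cf t).
  apply: continuous_compact_integrable; first exact: segment_compact.
  exact: continuous_subspaceT.
by apply: DeriveDef; [exact: d1|rewrite -derive1E; exact: d2].
Qed.

Definition cantider (h H : R -> R[i]) := forall t, -1 < t -> cder H t (h t).

Lemma cantider_exists h : ccont h -> exists H, cantider h H.
Proof.
move=> hh.
have [F1 dF1] := real_antideriv (ccont_Re hh).
have [F2 dF2] := real_antideriv (ccont_Im hh).
exists (fun t => F1 t +i* F2 t) => t t1.
by rewrite [h t]complexE; have := cder_ReIm (h := fun t => F1 t +i* F2 t) (dF1 t t1) (dF2 t t1); rewrite {1}[_ +i* _]complexE.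
Qed.

(* Difference of antiderivatives on ]-1, +oo[; junk if there is none, or outside. *)
Definition cint h (a b : R) : R[i] :=
  let H := xget (fun=> 0) [set H | cantider h H] in H b - H a.

(** Two antiderivatives differ by a curve of derivative 0, which [mean_le] shows to be constant; the
    one chosen inside [cint] is therefore as good as [H]. *)
Lemma cintE h H (a b : R) : cantider h H -> -1 < a -> -1 < b ->
  cint h a b = H b - H a.
Proof.
move=> hH a1 b1; rewrite /cint; case: xgetP => [G _ hG|/(_ H)//].
wlog ab : a b a1 b1 / a <= b.
  move=> W; have [/W->//|/ltW/W W'] := leP a b.
  by rewrite -(opprB (G a)) -(opprB (H a)) W'.
suff : (G b - H b) - (G a - H a) = 0 by move=> /eqP; rewrite subr_eq0 => /eqP E; rewrite -[LHS]addr0 -(subrr (H b)); move/eqP: E; rewrite -subr_eq0 => /eqP E; rewrite -[RHS]addr0 -E; ring.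
apply: normc_le0 => e e0.
have := @mean_le (fun t => G t - H t) (fun=> 0) a b 0 ab.
rewrite mulr0 mul0r => H1; apply: le_trans (H1 _ _) (ltW e0).
- move=> t /andP[at_ _]; have t1 := lt_le_trans a1 at_.
  have := cderD (hG t t1) (cderZ (-1) (hH t t1)).
  rewrite mulN1r subrr; apply: cder_eq => s; by rewrite mulN1r.
- by move=> t _; rewrite Normc.normc0.
Qed.

Lemma cintD h k (a b : R) : ccont h -> ccont k -> -1 < a -> -1 < b ->
  cint (fun t => h t + k t) a b = cint h a b + cint k a b.
Proof.
move=> /cantider_exists[H hH] /cantider_exists[K kK] a1 b1.
rewrite (cintE hH)// (cintE kK)// (@cintE _ (fun t => H t + K t))//; first by ring.
by move=> t t1; apply: cderD; [exact: hH|exact: kK].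
Qed.

Lemma cintZ c h (a b : R) : ccont h -> -1 < a -> -1 < b ->
  cint (fun t => c * h t) a b = c * cint h a b.
Proof.
move=> /cantider_exists[H hH] a1 b1.
rewrite (cintE hH)// (@cintE _ (fun t => c * H t))//; first by ring.
by move=> t t1; apply: cderZ; exact: hH.
Qed.

Lemma cint_chasles h (a b c : R) : cint h a b + cint h b c = cint h a c.
Proof. by rewrite /cint; set H := xget _ _; ring. Qed.

Lemma cint_le h (a b M : R) : ccont h -> -1 < a -> a <= b ->
  (forall t, a <= t <= b -> normc (h t) <= M) ->
  normc (cint h a b) <= 2 * M * (b - a).
Proof.
move=> /cantider_exists[H hH] a1 ab hM.
rewrite (cintE hH)//; last exact: lt_le_trans ab.
apply: (mean_le ab _ hM) => t /andP[at_ _]; apply: hH.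
exact: lt_le_trans at_.
Qed.

Lemma ccont_sum n (h : nat -> R -> R[i]) : (forall i, ccont (h i)) ->
  ccont (fun t => \sum_(i < n) h i t).
Proof.
move=> hh; elim: n => [|n ih].
  by rewrite (_ : (fun t => _) = fun=> 0); [exact: ccont_cst|apply/funext => t; rewrite big_ord0].
rewrite (_ : (fun t => _) = fun t => \sum_(i < n) h i t + h n t); first exact: ccontD.
by apply/funext => t; rewrite big_ord_recr.
Qed.

Lemma cint_sum n (h : nat -> R -> R[i]) (a b : R) : (forall i, ccont (h i)) ->
  -1 < a -> -1 < b ->
  cint (fun t => \sum_(i < n) h i t) a b = \sum_(i < n) cint (h i) a b.
Proof.
move=> hh a1 b1; elim: n => [|n ih].
  rewrite big_ord0 (@cintE _ (fun=> 0))// ?subrr// => t _.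
  by rewrite big_ord0; exact: cder_cst.
rewrite big_ord_recr -ih/= -cintD//; last exact: ccont_sum.
by congr (cint _ a b); apply/funext => t; rewrite big_ord_recr.
Qed.

End Curves.

(** * The complex exponential *)

Section CExp.
Context {R : realType}.

Definition cexp (z : R[i]) : R[i] :=
  (expR (complex.Re z))%:C * (cos (complex.Im z) +i* sin (complex.Im z)).

Lemma cexpD z w : cexp (z + w) = cexp z * cexp w.
Proof.
case: z w => a b [c d]; rewrite /cexp/= expRD cosD sinD; simpc.
by congr (_ +i* _); ring.
Qed.

Lemma cexp0 : cexp 0 = 1.
Proof. by rewrite /cexp/= expR0 cos0 sin0; simpc. Qed.

Lemma normc_cexp z : normc (cexp z) = expR (complex.Re z).
Proof.
rewrite /cexp normcM normc_real /Normc.normc.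
by rewrite cos2Dsin2 sqrtr1 mulr1 ger0_norm ?expR_ge0.
Qed.

Lemma cexp_neq0 z : cexp z != 0.
Proof. by rewrite -normc_gt0 normc_cexp expR_gt0. Qed.

Lemma cexpX z n : cexp z ^+ n = cexp (n%:R * z).
Proof.
elim: n => [|n ih]; first by rewrite mul0r cexp0.
by rewrite exprS ih -cexpD -natr1 mulrDl mul1r addrC.
Qed.

(** The coefficients of the real part are 1/2, 1/2 and those of the imaginary part -i/2, i/2. In the
    product rule the two contributions to the conjugate coefficient cancel by [i * i = -1]: these
    are the Cauchy-Riemann equations. *)
Lemma wirt_cexp z : wirt cexp z (cexp z) 0.
Proof.
have wRe w : wirt (fun z => (complex.Re z)%:C : R[i]) w (1 / 2) (1 / 2).
  move=> e e0; exists 1 => // k _.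
  rewrite (_ : _ - _ = 0); first by rewrite Normc.normc0 mulr_ge0 ?normc_ge0 ?ltW.
  by rewrite ReD rmorphD/= (addrC _%:C) addrK ReJ_add; field.
have wIm w : wirt (fun z => (complex.Im z)%:C : R[i]) w ((-'i%C) / 2) ('i%C / 2).
  move=> e e0; exists 1 => // k _.
  rewrite (_ : _ - _ = 0); first by rewrite Normc.normc0 mulr_ge0 ?normc_ge0 ?ltW.
  by rewrite ImD rmorphD/= (addrC _%:C) addrK ImJ_sub; field.
have wE : wirt (fun z => (expR (complex.Re z))%:C) z
    ((expR (complex.Re z))%:C / 2) ((expR (complex.Re z))%:C / 2).
  have /cderP := cder_real (@is_derive_expR R (complex.Re z)).
  move=> H; have := wirt_chain (g := fun z => (expR (complex.Re z))%:C) (f := fun z => (complex.Re z)%:C) H (wRe z).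
  have -> : ((1 / 2 : R[i])^*%C) = 1 / 2.
    by rewrite conjcM conjc1 conjc_inv conjc_nat.
  set E := (expR _)%:C.
  by rewrite (_ : _ + _ = E / 2)//; field.
have cT : cder (fun t => cos t +i* sin t) (complex.Im z) (- sin (complex.Im z) +i* cos (complex.Im z)).
  exact: (@cder_ReIm R (fun t => cos t +i* sin t)).
have wT := wirt_chain (g := fun z => cos (complex.Re z) +i* sin (complex.Re z)) (f := fun z => (complex.Im z)%:C) (proj1 (cderP _ _ _) cT) (wIm z).
have := wirt_mul wE wT; cbv beta.
have -> : ('i%C / 2)^*%C = - 'i%C / 2 :> R[i].
  by rewrite conjcM conjc_inv conjc_nat; congr (_ * _); simpc.
have -> : (- 'i%C / 2)^*%C = 'i%C / 2 :> R[i].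
  by rewrite conjcM conjc_inv conjc_nat; congr (_ * _); simpc.
rewrite -[complex.Re (complex.Im z)%:C]/(complex.Im z).
set E := (expR _)%:C; set T := (- sin (complex.Im z) +i* _).
have -> : T = 'i%C * (cos (complex.Im z) +i* sin (complex.Im z)).
  by rewrite /T; simpc.
set v := (cos (complex.Im z) +i* sin (complex.Im z)).
have i2 : 'i%C * 'i%C = -1 :> R[i] by rewrite -expr2 sqr_i.
have -> : E / 2 * v + E * ('i%C * v / 2 * (- 'i%C / 2) + 'i%C * v / 2 * (- 'i%C / 2)) = E * v.
  have -> : 'i%C * v / 2 * (- 'i%C / 2) = - ('i%C * 'i%C) * v / 4 :> R[i] by field.
  by rewrite i2; field.
have -> // : E / 2 * v + E * ('i%C * v / 2 * ('i%C / 2) + 'i%C * v / 2 * ('i%C / 2)) = 0.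
have -> : 'i%C * v / 2 * ('i%C / 2) = ('i%C * 'i%C) * v / 4 :> R[i] by field.
by rewrite i2; field.
Qed.

End CExp.

(** * Goursat's lemma and Cauchy's integral formula *)

Section Goursat.
Context {R : realType}.

Lemma pow_small (q e : R) : 0 <= q < 1 -> 0 < e ->
  exists N, forall n, (N <= n)%N -> q ^+ n < e.
Proof.
move=> /andP[q0 q1] e0.
have /cvgrPdist_lt /(_ e e0) [N _ H] : (GRing.exp q) @ \oo --> (0 : R).
  by apply: cvg_expr; rewrite ger0_norm.
exists N => n nN; have := H n nN.
by rewrite /= sub0r normrN ger0_norm// exprn_ge0.
Qed.

(* Goursat's bisection, for a function S of the square with lower left corner
   (x, y) and side h. *)
Lemma bisection (S : R -> R -> R -> R[i]) :
  (forall x y h, 0 <= x -> 0 <= y -> 0 < h ->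
    S x y (h + h) = S x y h + S (x + h) y h + S x (y + h) h + S (x + h) (y + h) h) ->
  (forall p q e : R, 0 <= p <= 1 -> 0 <= q <= 1 -> 0 < e ->
    exists2 d, 0 < d & forall x y h, 0 <= x <= p -> p <= x + h <= 1 ->
      0 <= y <= q -> q <= y + h <= 1 -> 0 < h < d -> normc (S x y h) <= e * h ^+ 2) ->
  S 0 0 1 = 0.
Proof.
move=> Sadd Sloc; apply/eqP; rewrite -normc_eq0; apply/negPn/negP => S0.
set e := normc _ in S0; have e0 : 0 < e by rewrite lt_def S0 normc_ge0.
pose l n : R := 2 ^- n.
have l0 n : 0 < l n by rewrite invr_gt0 exprn_gt0.
have lS n : l n = l n.+1 + l n.+1 by rewrite /l exprS; field; rewrite expf_neq0.
(* Invariant: the square of side [l n] at [p] lies in the unit square, and [S] has modulus at least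
   [e] times its area there. *)
pose P n (p : R * R) := [/\ 0 <= p.1, 0 <= p.2, p.1 + l n <= 1, p.2 + l n <= 1 &
  e * l n ^+ 2 <= normc (S p.1 p.2 (l n))].
pose Q n (p q : R * R) := [/\ P n.+1 q, p.1 <= q.1, q.1 + l n.+1 <= p.1 + l n,
  p.2 <= q.2 & q.2 + l n.+1 <= p.2 + l n].
have step n p : P n p -> exists q, Q n p q.
  (* If all four quarters were below their share, their sum would be below the value on the
     whole. *)
  move=> [x0 y0 x1 y1 Sp]; apply: contrapT => /forallNP nQ.
  have small a b : a = 0 \/ a = l n.+1 -> b = 0 \/ b = l n.+1 ->
      normc (S (p.1 + a) (p.2 + b) (l n.+1)) < e * l n.+1 ^+ 2.
    move=> ha hb; rewrite ltNge; apply/negP => H; apply: (nQ (p.1 + a, p.2 + b)).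
    have [a0 a1] : 0 <= a /\ a <= l n.+1 by case: ha => ->; split=> //; exact: ltW.
    have [b0 b1] : 0 <= b /\ b <= l n.+1 by case: hb => ->; split=> //; exact: ltW.
    have := lS n => lSn.
    split=> /=; [split=> //=|..]; lra.
  have s00 := small 0 0 (or_introl erefl) (or_introl erefl).
  have s01 := small 0 _ (or_introl erefl) (or_intror erefl).
  have s10 := small _ 0 (or_intror erefl) (or_introl erefl).
  have s11 := small _ _ (or_intror erefl) (or_intror erefl).
  rewrite !addr0 in s00 s01 s10.
  have := Sadd p.1 p.2 (l n.+1) x0 y0 (l0 _); rewrite -lS => E.
  move: Sp; rewrite E leNgt => /negP; apply.
  rewrite (le_lt_trans (normcD _ _))//.
  have h1 := normcD (S p.1 p.2 (l n.+1) + S (p.1 + l n.+1) p.2 (l n.+1)) (S p.1 (p.2 + l n.+1) (l n.+1)).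
  have h2 := normcD (S p.1 p.2 (l n.+1)) (S (p.1 + l n.+1) p.2 (l n.+1)).
  have -> : l n ^+ 2 = 4 * l n.+1 ^+ 2 by rewrite (lS n); ring.
  lra.
pose s := fix s n := if n is m.+1 then xget (0, 0) (Q m (s m)) else (0, 0) : R * R.
have sP n : P n (s n).
  elim: n => [|n ih].
    by split=> //=; rewrite /l expr0 invr1 ?add0r// expr1n mulr1.
  by have [q /= Qq] := step n _ ih; have [] := xgetPex (0, 0) (ex_intro _ q Qq).
have sQ n : Q n (s n) (s n.+1).
  by have [q /= Qq] := step n _ (sP n); exact: (xgetPex (0, 0) (ex_intro _ q Qq)).
have nest (x : nat -> R) : (forall n, x n <= x n.+1) ->
    (forall n, x n.+1 + l n.+1 <= x n + l n) -> forall n m, x m <= x n + l n.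
  move=> x1 x2.
  have up i j : x i <= x (i + j)%N.
    by elim: j => [|j ih]; rewrite ?addn0// addnS (le_trans ih).
  have dn i j : x (i + j)%N + l (i + j)%N <= x i + l i.
    by elim: j => [|j ih]; rewrite ?addn0// addnS (le_trans _ ih).
  move=> n m; have [nm|/ltnW mn] := leqP n m.
    rewrite -(subnKC nm); apply: le_trans (dn n (m - n)%N).
    by rewrite lerDl ltW.
  rewrite (le_trans (up m (n - m)%N))// subnKC// lerDl ltW//.
have lim (x : nat -> R) : (forall n, x n <= x n.+1) ->
    (forall n, x n.+1 + l n.+1 <= x n + l n) ->
    exists p, forall n, x n <= p <= x n + l n.
  move=> x1 x2; exists (sup (range x)) => n; have ub := nest x x1 x2.
  have hs : has_sup (range x).
    by split; [exists (x 0%N), 0%N|exists (x 0%N + l 0%N) => _ [m _ <-]].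
  apply/andP; split; first by apply: sup_upper_bound => //; exists n.
  by apply: ge_sup => [|_ [m _ <-]]; [exists (x 0%N), 0%N|].
have [p hp] : exists p, forall n, (s n).1 <= p <= (s n).1 + l n.
  by apply: lim => n; have [] := sQ n.
have [q hq] : exists q, forall n, (s n).2 <= q <= (s n).2 + l n.
  by apply: lim => n; have [] := sQ n.
(* Near the common point [(p, q)] of the nested squares, the local bound with [e / 2] contradicts
   the invariant. *)
have [|||d d0 H] := Sloc p q (e / 2).
- by have := hp 0%N; rewrite /= add0r /l expr0 invr1.
- by have := hq 0%N; rewrite /= add0r /l expr0 invr1.
- by rewrite divr_gt0.
have [N hN] : exists N, l N < d.
  have [||N hN] := @pow_small (1 / 2) d => //; first lra.
  exists N; have := hN N (leqnn _).
  by rewrite expr_div_n expr1n div1r.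
have [x0 y0 x1 y1 Sge] := sP N.
have /andP[p1 p2] := hp N; have /andP[q1 q2] := hq N.
have := H (s N).1 (s N).2 (l N); rewrite x0 p1 p2 x1 y0 q1 q2 y1 l0 hN.
move=> /(_ isT isT isT isT isT) Sle.
have := le_trans Sge Sle; rewrite ler_pM2r ?exprn_gt0//; lra.
Qed.

(** A primitive of [c + a * (z - z0)], the first-order expansion of the integrand at [z0]. *)
Definition affine_prim (c a z0 z : R[i]) := c * z + a / 2 * (z - z0) ^+ 2.

(** The affine part of the integrand integrates exactly to a difference of endpoint values of
    [affine_prim]. These differences cancel round a square, and only the approximation error [eta]
    is left. *)
Lemma edge_exact (G : R[i] -> R[i]) (g g' : R -> R[i]) (c a z0 : R[i]) (x h eta L : R) :
  (forall t, cder g t (g' t)) -> ccont g' -> ccont (fun t => G (g t)) ->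
  0 <= x -> 0 < h -> 0 <= L ->
  (forall t, x <= t <= x + h -> normc (G (g t) - (c + a * (g t - z0))) <= eta) ->
  (forall t, x <= t <= x + h -> normc (g' t) <= L) ->
  normc (cint (fun t => G (g t) * g' t) x (x + h) -
    (affine_prim c a z0 (g (x + h)) - affine_prim c a z0 (g x))) <= 2 * (eta * L) * h.
Proof.
move=> dg cg' cGg x0 h0 L0 hG hL; set T := affine_prim c a z0.
have cg : ccont g by apply: cder_cont => t; exists (g' t).
have wT z : wirt T z (c + a * (z - z0)) 0.
  have w1 := wirt_sub (wirt_id z) (wirt_cst z0 z); rewrite !subr0 in w1.
  have w2 := wirt_cplx_chain (wirt_sqr (z - z0)) (f := fun x => x - z0) w1.
  have := wirt_add (wirt_scale c z) (wirt_scaleM (a / 2) w2).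
  by rewrite !mulr0 addr0 (_ : _ + _ = c + a * (z - z0))//; field.
have cT : cantider (fun t => (c + a * (g t - z0)) * g' t) (fun t => T (g t)).
  by move=> t _; exact: cder_hol (wT _) (dg t).
have cE : ccont (fun t => (c + a * (g t - z0)) * g' t).
  apply: ccontM => //; apply: (@ccont_comp _ (fun z => c + a * (z - z0))) => // t.
  have := wirt_sub (wirt_id (g t)) (wirt_cst z0 (g t)).
  move=> /(wirt_scaleM a)/(wirt_add (wirt_cst c (g t))) w.
  by eexists; eexists; exact: w.
have x1 : -1 < x by lra.
have xh1 : -1 < x + h by lra.
rewrite -(cintE cT)//.
have cA : ccont (fun t => G (g t) * g' t) by exact: ccontM.
rewrite -[X in _ - X]mul1r -mulNr -cintZ// -cintD//; last first.
  by apply: ccontM => //; exact: ccont_cst.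
rewrite [X in _ <= _ * X](_ : h = x + h - x); last by ring.
apply: cint_le => //; first by apply: ccontD => //; apply: ccontM => //; exact: ccont_cst.
  by rewrite lerDl ltW.
move=> t tx; rewrite mulN1r -mulrBl normcM ler_pM ?normc_ge0//.
  exact: hG.
exact: hL.
Qed.

(* Cauchy's theorem for [G(z) dz] on the image of [0, 1]^2 under P. *)
Lemma Goursat_square (G : R[i] -> R[i]) (P Pu Pv : R -> R -> R[i]) (L : R) :
  (forall u v, cder (fun s => P s v) u (Pu u v)) ->
  (forall u v, cder (fun s => P u s) v (Pv u v)) ->
  (forall v, ccont (fun u => Pu u v)) -> (forall u, ccont (fun v => Pv u v)) ->
  (forall u v, 0 <= u <= 1 -> 0 <= v <= 1 -> normc (Pu u v) <= L) ->
  (forall u v, 0 <= u <= 1 -> 0 <= v <= 1 -> normc (Pv u v) <= L) ->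
  (forall u v, exists a, wirt G (P u v) a 0) ->
  cint (fun u => G (P u 0) * Pu u 0) 0 1 + cint (fun v => G (P 1 v) * Pv 1 v) 0 1
  - cint (fun u => G (P u 1) * Pu u 1) 0 1 - cint (fun v => G (P 0 v) * Pv 0 v) 0 1 = 0.
Proof.
move=> dPu dPv cPu cPv bu bv dG.
wlog L0 : L bu bv / 0 < L.
  move=> W; apply: (W (Num.max L 1)); last by rewrite lt_max ltr01 orbT.
    by move=> u v u1 v1; rewrite le_max bu.
  by move=> u v u1 v1; rewrite le_max bv.
pose S (x y h : R) : R[i] :=
  cint (fun u => G (P u y) * Pu u y) x (x + h) +
  cint (fun v => G (P (x + h) v) * Pv (x + h) v) y (y + h)
  - cint (fun u => G (P u (y + h)) * Pu u (y + h)) x (x + h)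
  - cint (fun v => G (P x v) * Pv x v) y (y + h).
transitivity (S 0 0 1); first by rewrite /S !add0r.
apply: bisection.
  move=> x y h x0 y0 h0; rewrite /S.
  have -> : x + (h + h) = x + h + h by ring.
  have -> : y + (h + h) = y + h + h by ring.
  rewrite -(cint_chasles (fun u => G (P u y) * Pu u y) x (x + h) (x + h + h)).
  rewrite -(cint_chasles (fun u => G (P u (y + h + h)) * Pu u (y + h + h)) x (x + h) (x + h + h)).
  rewrite -(cint_chasles (fun v => G (P x v) * Pv x v) y (y + h) (y + h + h)).
  rewrite -(cint_chasles (fun v => G (P (x + h + h) v) * Pv (x + h + h) v) y (y + h) (y + h + h)).
  (* Each inner edge of the subdivision is traversed twice, in opposite directions. *)
  set A := (fun u => _ * Pu u (y + h)); set B := (fun v => _ * Pv (x + h) v).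
  move: (cint A _ _) (cint A _ _) (cint B _ _) (cint B _ _) => a1 a2 b1 b2.
  move: (cint _ _ _) (cint _ _ _) (cint _ _ _) (cint _ _ _) (cint _ _ _) (cint _ _ _) (cint _ _ _) (cint _ _ _).
  by move=> *; ring.
move=> p q e hp hq e0.
have [a Ga] := dG p q.
(* The image of a square of side [h] lies within [4 * L * h] of [P p q], and each of the four edges
   contributes [2 * (eta * L) * h]. With [eta] equal to [e / (32 L^2)] times that distance, the
   total is [e * h ^+ 2]. *)
have L2 : 0 < 32 * L ^+ 2 by rewrite mulr_gt0// exprn_gt0.
have [d1 d10 H1] := Ga _ (divr_gt0 e0 L2).
exists (d1 / (8 * L)); first by rewrite divr_gt0// mulr_gt0.
move=> x y h /andP[x0 xp] /andP[px x1] /andP[y0 yq] /andP[qy y1] /andP[h0].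
rewrite ltr_pdivlMr ?mulr_gt0// => hd.
have lipu u u' v : 0 <= u -> u <= u' -> u' <= 1 -> 0 <= v <= 1 ->
    normc (P u' v - P u v) <= 2 * L * (u' - u).
  move=> u0 uu' u'1 hv; apply: (@mean_le R (fun s => P s v) (fun s => Pu s v) u u' L) => // t /andP[ut tu].
  by apply: bu => //; apply/andP; lra.
have lipv u v v' : 0 <= v -> v <= v' -> v' <= 1 -> 0 <= u <= 1 ->
    normc (P u v' - P u v) <= 2 * L * (v' - v).
  move=> u0 uu' u'1 hv; apply: (@mean_le R (fun s => P u s) (fun s => Pv u s) v v' L) => // t /andP[ut tu].
  by apply: bv => //; apply/andP; lra.
have lip u v : x <= u <= x + h -> y <= v <= y + h -> normc (P u v - P p q) <= 4 * L * h.
  move=> /andP[xu ux] /andP[yv vy].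
  have h1 : normc (P u v - P p v) <= 2 * L * h.
    have [pu|/ltW up] := leP p u.
      apply: le_trans (lipu p u v _ _ _ _) _ => //; try lra.
      by rewrite ler_pM2l ?mulr_gt0//; lra.
    rewrite normcBC; apply: le_trans (lipu u p v _ _ _ _) _ => //; try lra.
    by rewrite ler_pM2l ?mulr_gt0//; lra.
  have h2 : normc (P p v - P p q) <= 2 * L * h.
    have [pu|/ltW up] := leP q v.
      apply: le_trans (lipv p q v _ _ _ _) _ => //; try lra.
      by rewrite ler_pM2l ?mulr_gt0//; lra.
    rewrite normcBC; apply: le_trans (lipv p v q _ _ _ _) _ => //; try lra.
    by rewrite ler_pM2l ?mulr_gt0//; lra.
  have := normcD (P u v - P p v) (P p v - P p q); rewrite addrA subrK; lra.
set eta := e / (32 * L ^+ 2) * (4 * L * h).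
have err u v : x <= u <= x + h -> y <= v <= y + h ->
    normc (G (P u v) - (G (P p q) + a * (P u v - P p q))) <= eta.
  move=> hu hv; have l1 := lip u v hu hv.
  have := H1 (P u v - P p q); rewrite (_ : P p q + (P u v - P p q) = P u v); last by ring.
  rewrite mul0r addr0 opprD addrA.
  move=> H; apply: le_trans (H _) _.
    apply: le_lt_trans l1 _; apply: le_lt_trans hd.
    rewrite mulrC ler_pM2l//; lra.
  by rewrite ler_pM2l ?divr_gt0.
have cG1 v : ccont (fun u => G (P u v)).
  apply: ccont_comp => [t|]; last by apply: cder_cont => t; exists (Pu t v).
  by have [b] := dG t v; exists b, 0.
have cG2 u : ccont (fun v => G (P u v)).
  apply: ccont_comp => [t|]; last by apply: cder_cont => t; exists (Pv u t).
  by have [b] := dG u t; exists b, 0.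
have ex : x <= x <= x + h by lra.
have ex' : x <= x + h <= x + h by lra.
have ey : y <= y <= y + h by lra.
have ey' : y <= y + h <= y + h by lra.
have inx t : x <= t <= x + h -> 0 <= t <= 1 by lra.
have iny t : y <= t <= y + h -> 0 <= t <= 1 by lra.
have L0' := ltW L0.
have e1 v (hv : y <= v <= y + h) := @edge_exact G (fun u => P u v) (fun u => Pu u v)
  (G (P p q)) a (P p q) x h eta L (dPu^~ v) (cPu v) (cG1 v) x0 h0 L0'
  (fun t ht => err t v ht hv) (fun t ht => bu t v (inx t ht) (iny v hv)).
have e2 u (hu : x <= u <= x + h) := @edge_exact G (fun v => P u v) (fun v => Pv u v)
  (G (P p q)) a (P p q) y h eta L (dPv u) (cPv u) (cG2 u) y0 h0 L0'
  (fun t ht => err u t hu ht) (fun t ht => bv u t (inx u hu) (iny t ht)).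
have E1 := e1 y ey; have E2 := e2 _ ex'; have E3 := e1 _ ey'; have E4 := e2 x ex.
move: E1 E2 E3 E4; rewrite /S /affine_prim /=.
set C1 := cint _ _ _; set C2 := cint _ _ _; set C3 := cint _ _ _; set C4 := cint _ _ _.
set T00 := (_ + _ * (P x y - _) ^+ 2).
set T10 := (_ + _ * (P (x + h) y - _) ^+ 2).
set T01 := (_ + _ * (P x (y + h) - _) ^+ 2).
set T11 := (_ + _ * (P (x + h) (y + h) - _) ^+ 2).
move=> E1 E2 E3 E4.
(* The corner values of the primitive telescope around the square. *)
rewrite (_ : C1 + _ - _ - _ = (C1 - (T10 - T00)) + (C2 - (T11 - T10)) -
  (C3 - (T11 - T01)) - (C4 - (T01 - T00))); last by ring.
have := normcB (C1 - (T10 - T00) + (C2 - (T11 - T10)) - (C3 - (T11 - T01))) (C4 - (T01 - T00)).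
have := normcB (C1 - (T10 - T00) + (C2 - (T11 - T10))) (C3 - (T11 - T01)).
have := normcD (C1 - (T10 - T00)) (C2 - (T11 - T10)).
move=> F1 F2 F3.
have -> : e * h ^+ 2 = 4 * (2 * (eta * L) * h).
  by rewrite /eta; field; rewrite gt_eqF.
lra.
Qed.

End Goursat.

(** * Cauchy's formula on circles centred at the origin *)

Section Cauchy.
Context {R : realType}.

Definition chol (f : R[i] -> R[i]) := forall z, normc z < 1 -> exists a, wirt f z a 0.

Definition tpi : R[i] := (2 * pi)%:C * 'i%C.

Definition circ (r v : R) : R[i] := r%:C * cexp (tpi * v%:C).

Lemma Re_iM_real (x y : R) : complex.Re (x%:C * 'i%C * y%:C) = 0.
Proof. by simpc. Qed.

Lemma normc_circ r v : 0 <= r -> normc (circ r v) = r.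
Proof.
move=> r0; rewrite normcM normc_real ger0_norm// normc_cexp.
by rewrite /tpi Re_iM_real expR0 mulr1.
Qed.

Lemma circ01 r : circ r 1 = circ r 0.
Proof.
rewrite /circ mulr1 mulr0 cexp0 /cexp /tpi; simpc.
rewrite /= expR0.
by rewrite mulr_natl cos2pi sin2pi; simpc.
Qed.

Lemma cder_circ r v : cder (circ r) v (tpi * circ r v).
Proof.
have := cderZ r%:C (cder_hol (wirt_cexp _) (cderZ tpi (cder_real_id v))).
by rewrite mulr1 /circ (mulrC (cexp _)) mulrCA.
Qed.

Lemma ccont_circ r : ccont (circ r).
Proof. by apply: cder_cont => v; eexists; exact: cder_circ. Qed.

Lemma tpi_neq0 : tpi != 0 :> R[i].
Proof.
by rewrite -normc_gt0 normcM normc_Ci mulr1 normc_real gtr0_norm mulr_gt0 ?pi_gt0.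
Qed.

(** For [n > 0] the integrand is a multiple of an exponential, and its antiderivative takes equal
    values at 0 and 1 because the circle closes up. *)
Lemma cint_circX (r : R) n : 0 < r ->
  cint (fun v => (circ r v)^-1 ^+ n) 0 1 = (n == 0%N)%:R.
Proof.
move=> r0; case: n => [|n].
  rewrite (@cintE _ _ (fun t => t%:C)) ?subr0//= ?ltrN10//.
    by move=> t _; rewrite expr0; exact: cder_real_id.
set c := - (n.+1%:R * tpi).
have c0 : c != 0 by rewrite oppr_eq0 mulf_neq0 ?tpi_neq0 ?pnatr_eq0.
have E v : (circ r v)^-1 ^+ n.+1 = (r%:C^-1) ^+ n.+1 * cexp (c * v%:C).
  rewrite /circ invfM exprMn; congr (_ * _).
  rewrite (_ : (cexp _)^-1 = cexp (- (tpi * v%:C))).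
    by rewrite cexpX /c; congr cexp; ring.
  by apply: (mulfI (cexp_neq0 (tpi * v%:C))); rewrite divff ?cexp_neq0// -cexpD subrr cexp0.
rewrite (@cintE _ _ (fun v => (r%:C^-1) ^+ n.+1 / c * cexp (c * v%:C))) ?ltrN10//; last first.
  move=> t _; rewrite E.
  have := cderZ ((r%:C^-1) ^+ n.+1 / c) (cder_hol (wirt_cexp _) (cderZ c (cder_real_id t))).
  by rewrite mulr1 (mulrC (cexp _)) mulrA divfK.
have := E 1; have := E 0; rewrite circ01 => -> /mulfI ->; first by rewrite subrr.
by rewrite expf_neq0// invr_eq0 -normc_gt0 normc_real gtr0_norm.
Qed.

Section CauchyFormula.
Context (w : R[i]) (r : R).
Context (wr : normc w < r) (r1 : r < 1).

Let r0 : 0 < r. Proof. exact: le_lt_trans (normc_ge0 w) wr. Qed.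

Lemma circ_sub_ge v : r - normc w <= normc (circ r v - w).
Proof.
have := normcB (circ r v - w) (- w); rewrite opprK subrK normc_circ ?(ltW r0)// normcN.
lra.
Qed.

Lemma circ_sub_neq0 v : circ r v - w != 0.
Proof. by rewrite -normc_gt0 (lt_le_trans _ (circ_sub_ge v))// subr_gt0. Qed.

(* [dz / (2 pi i (z - w))] pulled back to [0, 1] by [z = circ r v]. *)
Definition ckern v := circ r v / (circ r v - w).

Lemma ckern_le v : normc (ckern v) <= r / (r - normc w).
Proof.
rewrite normcM normcV normc_circ ?(ltW r0)//.
rewrite ler_wpM2l ?(ltW r0)// lef_pV2 ?circ_sub_ge//.
  by rewrite posrE normc_gt0 circ_sub_neq0.
by rewrite posrE subr_gt0.
Qed.

Lemma ccont_ckern : ccont ckern.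
Proof.
apply: ccontM; first exact: ccont_circ.
apply: (@ccont_comp _ (fun z => (z - w)^-1)); last exact: ccont_circ.
move=> t; have := wirt_sub (wirt_id (circ r t)) (wirt_cst w (circ r t)).
rewrite !subr0 => /(wirt_cplx_chain (f := fun z => z - w) (wirt_inv (circ_sub_neq0 t))) h.
by eexists; eexists; exact: h.
Qed.

(** [ckern] is [1 / (1 - w / circ r v)]: a finite geometric sum with its exact remainder. *)
Lemma ckern_expand n v : ckern v =
  \sum_(i < n) w ^+ i * (circ r v)^-1 ^+ i + (w / circ r v) ^+ n * ckern v.
Proof.
have c0 : circ r v != 0 by rewrite -normc_gt0 normc_circ ?(ltW r0).
have q1 : 1 - w / circ r v != 0.
  apply: contraNneq (circ_sub_neq0 v) => E.
  have -> : circ r v - w = (1 - w / circ r v) * circ r v by field.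
  by rewrite E mul0r.
have kE : ckern v = (1 - w / circ r v)^-1.
  by rewrite /ckern; field; rewrite circ_sub_neq0 c0.
rewrite kE.
have -> : \sum_(i < n) w ^+ i * (circ r v)^-1 ^+ i = \sum_(i < n) (w / circ r v) ^+ i.
  by apply: eq_bigr => i _; rewrite exprMn.
have := subrX1 (w / circ r v) n.
move: (w / _) q1 (\sum_(_ < _) _) => q q1 s H.
apply: (mulIf q1); rewrite mulrDl mulVf// -mulrA mulVf// mulr1.
have -> : s * (1 - q) = - ((q - 1) * s) by ring.
by rewrite -H; ring.
Qed.

Let q := normc w / r.
Let q01 : 0 <= q < 1.
Proof. by rewrite divr_ge0 ?normc_ge0 ?ltW//= ltr_pdivrMr// mul1r. Qed.

Let normq v : normc (w / circ r v) = q.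
Proof. by rewrite normcM normcV normc_circ// ltW. Qed.

Let cw (F : R -> R[i]) n : ccont F -> ccont (fun v => w ^+ n * (F v * (circ r v)^-1 ^+ n)).
Proof.
move=> cF; apply: ccontM; first exact: ccont_cst.
apply: ccontM => //; apply: (@ccont_comp _ (fun z => z^-1 ^+ n)); last exact: ccont_circ.
move=> t; have c0 : circ r t != 0 by rewrite -normc_gt0 normc_circ ?(ltW r0).
have h := wirt_cplx_chain (wirt_exp n _) (wirt_inv c0).
by eexists; eexists; exact: h.
Qed.

(** The geometric expansion is integrated against [F]. With [F = 1] this evaluates the integral of
    [ckern]; with [F] a holomorphic function on the circle it is the Taylor expansion with
    remainder. *)
Lemma cint_ckern_expand (F : R -> R[i]) (M : R) n : ccont F ->
  (forall v, 0 <= v <= 1 -> normc (F v) <= M) ->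
  normc (cint (fun v => F v * ckern v) 0 1 -
    \sum_(i < n) w ^+ i * cint (fun v => F v * (circ r v)^-1 ^+ i) 0 1)
  <= 2 * (M * (r / (r - normc w)) * q ^+ n).
Proof.
move=> cF FM.
have N1 : -1 < 0 :> R by rewrite ltrN10.
have cX i : ccont (fun v => F v * (circ r v)^-1 ^+ i).
  apply: ccontM => //; apply: (@ccont_comp _ (fun z => z^-1 ^+ i)); last exact: ccont_circ.
  move=> t; have c0 : circ r t != 0 by rewrite -normc_gt0 normc_circ ?(ltW r0).
  have h := wirt_cplx_chain (wirt_exp i _) (wirt_inv c0).
  by eexists; eexists; exact: h.
have -> : \sum_(i < n) w ^+ i * cint (fun v => F v * (circ r v)^-1 ^+ i) 0 1 =
    cint (fun v => \sum_(i < n) w ^+ i * (F v * (circ r v)^-1 ^+ i)) 0 1.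
  rewrite (cint_sum _ (fun i => cw i cF))//.
  by apply: eq_bigr => i _; rewrite cintZ.
have cs : ccont (fun v => \sum_(i < n) w ^+ i * (F v * (circ r v)^-1 ^+ i)).
  exact: ccont_sum (fun i => cw i cF).
have ck : ccont (fun v => F v * ckern v) by apply: ccontM => //; exact: ccont_ckern.
rewrite -[X in _ - X]mul1r -mulNr -cintZ// -cintD//; last first.
  by apply: ccontM => //; exact: ccont_cst.
apply: (@le_trans _ _ (2 * (M * (r / (r - normc w)) * q ^+ n) * (1 - 0))); last first.
  by rewrite subr0 mulr1.
apply: cint_le => //.
  by apply: ccontD => //; apply: ccontM => //; exact: ccont_cst.
move=> t t01; rewrite {1}(ckern_expand n t) mulrDr mulr_sumr mulN1r.
rewrite (_ : \sum_(i < n) F t * _ = \sum_(i < n) w ^+ i * (F t * (circ r t)^-1 ^+ i)).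
  rewrite addrAC subrr add0r normcM (normcM _ (ckern t)) normcX normq (mulrC (q ^+ n)) [leLHS]mulrA.
  rewrite ler_wpM2r ?exprn_ge0//; first by case/andP: q01.
  by rewrite ler_pM ?normc_ge0 ?FM// ckern_le.
by apply: eq_bigr => i _; ring.
Qed.

Lemma cint_ckern : cint ckern 0 1 = 1.
Proof.
apply/eqP; rewrite -subr_eq0; apply/eqP/normc_le0 => e e0.
have [c0] : 0 <= r / (r - normc w) by rewrite divr_ge0 ?ltW// subr_gt0.
set c := r / _ in c0.
have [N hN] := @pow_small R q (e / (2 * (c + 1))) q01 (divr_gt0 e0 (mulr_gt0 (ltr0Sn R 1) (ltr_wpDl c0 ltr01))).
have := @cint_ckern_expand (fun=> 1) 1 N.+1 (ccont_cst 1).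
rewrite mul1r -/c (_ : (fun v => 1 * ckern v) = ckern); last by apply/funext => v; rewrite mul1r.
rewrite big_ord_recl/= big1 ?addr0 => [|i _]; last first.
  rewrite (_ : (fun v => _) = fun v => (circ r v)^-1 ^+ i.+1).
    by rewrite cint_circX// mulr0.
  by apply/funext => v; rewrite mul1r.
rewrite (_ : (fun v => _) = fun v => (circ r v)^-1 ^+ 0); last first.
  by apply/funext => v; rewrite mul1r.
rewrite cint_circX// mulr1 expr0 => H; apply: le_trans (H _) _.
  by move=> _ _; rewrite Normc.normc1.
have := hN _ (leqnSn N); rewrite ltr_pdivlMr ?mulr_gt0 ?ltr_wpDl// => h.
have qn : 0 <= q ^+ N.+1 by rewrite exprn_ge0//; case/andP: q01.
apply: le_trans (ltW h); rewrite (_ : _ ^+ _ * _ = 2 * (c * q ^+ N.+1) + 2 * q ^+ N.+1); last by ring.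
by rewrite lerDl mulr_ge0.
Qed.

(** The circle is shrunk homothetically towards [w]. By [Goursat_square] for [f(z) / (z - w)] the
    integral keeps its value, and it tends to [f w] times the integral of [ckern], which is 1. *)
Lemma Cauchy_formula f : chol f -> cint (fun v => f (circ r v) * ckern v) 0 1 = f w.
Proof.
move=> hf.
have N1 : -1 < 0 :> R by rewrite ltrN10.
pose psi v := circ r v - w.
have psi_le v : normc (psi v) <= 2.
  apply: le_trans (normcB _ _) _; rewrite normc_circ ?(ltW r0)//; move: wr r1; lra.
have dpsi v : cder psi v (tpi * circ r v).
  have := cderD (cder_circ r v) (cder_cst (- w) v); rewrite addr0.
  exact.
have disk l v : 0 < l -> l <= 1 -> normc (w + l%:C * psi v) < 1.
  move=> l0 l1; rewrite (_ : _ + _ = (1 - l)%:C * w + l%:C * circ r v); last first.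
    by rewrite /psi rmorphB rmorph1; ring.
  apply: le_lt_trans (normcD _ _) _.
  rewrite (normcM _ w) (normcM _ (circ r v)) !normc_real normc_circ ?(ltW r0)//.
  rewrite (ger0_norm (ltW l0)) ger0_norm ?subr_ge0//.
  apply: (@le_lt_trans _ _ ((1 - l) * r + l * r)).
    by rewrite lerD2r ler_wpM2l ?subr_ge0 ?(ltW wr).
  by rewrite -mulrDl subrK mul1r.
have cpt l : 0 < l -> l <= 1 -> ccont (fun v => f (w + l%:C * psi v)).
  move=> l0 l1; apply: ccont_comp => [t|].
    by have [a fa] := hf _ (disk l t l0 l1); exists a, 0.
  apply: cder_cont => t; eexists.
  exact: cderD (cder_cst w t) (cderZ l%:C (dpsi t)).
have key l : 0 < l -> l <= 1 ->
    cint (fun v => f (circ r v) * ckern v) 0 1 =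
    cint (fun v => f (w + l%:C * psi v) * ckern v) 0 1.
  move=> l0 l1.
  (* The circle is contracted to w along [l ^ (u ^ 2)], which is at most 1 for all real u. *)
  pose la u := expR (u * u * ln l).
  have la01 u : 0 < la u <= 1.
    rewrite expR_gt0/= -expR0 ler_expR mulr_ge0_le0//; first by rewrite -expr2 sqr_ge0.
    exact: ln_le0.
  have dla u : cder (fun s => (la s)%:C) u ((2 * u * ln l * la u)%:C).
    have d1 := cderM (cder_real_id u) (cder_real_id u).
    have d2 := cderZ (ln l)%:C d1.
    have d3 := cder_hol (wirt_cexp _) d2.
    rewrite (_ : (2 * u * ln l * la u)%:C = cexp ((ln l)%:C * (u%:C * u%:C)) * ((ln l)%:C * (1 * u%:C + u%:C * 1))).
      apply: cder_eq d3 => s; rewrite /cexp -!rmorphM/= cos0 sin0 /la (mulrC (ln l)).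
      by simpc.
    rewrite /cexp -!rmorphM/= cos0 sin0 /la (mulrC (ln l) (u * u)) mulr1.
    rewrite -rmorphD -rmorphM mul1r.
    by simpc; congr (_ +i* _); ring.
  pose P u v := w + (la u)%:C * psi v.
  pose Pu u v := (2 * u * ln l * la u)%:C * psi v.
  pose Pv u v := (la u)%:C * (tpi * circ r v).
  have laE u : normc (la u)%:C <= 1.
    by have /andP[/ltW h1 h2] := la01 u; rewrite normc_real ger0_norm.
  pose L := Num.max (`|2 * ln l| * 2) (2 * pi) : R.
  pose G z := f z / (z - w).
  have Pw u v : P u v - w != 0.
    rewrite /P addrC addKr mulf_neq0 ?circ_sub_neq0//.
    rewrite -normc_gt0 normc_real normr_gt0 gt_eqF//.
    by have /andP[] := la01 u.
  have := @Goursat_square R G P Pu Pv L.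
  (* The two edges that follow the contraction coincide, the circle being closed, and cancel. *)
  have -> : (fun u => G (P u 0) * Pu u 0) = (fun u => G (P u 1) * Pu u 1).
    by apply/funext => u; rewrite /P /Pu /psi circ01.
  have GE u v : G (P u v) * Pv u v = tpi * (f (P u v) * ckern v).
    have := Pw u v; rewrite /G /Pv /ckern {1 3}/P addrC addKr => h.
    move: h; rewrite mulf_eq0 negb_or => /andP[h1 h2]; rewrite -/(psi v).
    by field; rewrite h1 h2.
  have -> : (fun v => G (P 1 v) * Pv 1 v) = (fun v => tpi * (f (w + l%:C * psi v) * ckern v)).
    by apply/funext => v; rewrite GE /P /la !mul1r lnK.
  have -> : (fun v => G (P 0 v) * Pv 0 v) = (fun v => tpi * (f (circ r v) * ckern v)).
    apply/funext => v; rewrite GE /P /la !mul0r expR0 mul1r /psi.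
    by rewrite addrC subrK.
  have ck := ccont_ckern.
  rewrite !cintZ//; last 2 first.
  - apply: ccontM => //; have := cpt 1 ltr01 (lexx _).
    rewrite (_ : (fun v => f _) = fun v => f (circ r v))//.
    by apply/funext => v; rewrite mul1r /psi addrC subrK.
  - by apply: ccontM => //; exact: cpt.
  move=> H; have {}H : _ = 0 := H _ _ _ _ _ _ _.
  have E : tpi * (cint (fun v => f (w + l%:C * psi v) * ckern v) 0 1 -
     cint (fun v => f (circ r v) * ckern v) 0 1) = 0.
    rewrite -[RHS]H; first by ring.
    - move=> u v; have := cderD (cder_cst w u) (cderM (dla u) (cder_cst (psi v) u)).
      by rewrite add0r mulr0 addr0.
    - move=> u v; have := cderD (cder_cst w v) (cderZ (la u)%:C (dpsi v)).
      by rewrite add0r.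
    - move=> v; apply: cder_cont => u; rewrite /Pu.
      have := cderM (cderM (cder_real_id u) (cderZ (2 * ln l)%:C (dla u))) (cder_cst (psi v) u).
      move=> h; eexists; apply: cder_eq h => s; congr (_ * _).
      by rewrite -!rmorphM/=; congr (_%:C); ring.
    - move=> u; apply: cder_cont => v; eexists.
      exact: cderZ (cderZ _ (cder_circ r v)).
    - move=> u v /andP[u0 u1] _; rewrite /Pu normcM normc_real le_max; apply/orP; left.
      have /andP[h1 h2] := la01 u.
      rewrite ler_pM ?normc_ge0//.
      rewrite (_ : 2 * u * ln l * la u = (2 * ln l) * (u * la u)); last by ring.
      rewrite normrM ler_piMr// ger0_norm; first by rewrite mulr_ile1 ?(ltW h1).
      by rewrite mulr_ge0 ?(ltW h1).
    - move=> u v _ _; rewrite /Pv normcM le_max; apply/orP; right.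
      rewrite -[leRHS]mul1r ler_pM ?normc_ge0// (normcM tpi) (normcM _ 'i%C) normc_Ci mulr1.
      rewrite normc_real gtr0_norm ?mulr_gt0 ?pi_gt0// normc_circ ?(ltW r0)//.
      by rewrite ler_piMr ?mulr_ge0 ?pi_ge0// ltW.
    - move=> u v; have /andP[h1 h2] := la01 u.
      have [a fa] := hf _ (disk _ v h1 h2).
      have w1 := wirt_sub (wirt_id (P u v)) (wirt_cst w (P u v)).
      rewrite !subr0 in w1.
      by eexists; exact: (wirt_div (g := fun z => z - w) (Pw u v) fa w1).
  move/eqP: E; rewrite mulf_eq0 (negbTE tpi_neq0)/= subr_eq0 => /eqP ->//.
apply/eqP; rewrite -subr_eq0; apply/eqP/normc_le0 => e e0.
have c0 : 0 <= r / (r - normc w) by rewrite divr_ge0 ?ltW// subr_gt0.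
set c := r / _ in c0.
have c1 : 0 < 2 * (c + 1) by rewrite mulr_gt0// ltr_wpDl.
have [a fa] := hf w (lt_trans wr r1).
have [d d0 hd] := wirt_cont fa (divr_gt0 e0 c1).
(* As [psi] is bounded by 2, the shrunk circle stays within [d / 2] of [w]. *)
pose l := Num.min 1 (d / 4).
have l0 : 0 < l by rewrite lt_min ltr01 divr_gt0.
have l1 : l <= 1 by rewrite ge_min lexx.
rewrite (key l)//.
have -> : f w = f w * cint ckern 0 1 by rewrite cint_ckern mulr1.
have ck := ccont_ckern.
rewrite -mulNr -cintZ// -cintD//; last 2 first.
- by apply: ccontM => //; exact: cpt.
- by apply: ccontM => //; exact: ccont_cst.
apply: (@le_trans _ _ (2 * (e / (2 * (c + 1)) * c) * (1 - 0))).
  apply: cint_le => //.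
    apply: ccontD; first by apply: ccontM => //; exact: cpt.
    by apply: ccontM => //; exact: ccont_cst.
  move=> t _; rewrite mulNr -mulrBl normcM ler_pM ?normc_ge0 ?ckern_le//.
  apply: hd; rewrite normcM normc_real gtr0_norm//.
  apply: (@le_lt_trans _ _ (d / 4 * 2)); last lra.
  by rewrite ler_pM ?normc_ge0 ?(ltW l0)// ge_min lexx orbT.
rewrite subr0 mulr1 (_ : 2 * _ = e * (c / (c + 1))); last by field; rewrite gt_eqF ?ltr_wpDl.
by rewrite ler_piMr ?(ltW e0)// ler_pdivrMr ?mul1r ?lerDl ?ltr_wpDl.
Qed.

End CauchyFormula.
End Cauchy.

(** * Sequences of holomorphic functions and power series *)

Section Convergence.
Context {R : realType}.

Definition clim (u : nat -> R[i]) (l : R[i]) :=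
  forall e : R, 0 < e -> exists N, forall n, (N <= n)%N -> normc (u n - l) <= e.

Lemma clim_uniq u l l' : clim u l -> clim u l' -> l = l'.
Proof.
move=> h1 h2; apply/eqP; rewrite -subr_eq0; apply/eqP/normc_le0 => e e0.
have e20 : 0 < e / 2 by rewrite divr_gt0.
have [N1 H1] := h1 _ e20; have [N2 H2] := h2 _ e20.
have := H1 (maxn N1 N2) (leq_maxl _ _); have := H2 (maxn N1 N2) (leq_maxr _ _).
move: (u _) => x k1 k2.
have := normcB (x - l') (x - l).
rewrite (_ : x - l' - (x - l) = l - l'); last by ring.
lra.
Qed.

Lemma clim_Re u l : clim u l -> complex.Re (u n) @[n --> \oo] --> complex.Re l.
Proof.
move=> h; apply/cvgrPdist_le => e /h[N H]; exists N => // n /= /H.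
by rewrite normcBC; apply: le_trans; rewrite -ReB; exact: normc_ge_Re.
Qed.

Lemma real_cauchy (u : nat -> R) :
  (forall e, 0 < e -> exists N, forall n m, (N <= n)%N -> (N <= m)%N -> `|u n - u m| <= e) ->
  exists l, forall e, 0 < e -> exists N, forall n, (N <= n)%N -> `|u n - l| <= e.
Proof.
move=> H; have : cvg (u @ \oo).
  apply: cauchy_cvg; apply: cauchy_exP => e e0.
  have e20 : 0 < e / 2 by rewrite divr_gt0.
  have [N HN] := H _ e20; exists (u N); exists N => // n /= Nn.
  apply: le_lt_trans (HN _ _ _ Nn) _ => //.
  by rewrite ltr_pdivrMr// mulr_natr mulr2n ltrDl.
move=> /cvg_ex[l /cvgrPdist_le hl]; exists l => e /hl[N _ HN].
by exists N => n /HN; rewrite distrC.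
Qed.

Lemma clim_cauchy (u : nat -> R[i]) :
  (forall e : R, 0 < e -> exists N, forall n m, (N <= n)%N -> (N <= m)%N ->
     normc (u n - u m) <= e) -> exists l, clim u l.
Proof.
move=> H.
have [|a ha] := @real_cauchy (fun n => complex.Re (u n)).
  move=> e /H[N HN]; exists N => n m nN mN; apply: le_trans (HN n m nN mN).
  by rewrite -ReB; exact: normc_ge_Re.
have [|b hb] := @real_cauchy (fun n => complex.Im (u n)).
  move=> e /H[N HN]; exists N => n m nN mN; apply: le_trans (HN n m nN mN).
  by rewrite -ImB; exact: normc_ge_Im.
exists (a +i* b) => e e0; have e20 : 0 < e / 2 by rewrite divr_gt0.
have [N1 H1] := ha _ e20; have [N2 H2] := hb _ e20.
exists (maxn N1 N2) => n; rewrite geq_max => /andP[/H1{}H1 /H2{}H2].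
apply: le_trans (normc_le_ReIm _) _; rewrite ReB ImB /= (splitr e).
exact: lerD.
Qed.

Lemma clim_norm_le u l (M : R) : clim u l ->
  (exists N, forall n, (N <= n)%N -> normc (u n) <= M) -> normc l <= M.
Proof.
move=> h [N HN]; apply/ler_addgt0Pr => e e0; have [N' H'] := h e e0.
have := HN _ (leq_maxl N N'); have := H' _ (leq_maxr N N').
move: (u _) => x k1 k2; have := normcB x (x - l); rewrite opprB addrC subrK; lra.
Qed.

Lemma climD u v l m : clim u l -> clim v m -> clim (fun n => u n + v n) (l + m).
Proof.
move=> hu hv e e0; have e20 : 0 < e / 2 by rewrite divr_gt0.
have [N1 H1] := hu _ e20; have [N2 H2] := hv _ e20.
exists (maxn N1 N2) => n; rewrite geq_max => /andP[/H1{}H1 /H2{}H2].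
rewrite (_ : _ - _ = (u n - l) + (v n - m)); last by ring.
by rewrite (le_trans (normcD _ _))// (splitr e) lerD.
Qed.

Lemma climZ c u l : clim u l -> clim (fun n => c * u n) (c * l).
Proof.
move=> hu e e0; have c0 : 0 < normc c + 1 by rewrite ltr_wpDl ?normc_ge0.
have [N H] := hu _ (divr_gt0 e0 c0); exists N => n /H.
rewrite ler_pdivlMr// => h; rewrite -mulrBr normcM; apply: le_trans h.
by rewrite mulrC ler_wpM2l ?normc_ge0// lerDl.
Qed.

Lemma clim_cst c : clim (fun=> c) c.
Proof. by move=> e e0; exists 0%N => n _; rewrite subrr Normc.normc0 ltW. Qed.

(* Locally uniform convergence on the unit disk. *)
Definition luc (fn : nat -> R[i] -> R[i]) (f : R[i] -> R[i]) :=
  forall rho e : R, rho < 1 -> 0 < e -> exists N, forall n, (N <= n)%N ->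
    forall w, normc w < rho -> normc (fn n w - f w) <= e.

Lemma between (x y : R) : x < y -> x < (x + y) / 2 < y.
Proof. by move=> xy; apply/andP; split; lra. Qed.

Lemma luc_clim fn f w : luc fn f -> normc w < 1 -> clim (fun n => fn n w) (f w).
Proof.
move=> h w1 e e0; have /andP[h1 h2] := between w1.
by have [N HN] := h _ _ h2 e0; exists N => n /HN; exact.
Qed.

End Convergence.

(** * Cauchy estimates and limits of holomorphic functions *)

Section CauchyEstimates.
Context {R : realType}.

Lemma ccont_circ_comp f (r : R) : chol f -> 0 <= r -> r < 1 -> ccont (fun v => f (circ r v)).
Proof.
move=> hf r0 r1; apply: ccont_comp; last exact: ccont_circ.
by move=> t; have [a fa] := hf (circ r t) (eq_rect _ (fun x => x < 1) r1 _ (esym (normc_circ t r0))); exists a, 0.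
Qed.

Lemma chol_bound_circ f (r : R) : chol f -> 0 <= r -> r < 1 ->
  exists2 M, 0 <= M & forall v, 0 <= v <= 1 -> normc (f (circ r v)) <= M.
Proof.
move=> hf r0 r1; have cf := ccont_circ_comp hf r0 r1.
have cn : continuous (fun v => normc (f (circ r v))).
  apply: cont_ReP => t e /(cf t)[d d0 H]; exists d => // s /H.
  apply: le_trans; rewrite ler_norml; apply/andP; split.
    have := normcB (f (circ r (t + s))) (f (circ r (t + s)) - f (circ r t)).
    rewrite opprB addrC subrK; lra.
  have := normcD (f (circ r (t + s)) - f (circ r t)) (f (circ r t)).
  rewrite subrK; lra.
have [c _ hc] := EVT_max ler01 (continuous_subspaceT cn).
exists (normc (f (circ r c))); first exact: normc_ge0.
by move=> v v01; apply: hc; rewrite in_itv.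
Qed.

(** Stands in for the maximum principle: Cauchy's formula, with the kernel bounded by
    [1 / (r - rho)]. *)
Lemma chol_bound_of_circ f (w : R[i]) (rho r M : R) : chol f -> normc w < rho -> rho < r -> r < 1 ->
  (forall v, 0 <= v <= 1 -> normc (f (circ r v)) <= M) ->
  normc (f w) <= 2 * (M / (r - rho)).
Proof.
move=> hf wrho rr r1 fM; have wr := lt_trans wrho rr.
have r0 : 0 < r by rewrite (le_lt_trans _ wr)// normc_ge0.
have M0 : 0 <= M by apply: le_trans (normc_ge0 _) (fM 0 _); rewrite lexx ler01.
rewrite -(Cauchy_formula wr r1 hf) -[leRHS]mulr1 -[X in _ <= _ * X](subr0 1).
apply: cint_le => //; last first.
- move=> t t01; rewrite normcM ler_pM ?normc_ge0 ?fM//.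
  apply: le_trans (ckern_le wr _) _.
  rewrite -[leRHS]mul1r ler_pM ?(ltW r0) ?(ltW r1)// ?invr_ge0 ?subr_ge0 ?(ltW wr)//.
  by rewrite lef_pV2 ?posrE ?subr_gt0// lerB// ltW.
- apply: ccontM; last exact: ccont_ckern.
  exact: ccont_circ_comp (ltW r0) r1.
Qed.

Lemma chol_bounded f (rho : R) : chol f -> rho < 1 ->
  exists2 M, 0 <= M & forall w, normc w < rho -> normc (f w) <= M.
Proof.
move=> hf rho1; have [rho0|rho0] := leP rho 0.
  exists 0 => // w /lt_le_trans/(_ rho0); rewrite ltNge normc_ge0//.
have /andP[h1 h2] := between rho1; set r := (rho + 1) / 2 in h1 h2.
have r0 : 0 <= r by rewrite ltW// (lt_trans rho0).
have [M M0 HM] := chol_bound_circ hf r0 h2.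
exists (2 * (M / (r - rho))); first by rewrite mulr_ge0// divr_ge0// subr_ge0 ltW.
by move=> w wr; exact: chol_bound_of_circ HM.
Qed.

(** For [zeta] on the circle, [1/(zeta - w - k) - 1/(zeta - w) - k/(zeta - w)^2] is
    [k^2 / ((zeta - w)^2 (zeta - w - k))], so the remainder after the linear term is quadratic, with
    a constant depending only on [M] and the radii. This uniformity carries differentiability to
    limits in [Weierstrass]. *)
Lemma Cauchy_estimate f (rho r M : R) (w a : R[i]) : chol f -> normc w < rho -> rho < r -> r < 1 ->
  (forall v, 0 <= v <= 1 -> normc (f (circ r v)) <= M) -> wirt f w a 0 ->
  normc a <= 2 * (M / (r - rho) ^+ 3) /\
  forall k, normc (w + k) < rho ->
    normc (f (w + k) - f w - a * k) <= 2 * (M / (r - rho) ^+ 3) * normc k ^+ 2.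
Proof.
move=> hf wrho rr r1 fM fa; have wr := lt_trans wrho rr.
have r0 : 0 < r by rewrite (le_lt_trans _ wr)// normc_ge0.
have M0 : 0 <= M by apply: le_trans (normc_ge0 _) (fM 0 _); rewrite lexx ler01.
have cf := ccont_circ_comp hf (ltW r0) r1.
have N1 : -1 < 0 :> R by rewrite ltrN10.
have s0 : 0 < r - rho by rewrite subr_gt0.
have cinv x : normc x < rho -> ccont (fun v => (circ r v - x)^-1).
  move=> xrho; have xr := lt_trans xrho rr.
  apply: (@ccont_comp _ (fun z => (z - x)^-1)); last exact: ccont_circ.
  move=> t; have w1 := wirt_sub (wirt_id (circ r t)) (wirt_cst x (circ r t)).
  have w2 := wirt_chain (f := fun z => z - x) (wirt_inv (circ_sub_neq0 xr t)) w1.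
  by eexists; eexists; exact: w2.
have binv x v : normc x < rho -> normc (circ r v - x)^-1 <= (r - rho)^-1.
  move=> xrho; have xr := lt_trans xrho rr.
  rewrite normcV lef_pV2 ?posrE ?normc_gt0 ?circ_sub_neq0//.
  by apply: le_trans (circ_sub_ge xr v); rewrite lerB// ltW.
(* Cauchy's formula for the derivative; it equals [a] by [wirt_uniq], once its quadratic remainder
   is bounded. *)
pose D := cint (fun v => f (circ r v) * (circ r v * (circ r v - w)^-1 ^+ 2)) 0 1.
have cD : ccont (fun v => f (circ r v) * (circ r v * (circ r v - w)^-1 ^+ 2)).
  apply: ccontM => //; apply: ccontM; first exact: ccont_circ.
  by under eq_fun do rewrite expr2; apply: ccontM; exact: cinv.
have bc v : 0 <= v <= 1 -> normc (f (circ r v) * circ r v) <= M.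
  move=> v01; rewrite normcM normc_circ ?(ltW r0)// -[leRHS]mulr1.
  by rewrite ler_pM ?normc_ge0 ?fM ?(ltW r0) ?(ltW r1).
have main k : normc (w + k) < rho ->
    normc (f (w + k) - f w - D * k) <= 2 * (M / (r - rho) ^+ 3) * normc k ^+ 2.
  move=> wk; have wkr := lt_trans wk rr.
  rewrite -(Cauchy_formula wr r1 hf) -(Cauchy_formula wkr r1 hf) (mulrC D).
  have ck1 := ccontM cf (ccont_ckern wkr); have ck2 := ccontM cf (ccont_ckern wr).
  have c2 : ccont (fun t => -1 * (f (circ r t) * ckern w r t)).
    by apply: ccontM => //; exact: ccont_cst.
  have c3 : ccont (fun t => - k * (f (circ r t) * (circ r t * (circ r t - w)^-1 ^+ 2))).
    by apply: ccontM => //; exact: ccont_cst.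
  have c12 := ccontD ck1 c2.
  rewrite -mulNr -[X in _ - X + _]mul1r -mulNr -!cintZ// -!cintD//.
  rewrite -[leRHS]mulr1 -[X in _ <= _ * X](subr0 1) -mulrA.
  apply: cint_le => //.
    exact: ccontD.
  move=> t t01.
  have n1 := circ_sub_neq0 wr t; have n2 := circ_sub_neq0 wkr t.
  rewrite /ckern (_ : _ + _ = (f (circ r t) * circ r t) *
    ((circ r t - w)^-1 * (circ r t - w)^-1 * (circ r t - (w + k))^-1) * k ^+ 2); last first.
    by field; rewrite n1 n2.
  rewrite normcM normcX ler_wpM2r ?sqr_ge0// normcM ler_pM ?normc_ge0 ?bc//.
  rewrite !normcM -exprVn !exprS expr0 mulr1 mulrA.
  by rewrite !ler_pM ?mulr_ge0 ?normc_ge0 ?binv.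
have aD : a = D.
  suff : wirt f w D 0 by move=> /(wirt_uniq fa)[].
  move=> e e0; set C := 2 * _ in main.
  have C0 : 0 <= C by rewrite mulr_ge0// divr_ge0// exprn_ge0// ltW.
  exists (Num.min (rho - normc w) (e / (C + 1))).
    by rewrite lt_min subr_gt0 wrho divr_gt0// ltr_wpDl.
  move=> k; rewrite lt_min => /andP[k1]; rewrite ltr_pdivlMr ?ltr_wpDl// => k2.
  rewrite mul0r addr0; apply: le_trans (main k _) _.
    by apply: le_lt_trans (normcD _ _) _; lra.
  rewrite expr2 mulrA ler_wpM2r ?normc_ge0//.
  apply: le_trans (ltW k2); rewrite mulrC ler_wpM2l ?normc_ge0//; lra.
split; last by move=> k /main; rewrite aD.
rewrite aD -[leRHS]mulr1 -[X in _ <= _ * X](subr0 1).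
apply: cint_le => // t t01; rewrite mulrA normcM ler_pM ?normc_ge0 ?bc//.
rewrite expr2 normcM -exprVn.
apply: (@le_trans _ _ ((r - rho)^-1 * (r - rho)^-1)).
  by rewrite ler_pM ?normc_ge0 ?binv.
rewrite !exprS expr0 mulr1 mulrA ler_peMr ?mulr_ge0 ?invr_ge0 ?(ltW s0)//.
rewrite invf_ge1//; have := normc_ge0 w; lra.
Qed.

(** The first-order estimate, applied to differences [fn n - fn m], makes the derivatives locally
    uniformly Cauchy. The quadratic remainder bound, uniform in [n], survives in the limit and shows
    that the limit of the derivatives is the derivative of [f]. *)
Lemma Weierstrass (fn gn : nat -> R[i] -> R[i]) f : luc fn f ->
  (forall n w, normc w < 1 -> wirt (fn n) w (gn n w) 0) ->
  exists2 g, (forall w, normc w < 1 -> wirt f w (g w) 0) & luc gn g.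
Proof.
move=> hl hg.
have hol n : chol (fn n) by move=> w w1; exists (gn n w); exact: hg.
have gC rho e : rho < 1 -> 0 < e -> exists N, forall n m, (N <= n)%N -> (N <= m)%N ->
    forall w, normc w < rho -> normc (gn n w - gn m w) <= e.
  move=> rho1 e0; have [rho0|rho0] := leP rho 0.
    by exists 0%N => n m _ _ w /lt_le_trans/(_ rho0); rewrite ltNge normc_ge0.
  have /andP[h1 h2] := between rho1; set r := (rho + 1) / 2 in h1 h2.
  have /andP[h3 h4] := between h2; set r' := (r + 1) / 2 in h3 h4.
  have s0 : 0 < r - rho by rewrite subr_gt0.
  have r0 : 0 <= r by rewrite ltW// (lt_trans rho0).
  pose e' := e * (r - rho) ^+ 3 / 4.
  have e'0 : 0 < e' by rewrite divr_gt0// mulr_gt0// exprn_gt0.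
  have [N HN] := hl _ _ h4 e'0; exists N => n m nN mN w wrho.
  have wf := wirt_sub (hg n w (lt_trans wrho rho1)) (hg m w (lt_trans wrho rho1)).
  rewrite subr0 in wf.
  have hol' : chol (fun x => fn n x - fn m x).
    move=> z z1; eexists; have := wirt_sub (hg n z z1) (hg m z z1); rewrite subr0.
    exact.
  have [|H _] := @Cauchy_estimate _ rho r (2 * e') w _ hol' wrho h1 h2 _ wf.
    move=> v _; have cr : normc (circ r v) < r' by rewrite normc_circ.
    have := HN n nN _ cr; have := HN m mN _ cr => k1 k2.
    have := normcB (fn n (circ r v) - f (circ r v)) (fn m (circ r v) - f (circ r v)).
    rewrite (_ : _ - (_ - _) = fn n (circ r v) - fn m (circ r v)); last by ring.
    lra.
  apply: le_trans H _; apply: eqW; rewrite /e'; field.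
  by rewrite gt_eqF.
have [g hgl] : exists g, forall w, normc w < 1 -> clim (fun n => gn n w) (g w).
  suff /choice[g Hg] : forall w, exists l, normc w < 1 -> clim (fun n => gn n w) l by exists g.
  move=> w; have [w1|w1] := ltP (normc w) 1; last by exists 0.
  have [|l hl'] := @clim_cauchy _ (fun n => gn n w); last by exists l.
  move=> e e0; have /andP[h1 h2] := between w1; have [N HN] := gC _ _ h2 e0.
  by exists N => n m nN mN; exact: HN.
exists g; last first.
  move=> rho e rho1 e0; have [N HN] := gC _ _ rho1 e0; exists N => n nN w wrho.
  have := climD (clim_cst (gn n w)) (climZ (-1) (hgl w (lt_trans wrho rho1))).
  rewrite mulN1r => /clim_norm_le; apply; exists N => m mN.
  by rewrite mulN1r; exact: HN.
move=> w w1.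
have /andP[h0 h] := between w1; set rho := (_ + 1) / 2 in h0 h.
have /andP[h1 h2] := between h; set r := (rho + 1) / 2 in h1 h2.
have /andP[h3 h4] := between h2; set r' := (r + 1) / 2 in h3 h4.
have s0 : 0 < r - rho by rewrite subr_gt0.
have r0 : 0 <= r by rewrite ltW// (lt_trans _ h1)// (le_lt_trans _ h0)// normc_ge0.
have [N HN] := hl _ _ h4 ltr01.
have [M M0 HM] := chol_bound_circ (hol N) r0 h2.
(* [M] bounds [fn N] on the circle; from [N] on each [fn n] is within 1 of [f] there, hence within 2
   of [fn N]. *)
set C := 2 * ((M + 2) / (r - rho) ^+ 3).
have C0 : 0 <= C by rewrite mulr_ge0// divr_ge0 ?addr_ge0// exprn_ge0// ltW.
have key k : normc (w + k) < rho -> normc (f (w + k) - f w - g w * k) <= C * normc k ^+ 2.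
  move=> wk.
  have l1 := luc_clim hl (lt_trans wk h).
  have l2 := climZ (-1) (luc_clim hl w1).
  have l3 := climZ (- k) (hgl w w1).
  have := climD (climD l1 l2) l3; rewrite mulN1r mulNr (mulrC k) => /clim_norm_le; apply.
  exists N => n nN; rewrite mulN1r mulNr (mulrC k).
  have [|_ H] := @Cauchy_estimate (fn n) rho r (M + 2) w _ (hol n) h0 h1 h2 _ (hg n w w1).
    move=> v v01; have cr : normc (circ r v) < r' by rewrite normc_circ.
    have := HN n nN _ cr; have := HN N (leqnn _) _ cr; have := HM v v01 => k1 k2 k3.
    have := normcD (fn N (circ r v)) ((fn n (circ r v) - f (circ r v)) - (fn N (circ r v) - f (circ r v))).
    have := normcB (fn n (circ r v) - f (circ r v)) (fn N (circ r v) - f (circ r v)).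
    rewrite (_ : fn N (circ r v) + (fn n (circ r v) - f (circ r v) - (fn N (circ r v) - f (circ r v))) = fn n (circ r v)); last by ring.
    lra.
  exact: H.
move=> e e0; exists (Num.min (rho - normc w) (e / (C + 1))).
  by rewrite lt_min subr_gt0 h0 divr_gt0// ltr_wpDl.
move=> k; rewrite lt_min => /andP[k1]; rewrite ltr_pdivlMr ?ltr_wpDl// => k2.
rewrite mul0r addr0; apply: le_trans (key k _) _.
  by apply: le_lt_trans (normcD _ _) _; lra.
rewrite expr2 mulrA ler_wpM2r ?normc_ge0//.
apply: le_trans (ltW k2); rewrite mulrC ler_wpM2l ?normc_ge0//; lra.
Qed.

End CauchyEstimates.

(** * Power series on the unit disk *)

Section PowerSeries.
Context {R : realType}.
Implicit Types (a b : nat -> R[i]) (f g : R[i] -> R[i]).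

Lemma between_ex (x y : R) : x < y -> exists r, x < r /\ r < y.
Proof. by move=> /between/andP h; exists ((x + y) / 2). Qed.

Definition psum a n (w : R[i]) := \sum_(i < n) a i * w ^+ i.

Definition pseries a f := luc (psum a) f.

Lemma psumS a n w : psum a n.+1 w = psum a n w + a n * w ^+ n.
Proof. by rewrite /psum big_ord_recr. Qed.

(** By strong induction the partial sum of length [n + 1] reduces to its last term; dividing by
    [|w|^n] and letting [w] tend to 0 kills the coefficient. *)
Lemma coef_zero (c : nat -> R[i]) :
  (forall n, exists K d : R, [/\ 0 <= K, 0 < d & forall w, normc w < d ->
     normc (psum c n w) <= K * normc w ^+ n]) -> forall n, c n = 0.
Proof.
move=> H; elim/ltn_ind => n ih; apply: normc_le0 => e e0.
have [K [d [K0 d0 Hn]]] := H n.+1.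
pose t := Num.min (d / 2) (e / (K + 1)).
have t0 : 0 < t by rewrite lt_min !divr_gt0// ltr_wpDl.
have nt : normc (t%:C : R[i]) = t by rewrite normc_real gtr0_norm.
have td : normc (t%:C : R[i]) < d.
  by rewrite nt gt_min; apply/orP; left; lra.
have := Hn _ td; rewrite psumS /psum big1 ?add0r => [|i _]; last by rewrite ih ?mul0r.
rewrite normcM normcX nt exprS mulrA ler_pM2r ?exprn_gt0// => h.
apply: le_trans h _.
apply: (@le_trans _ _ (K * (e / (K + 1)))).
  by rewrite ler_wpM2l// ge_min lexx orbT.
rewrite mulrCA -[leRHS]mulr1 ler_wpM2l ?(ltW e0)// ler_pdivrMr ?mul1r ?lerDl ?ltr_wpDl//.
Qed.

Definition ccoef f (r : R) i := cint (fun v => f (circ r v) * (circ r v)^-1 ^+ i) 0 1.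

Lemma ccoef_expand f (r M : R) w n : chol f -> normc w < r -> r < 1 ->
  (forall v, 0 <= v <= 1 -> normc (f (circ r v)) <= M) ->
  normc (f w - psum (ccoef f r) n w) <= 2 * (M * (r / (r - normc w)) * (normc w / r) ^+ n).
Proof.
move=> hf wr r1 fM; have r0 : 0 < r := le_lt_trans (normc_ge0 w) wr.
have := cint_ckern_expand wr n (ccont_circ_comp hf (ltW r0) r1) fM.
rewrite (Cauchy_formula wr r1 hf) /psum.
by under eq_bigr do rewrite mulrC.
Qed.

(** Both coefficient sequences expand [f] at 0 up to [O(|w|^n)] for every [n], so [coef_zero]
    applies to their difference. Thus the coefficients taken at radius 1/2 also serve on larger
    disks, where convergence is proved with a circle further out. *)
Lemma ccoef_indep f (r s : R) i : chol f -> 0 < r < 1 -> 0 < s < 1 ->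
  ccoef f r i = ccoef f s i.
Proof.
move=> hf r01 s01; apply/eqP; rewrite -subr_eq0; apply/eqP; move: i.
have ex t n : 0 < t < 1 -> exists K d : R, [/\ 0 <= K, 0 < d & forall w, normc w < d ->
    normc (f w - psum (ccoef f t) n w) <= K * normc w ^+ n].
  move=> /andP[t0 t1]; have [M M0 HM] := chol_bound_circ hf (ltW t0) t1.
  exists (2 * (M * (t / (t / 2))) * t^-1 ^+ n), (t / 2); split.
  - by rewrite !mulr_ge0 ?invr_ge0 ?exprn_ge0 ?invr_ge0 ?mulr_ge0 ?(ltW t0)// invr_ge0.
  - by rewrite divr_gt0.
  move=> w wt; have wt' : normc w < t by lra.
  apply: le_trans (ccoef_expand n hf wt' t1 HM) _.
  rewrite expr_div_n -exprVn (mulrC (normc w ^+ n)) !mulrA ler_wpM2r ?exprn_ge0 ?normc_ge0//.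
  rewrite ler_wpM2r ?exprn_ge0 ?invr_ge0 ?(ltW t0)//.
  rewrite ler_wpM2l ?mulr_ge0 ?(ltW t0)// lef_pV2 ?posrE ?invr_gt0 ?divr_gt0 ?subr_gt0//.
  lra.
apply: coef_zero => n.
have [K [d [K0 d0 H]]] := ex r n r01; have [K' [d' [K'0 d'0 H']]] := ex s n s01.
exists (K + K'), (Num.min d d'); split; [exact: addr_ge0|by rewrite lt_min d0|].
move=> w; rewrite lt_min => /andP[/H h /H' h'].
have -> : psum (fun i => ccoef f r i - ccoef f s i) n w =
    psum (ccoef f r) n w - psum (ccoef f s) n w.
  by rewrite /psum -sumrB; apply: eq_bigr => i _; rewrite mulrBl.
have swap (x y z : R[i]) : x - y = (z - y) - (z - x) by ring.
rewrite (swap _ _ (f w)).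
apply: le_trans (normcB _ _) _; rewrite mulrDl addrC; exact: lerD.
Qed.

Let half01 : 0 < (1 / 2 : R) < 1.
Proof. by apply/andP; split; lra. Qed.

Lemma chol_pseries f : chol f -> exists a, pseries a f.
Proof.
move=> hf; exists (ccoef f (1 / 2)) => rho e rho1 e0.
have [rho0|rho0] := leP rho 0.
  by exists 0%N => n _ w /lt_le_trans/(_ rho0); rewrite ltNge normc_ge0.
have [r [h1 h2]] := between_ex rho1.
have r0 : 0 < r by rewrite (lt_trans rho0).
have [M M0 HM] := chol_bound_circ hf (ltW r0) h2.
set C := 2 * (M * (r / (r - rho))).
have C0 : 0 <= C by rewrite mulr_ge0// mulr_ge0// divr_ge0 ?(ltW r0)// subr_ge0 ltW.
have q01 : 0 <= rho / r < 1 by rewrite divr_ge0 ?ltW//= ltr_pdivrMr// mul1r.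
have [|N HN] := pow_small q01 (_ : 0 < e / (C + 1)); first by rewrite divr_gt0// ltr_wpDl.
exists N => n nN w wrho; have wr := lt_trans wrho h1.
rewrite (_ : ccoef f (1 / 2) = ccoef f r); last first.
  by apply/funext => i; apply: ccoef_indep; rewrite ?half01 ?r0 ?h2.
rewrite normcBC; apply: le_trans (ccoef_expand n hf wr h2 HM) _.
apply: (@le_trans _ _ (C * (rho / r) ^+ n)); last first.
  have := HN n nN; rewrite ltr_pdivlMr ?ltr_wpDl// => h.
  apply: le_trans (ltW h); rewrite mulrC ler_wpM2l ?lerDl// exprn_ge0//.
  by case/andP: q01.
have w0 := normc_ge0 w; have rw : 0 < r - normc w by rewrite subr_gt0.
rewrite /C -!mulrA ler_pM2l// ler_wpM2l//; apply: ler_pM.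
- by rewrite (ltW r0).
- by rewrite mulr_ge0 ?invr_ge0 ?(ltW rw)// exprn_ge0// divr_ge0// ltW.
- by [].
apply: ler_pM; rewrite ?invr_ge0 ?(ltW rw) ?exprn_ge0 ?divr_ge0 ?(ltW r0)//.
  by rewrite lef_pV2 ?posrE ?subr_gt0// lerB// ltW.
by rewrite lerXn2r ?nnegrE ?divr_ge0 ?(ltW r0) ?(ltW rho0)// ler_wpM2r ?invr_ge0 ?(ltW r0)// ltW.
Qed.

(** Radius of convergence at least 1, in Abel's form; by [pseries_bounded] and [pbounded_exists] it
    is equivalent to locally uniform convergence on the disk. *)
Definition pbounded a := forall rho : R, 0 <= rho < 1 ->
  exists2 K, 0 <= K & forall i, normc (a i) * rho ^+ i <= K.

Lemma luc_uniq (fn : nat -> R[i] -> R[i]) f g : luc fn f -> luc fn g ->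
  forall w, normc w < 1 -> f w = g w.
Proof. by move=> h1 h2 w w1; exact: clim_uniq (luc_clim h1 w1) (luc_clim h2 w1). Qed.

Lemma luc_shift (fn : nat -> R[i] -> R[i]) f : luc fn f <-> luc (fun n => fn n.+1) f.
Proof.
split=> h rho e rho1 e0; have [N HN] := h _ _ rho1 e0.
  by exists N => n nN; apply: HN; rewrite ltnW.
by exists N.+1 => -[//|n] nN; apply: HN.
Qed.

Lemma pseries_bounded a f : pseries a f -> pbounded a.
Proof.
move=> h rho /andP[rho0 rho1]; have /andP[h1 h2] := between rho1.
have [N HN] := h _ _ h2 ltr01.
have key i : (N <= i)%N -> normc (a i) * rho ^+ i <= 2.
  move=> iN; have nr : normc (rho%:C : R[i]) = rho by rewrite normc_real ger0_norm.
  have := HN i iN rho%:C; have := HN i.+1 (leqW iN) rho%:C; rewrite nr => /(_ h1) k1 /(_ h1) k2.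
  have := normcB (psum a i.+1 rho%:C - f rho%:C) (psum a i rho%:C - f rho%:C).
  rewrite psumS (_ : _ - _ = a i * rho%:C ^+ i); last by ring.
  rewrite normcM normcX nr; rewrite psumS in k1; lra.
exists (2 + \sum_(i < N) normc (a i)); first by rewrite addr_ge0// sumr_ge0// => i _; exact: normc_ge0.
move=> i; have [iN|iN] := leqP N i.
  by rewrite (le_trans (key i iN))// lerDl sumr_ge0// => j _; exact: normc_ge0.
apply: (@le_trans _ _ (normc (a i))).
  by rewrite ler_piMr ?normc_ge0// exprn_ile1// ltW.
rewrite (bigD1 (Ordinal iN))//= addrCA lerDl addr_ge0// sumr_ge0// => j _; exact: normc_ge0.
Qed.

Lemma psum_tail a (K s w0 : R) (w : R[i]) n m : 0 < s -> (forall i, normc (a i) * s ^+ i <= K) ->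
  normc w <= w0 -> w0 < s -> normc (psum a (n + m) w - psum a n w) <= K * (1 - w0 / s)^-1 * (w0 / s) ^+ n.
Proof.
move=> s0 aK ww ws; have w00 : 0 <= w0 by apply: le_trans ww; exact: normc_ge0.
have K0 : 0 <= K by apply: le_trans (aK 0%N); rewrite mulr_ge0 ?normc_ge0 ?exprn_ge0 ?ltW.
set q := w0 / s; have q01 : 0 <= q < 1 by rewrite divr_ge0 ?(ltW s0)//= ltr_pdivrMr// mul1r.
have /andP[q0 q1] := q01.
(* The sharper bound, by the finite geometric sum itself, is one that induction on [m] can carry. *)
suff H : normc (psum a (n + m) w - psum a n w) <= K * (1 - q)^-1 * (q ^+ n - q ^+ (n + m)).
  apply: le_trans H _; rewrite ler_wpM2l ?mulr_ge0 ?invr_ge0 ?subr_ge0 ?(ltW q1)//.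
  by rewrite lerBlDr lerDl exprn_ge0.
elim: m => [|m ih]; first by rewrite addn0 !subrr Normc.normc0 mulr0.
rewrite addnS psumS addrAC; apply: le_trans (normcD _ _) _.
have -> : K * (1 - q)^-1 * (q ^+ n - q ^+ (n + m).+1) =
   K * (1 - q)^-1 * (q ^+ n - q ^+ (n + m)) + K * q ^+ (n + m).
  by rewrite [q ^+ (n + m).+1]exprS; field; rewrite subr_eq0 eq_sym lt_eqF.
apply: lerD => //; rewrite normcM normcX.
apply: (@le_trans _ _ (normc (a (n + m)%N) * s ^+ (n + m) * q ^+ (n + m))); last first.
  by rewrite ler_wpM2r ?exprn_ge0.
rewrite -mulrA -exprMn ler_wpM2l ?normc_ge0// lerXn2r ?nnegrE ?normc_ge0//.
  by rewrite mulr_ge0 ?(ltW s0).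
by rewrite /q mulrC divfK// gt_eqF.
Qed.

Lemma pbounded_tail a (rho : R) : pbounded a -> 0 <= rho -> rho < 1 ->
  exists C q : R, [/\ 0 <= C, 0 <= q < 1 & forall n m w, normc w <= rho ->
    normc (psum a (n + m) w - psum a n w) <= C * q ^+ n].
Proof.
move=> ha rho0 rho1; have [s [h1 h2]] := between_ex rho1.
have s0 : 0 < s by rewrite (le_lt_trans rho0).
have [|K K0 HK] := ha s; first by rewrite (ltW s0).
have q01 : 0 <= rho / s < 1 by rewrite divr_ge0 ?(ltW s0)//= ltr_pdivrMr// mul1r.
exists (K * (1 - rho / s)^-1), (rho / s); split=> //.
  by rewrite mulr_ge0// invr_ge0 subr_ge0; case/andP: q01 => _ /ltW.
by move=> n m w wr; exact: psum_tail.
Qed.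

Lemma pbounded_exists a : pbounded a -> exists f, pseries a f.
Proof.
move=> ha.
have C w : normc w < 1 -> forall e : R, 0 < e -> exists N, forall n m,
    (N <= n)%N -> (N <= m)%N -> normc (psum a n w - psum a m w) <= e.
  move=> w1 e e0; have [C [q [C0 q01 H]]] := pbounded_tail ha (normc_ge0 w) w1.
  have [|N HN] := pow_small q01 (_ : 0 < e / (C + 1)); first by rewrite divr_gt0// ltr_wpDl.
  exists N => n m; wlog mn : n m / (m <= n)%N.
    by move=> W; have [/W//|/ltnW/W W'] := leqP m n; rewrite normcBC => ? ?; exact: W'.
  move=> nN mN; rewrite -(subnKC mn); apply: le_trans (H _ _ _ (lexx _)) _.
  have := HN m mN; rewrite ltr_pdivlMr ?ltr_wpDl// => h.
  apply: le_trans (ltW h); rewrite mulrC ler_wpM2l ?lerDl// exprn_ge0//.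
  by case/andP: q01.
have /choice[f Hf] : forall w, exists l, normc w < 1 -> clim (fun n => psum a n w) l.
  move=> w; have [w1|w1] := ltP (normc w) 1; last by exists 0.
  by have [l hl] := clim_cauchy (C w w1); exists l.
exists f => rho e rho1 e0.
have [rho0|rho0] := leP rho 0.
  by exists 0%N => n _ w /lt_le_trans/(_ rho0); rewrite ltNge normc_ge0.
have [C' [q [C0 q01 H]]] := pbounded_tail ha (ltW rho0) rho1.
have [|N HN] := pow_small q01 (_ : 0 < e / (C' + 1)); first by rewrite divr_gt0// ltr_wpDl.
exists N => n nN w wr; rewrite normcBC.
have := climD (Hf w (lt_trans wr rho1)) (clim_cst (- psum a n w)).
move=> /clim_norm_le; apply; exists n => m nm.
rewrite -(subnKC nm); apply: le_trans (H _ _ _ (ltW wr)) _.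
have := HN n nN; rewrite ltr_pdivlMr ?ltr_wpDl// => h.
apply: le_trans (ltW h); rewrite mulrC ler_wpM2l ?lerDl// exprn_ge0//.
by case/andP: q01.
Qed.

Definition dcoef a i : R[i] := i.+1%:R * a i.+1.

Lemma wirt_psum a n w : wirt (psum a n) w (psum (dcoef a) n.-1 w) 0.
Proof.
have H := @wirt_sum R n (fun i w => a i * w ^+ i) (fun i => a i * (i%:R * w ^+ i.-1)) w.
have -> : psum (dcoef a) n.-1 w = \sum_(i < n) a i * (i%:R * w ^+ i.-1).
  case: n {H} => [|n]; first by rewrite /psum !big_ord0.
  rewrite big_ord_recl/= mul0r mulr0 add0r; apply: eq_bigr => i _.
  by rewrite /dcoef /bump/= add1n/= mulrA (mulrC (a _)).
apply: H => i _; have := wirt_scaleM (a i) (wirt_exp i w).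
by rewrite mulr0.
Qed.

Lemma pseries_deriv a f : pseries a f ->
  exists2 g, (forall w, normc w < 1 -> wirt f w (g w) 0) & pseries (dcoef a) g.
Proof.
move=> /Weierstrass/(_ (fun n w _ => wirt_psum a n w))[g h1 h2].
by exists g => //; move/luc_shift: h2.
Qed.

Lemma pseries_chol a f : pseries a f -> chol f.
Proof. by move=> /pseries_deriv[g h _] w w1; exists (g w); exact: h. Qed.

Lemma chol_deriv f : chol f ->
  exists2 g, chol g & forall w, normc w < 1 -> wirt f w (g w) 0.
Proof.
move=> /chol_pseries[a /pseries_deriv[g h1 h2]]; exists g => //.
exact: pseries_chol h2.
Qed.

(** Termwise integration of the power series; this provides the logarithm of the factor in
    [factor_exists]. *)
Lemma chol_primitive g : chol g -> exists f, forall w, normc w < 1 -> wirt f w (g w) 0.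
Proof.
move=> /chol_pseries[a ha]; have ba := pseries_bounded ha.
pose b i := if i is j.+1 then a j / j.+1%:R else 0.
have bb : pbounded b.
  move=> rho rho01; have [K K0 HK] := ba rho rho01; exists K => // -[|i] /=.
    by rewrite Normc.normc0 mul0r.
  have /andP[rho0 rho1] := rho01.
  apply: le_trans (HK i); rewrite normcM exprS mulrA.
  rewrite ler_wpM2r ?exprn_ge0// -mulrA ler_piMr ?normc_ge0//.
  rewrite -[leRHS]mulr1 ler_pM ?normc_ge0 ?(ltW rho1)// normcV.
  rewrite invf_le1; last by rewrite normc_gt0 pnatr_eq0.
  rewrite (_ : i.+1%:R = (i.+1%:R)%:C); last by rewrite rmorph_nat.
  by rewrite normc_real ger0_norm// ler1n.
have [f hf] := pbounded_exists bb.
have [g' h1 h2] := pseries_deriv hf.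
exists f => w w1; rewrite (_ : g w = g' w); first exact: h1.
apply: (luc_uniq ha) => //; move: h2; rewrite /pseries.
rewrite (_ : dcoef b = a)//.
by apply/funext => i; rewrite /dcoef /b mulrC divfK// pnatr_eq0.
Qed.

Lemma pseries0 a f : pseries a f -> f 0 = a 0%N.
Proof.
move=> h; have := luc_clim h (_ : normc (0 : R[i]) < 1); rewrite Normc.normc0 => /(_ ltr01) l1.
apply: (clim_uniq l1) => e e0; exists 1%N => -[//|n] _.
rewrite /psum big_ord_recl expr0 mulr1 big1 ?addr0 ?subrr ?Normc.normc0 ?ltW// => i _.
by rewrite /= exprS mul0r mulr0.
Qed.

(** Induction on [n], passing to the derived series, whose coefficient of index [n] is [n + 1] times
    the next coefficient of [a]. *)
Lemma pseries_derivs a f (D : nat -> R[i] -> R[i]) : pseries a f ->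
  (forall w, normc w < 1 -> D 0%N w = f w) ->
  (forall n w, normc w < 1 -> wirt (D n) w (D n.+1 w) 0) ->
  forall n, D n 0 = 0 -> a n = 0.
Proof.
move=> ha D0 DD n; elim: n a f D ha D0 DD => [|n ih] a f D ha D0 DD.
  by rewrite D0 ?Normc.normc0// (pseries0 ha).
have [g h1 h2] := pseries_deriv ha => Dn.
have w1 w : normc w < 1 -> D 1%N w = g w.
  move=> w1; have [|//] := wirt_uniq (DD 0%N w w1) (_ : wirt (D 0%N) w (g w) 0).
  apply: wirt_eq (h1 w w1); exists (1 - normc w); first by rewrite subr_gt0.
  move=> k kw; rewrite D0//; apply: le_lt_trans (normcD _ _) _; lra.
have := ih _ _ (fun m => D m.+1) h2 w1 (fun m => DD m.+1) Dn.
by move=> /eqP; rewrite /dcoef mulf_eq0 pnatr_eq0 => /eqP.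
Qed.

(** The identity theorem at 0. The derivatives are given as a chain [D], so that any choice of their
    values off the disk is allowed. *)
Lemma chol_eq0 f (D : nat -> R[i] -> R[i]) : chol f ->
  (forall w, normc w < 1 -> D 0%N w = f w) ->
  (forall n w, normc w < 1 -> wirt (D n) w (D n.+1 w) 0) ->
  (forall n, D n 0 = 0) -> forall w, normc w < 1 -> f w = 0.
Proof.
move=> /chol_pseries[a ha] D0 DD Dz w w1.
apply: clim_uniq (luc_clim ha w1) _ => e e0; exists 0%N => n _.
rewrite /psum big1 ?subr0 ?Normc.normc0 ?ltW// => i _.
by rewrite (pseries_derivs ha D0 DD (Dz i)) mul0r.
Qed.

End PowerSeries.

(** * The Laplacian of the logarithm of a norm *)

Section Bridge.
Context {R : realType}.

Lemma normE (z : R[i]) : `|z| = (normc z)%:C.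
Proof. by rewrite normc_def; case: z => a b. Qed.

Lemma gtc0_real (e : R[i]) : 0 < e -> exists2 x : R, 0 < x & e = x%:C.
Proof.
case: e => a b; rewrite ltcE/= => /andP[/eqP -> a0]; by exists a.
Qed.

Lemma derivable_wirt (f : R[i] -> R[i]) z :
  derivable (f : R[i]^o -> R[i]^o) z 1 <-> exists a, wirt f z a 0.
Proof.
split.
  move=> df; exists ('D_1 (f : R[i]^o -> R[i]^o) z) => e e0.
  have : h^-1 *: ((f : R[i]^o -> R[i]^o) (h *: 1 + z) - f z) @[h --> 0^'] --> 'D_1 (f : R[i]^o -> R[i]^o) z by exact: df.
  have e0' : 0 < e%:C by rewrite ltcR.
  move=> /cvgrPdist_le /(_ _ e0').
  rewrite near_withinE => /nbhs_ballP [d' /= /gtc0_real[d d0 ->] H].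
  exists d => // s sd; rewrite mul0r addr0; have [->|s0] := eqVneq s 0.
    by rewrite addr0 subrr mulr0 subr0 Normc.normc0 mulr0.
  have := H s; rewrite /ball/= sub0r normrN !normE ltcR => /(_ sd s0).
  rewrite lecR [s *: 1]mulr1 (addrC s) normcBC -ler_pdivrMr ?normc_gt0// => H1.
  rewrite -normcV -normcM.
  move: H1; rewrite /GRing.scale/=; apply: le_trans; apply: eqW; congr (normc _).
  by field.
move=> [a fa].
have cv : h^-1 *: ((f : R[i]^o -> R[i]^o) (h *: 1 + z) - f z) @[h --> 0^'] --> (a : R[i]^o).
  apply/cvgrPdist_le => e' /gtc0_real[e e0 ->]; have [d d0 {}H] := fa e e0.
  rewrite near_withinE; apply/nbhs_ballP; exists d%:C => //=; first by rewrite ltcR.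
  move=> s; rewrite /ball/= sub0r normrN normE ltcR => sd s0.
  have := H s sd; rewrite [s *: 1]mulr1 (addrC s) -ler_pdivrMr ?normc_gt0//.
  rewrite mul0r addr0 normE lecR normcBC -normcV -normcM; apply: le_trans; apply: eqW; congr (normc _).
  by rewrite /GRing.scale/=; field.
by apply/cvg_ex; exists a.
Qed.

Lemma holomorphicE (f : R[i] -> R[i]) : holomorphic f <-> chol f.
Proof.
by split=> h z; have := h z; rewrite diskE => hz /hz /derivable_wirt.
Qed.

Lemma partial_wirt (g : R[i] -> R[i]) z a b v : wirt g z a b ->
  partial v g z = a * v + b * v^*%C.
Proof.
move=> gab.
have c : cder (fun t : R => z + t%:C * v) 0 v.
  have := cderD (cder_cst z 0) (cderM (cder_real_id 0) (cder_cst v 0)).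
  by rewrite add0r mulr0 addr0 mul1r.
have gab' : wirt g (z + (0 : R)%:C * v) a b by rewrite mul0r addr0.
have := cder_wirt gab' c => h.
have h1 := cder_Re h; have h2 := cder_Im h.
rewrite /partial !derive1E.
have := @derive_val _ _ _ _ _ _ _ h1; rewrite /= => ->.
have := @derive_val _ _ _ _ _ _ _ h2; rewrite /= => ->.
by case: (_ + _).
Qed.

Lemma d_z_wirt (g : R[i] -> R[i]) z a b : wirt g z a b -> d_z g z = a.
Proof.
move=> h; rewrite /d_z !(partial_wirt _ h) conjc1.
rewrite (_ : ('i%C)^*%C = - 'i%C); last by simpc.
have i2 : 'i%C * 'i%C = -1 :> R[i] by rewrite -expr2 sqr_i.
have -> : 'i%C * (a * 'i%C + b * - 'i%C) = ('i%C * 'i%C) * (a - b) by ring.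
by rewrite i2; field.
Qed.

Lemma d_zbar_wirt (g : R[i] -> R[i]) z a b : wirt g z a b -> d_zbar g z = b.
Proof.
move=> h; rewrite /d_zbar !(partial_wirt _ h) conjc1.
rewrite (_ : ('i%C)^*%C = - 'i%C); last by simpc.
have i2 : 'i%C * 'i%C = -1 :> R[i] by rewrite -expr2 sqr_i.
have -> : 'i%C * (a * 'i%C + b * - 'i%C) = ('i%C * 'i%C) * (a - b) by ring.
by rewrite i2; field.
Qed.

Lemma near_disk (z : R[i]) : normc z < 1 ->
  exists2 d : R, 0 < d & forall k, normc k < d -> normc (z + k) < 1.
Proof.
move=> z1; exists (1 - normc z); first by rewrite subr_gt0.
by move=> k kd; apply: le_lt_trans (normcD _ _) _; lra.
Qed.

Lemma wirt_eq_disk (f g : R[i] -> R[i]) z a b : normc z < 1 ->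
  (forall w, normc w < 1 -> f w = g w) -> wirt f z a b -> wirt g z a b.
Proof.
move=> z1 fg; have [d d0 H] := near_disk z1.
by apply: wirt_eq; exists d => // k /H /fg.
Qed.

Lemma laplacian_wirt (g A B : R[i] -> R[i]) z c d : normc z < 1 ->
  (forall w, normc w < 1 -> wirt g w (A w) (B w)) -> wirt B z c d ->
  laplacian g z = 4 * c.
Proof.
move=> z1 h hB; rewrite /laplacian; congr (_ * _).
apply: (@d_z_wirt _ _ _ d); apply: wirt_eq_disk hB => // w /h hw.
by rewrite (d_zbar_wirt hw).
Qed.

Lemma wirt_ln (u : R[i] -> R) z a b : 0 < u z -> wirt (fun w => (u w)%:C) z a b ->
  wirt (fun w => (ln (u w))%:C) z (a / (u z)%:C) (b / (u z)%:C).
Proof.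
move=> u0 hu.
(* The function is real-valued, so it is its own conjugate, while conjugation swaps and conjugates
   its two coefficients. *)
have bE : b = a^*%C.
  have := wirt_conj hu; under eq_fun do rewrite conjc_real.
  by move=> /(wirt_uniq hu)[].
have aE : a = b^*%C by rewrite bE conjcK.
have := cder_real (is_derive1_ln u0) => /cderP hl.
have := wirt_chain (g := fun w => (ln (complex.Re w))%:C) hl hu.
rewrite /= -aE -bE => h.
have E x : (u z)^-1%:C / 2 * x + (u z)^-1%:C / 2 * x = x / (u z)%:C.
  rewrite fmorphV; field; rewrite fmorph_eq0.
  by rewrite gt_eqF.
by rewrite !E in h.
Qed.

End Bridge.

Section Forward.
Context {R : realType}.

Definition sqn (f1 f2 : R[i] -> R[i]) z := abs2 (f1 z) + abs2 (f2 z).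

Lemma sqnE f1 f2 z : (sqn f1 f2 z)%:C = f1 z * (f1 z)^*%C + f2 z * (f2 z)^*%C.
Proof. by rewrite rmorphD/= !abs2_mulJ. Qed.

Lemma wirt_mulJ (f g : R[i] -> R[i]) z a b : wirt f z a 0 -> wirt g z b 0 ->
  wirt (fun w => f w * (g w)^*%C) z (a * (g z)^*%C) (f z * b^*%C).
Proof.
move=> hf hg; have := wirt_mul hf (wirt_conj hg).
by rewrite conjc0 mulr0 addr0 mul0r add0r.
Qed.

Lemma wirt_gram (f1 f2 g1 g2 : R[i] -> R[i]) z a1 a2 b1 b2 : wirt f1 z a1 0 -> wirt f2 z a2 0 ->
  wirt g1 z b1 0 -> wirt g2 z b2 0 ->
  wirt (fun w => f1 w * (g1 w)^*%C + f2 w * (g2 w)^*%C) z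
    (a1 * (g1 z)^*%C + a2 * (g2 z)^*%C) (f1 z * b1^*%C + f2 z * b2^*%C).
Proof. by move=> *; apply: wirt_add; exact: wirt_mulJ. Qed.

(** The conjugate derivative of [log |d|^2] is the conjugate of [d' / d], an antiholomorphic
    function, whose holomorphic derivative vanishes. *)
Lemma laplacian_log_abs2 (u : R[i] -> R) (d : R[i] -> R[i]) z : chol d ->
  (forall w, normc w < 1 -> d w != 0) -> (forall w, normc w < 1 -> u w = abs2 (d w)) ->
  normc z < 1 -> laplacian (fun w => (ln (u w))%:C) z = 0.
Proof.
move=> hd d0 ud z1; have [d' hd' dd'] := chol_deriv hd.
have dpos w : normc w < 1 -> 0 < abs2 (d w).
  by move=> /d0 h; rewrite abs2E exprn_gt0// normc_gt0.
have W w : normc w < 1 -> wirt (fun w => (ln (abs2 (d w)))%:C) w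
    (d' w / d w) (d' w / d w)^*%C.
  move=> w1.
  have := wirt_mulJ (dd' w w1) (dd' w w1) => h.
  have {}h : wirt (fun w => (abs2 (d w))%:C) w (d' w * (d w)^*%C) (d w * (d' w)^*%C).
    by apply: wirt_eq_disk h => // x _; rewrite abs2_mulJ.
  have := wirt_ln (u := fun w => abs2 (d w)) (dpos w w1) h; rewrite abs2_mulJ.
  have dw0 := d0 w w1; have dJ0 : (d w)^*%C != 0 by rewrite conjc_eq0.
  rewrite conjcM conjc_inv.
  rewrite (_ : d' w * _ / _ = d' w / d w); last by field; rewrite dw0 dJ0.
  by rewrite (_ : d w * _ / _ = (d' w)^*%C / (d w)^*%C)//; field; rewrite dw0 dJ0.
have [d2 dd2] := hd' z z1.
have := wirt_conj (wirt_div (d0 z z1) dd2 (dd' z z1)); rewrite conjc0 => hB.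
have Wu w (w1 : normc w < 1) : wirt (fun w => (ln (u w))%:C) w (d' w / d w) (d' w / d w)^*%C.
  by apply: wirt_eq_disk (W w w1) => // x x1; rewrite ud.
by rewrite (laplacian_wirt z1 Wu hB) mulr0.
Qed.

End Forward.

(** * From a harmonic logarithm to a holomorphic factor *)

Section Rigidity.
Context {R : realType}.
Context (t1 t2 p1 p2 : R[i] -> R[i]).
Context (ht1 : chol t1) (ht2 : chol t2) (hp1 : chol p1) (hp2 : chol p2).
Context (tpos : forall z, normc z < 1 -> 0 < sqn t1 t2 z).
Context (ppos : forall z, normc z < 1 -> 0 < sqn p1 p2 z).
Context (lap0 : forall z, normc z < 1 ->
  laplacian (fun w => (ln (sqn t1 t2 w / sqn p1 p2 w))%:C) z = 0).

(** The holomorphic derivative [G] of the logarithm is itself holomorphic when the Laplacian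
    vanishes. With a primitive [L] of it, the logarithm is [2 Re L + r] for a constant [r], and
    [d = exp (L + r / 2)]. *)
Lemma factor_exists : exists d, [/\ chol d, (forall z, normc z < 1 -> d z != 0) &
  forall z, normc z < 1 -> sqn t1 t2 z = abs2 (d z) * sqn p1 p2 z].
Proof.
have [t1' ht1' dt1] := chol_deriv ht1; have [t2' ht2' dt2] := chol_deriv ht2.
have [p1' hp1' dp1] := chol_deriv hp1; have [p2' hp2' dp2] := chol_deriv hp2.
pose G z := (t1' z * (t1 z)^*%C + t2' z * (t2 z)^*%C) / (sqn t1 t2 z)%:C
          - (p1' z * (p1 z)^*%C + p2' z * (p2 z)^*%C) / (sqn p1 p2 z)%:C.
have wsq (f1 f2 : R[i] -> R[i]) f1' f2' z : wirt f1 z f1' 0 -> wirt f2 z f2' 0 ->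
    wirt (fun w => (sqn f1 f2 w)%:C) z (f1' * (f1 z)^*%C + f2' * (f2 z)^*%C)
      (f1' * (f1 z)^*%C + f2' * (f2 z)^*%C)^*%C.
  move=> h1 h2; have := wirt_gram h1 h2 h1 h2.
  rewrite conjcD !conjcM !conjcK (mulrC (f1 z)) (mulrC (f2 z)).
  by apply: wirt_eq; exists 1 => // k _; rewrite sqnE.
have WL z : normc z < 1 -> wirt (fun w => (ln (sqn t1 t2 w / sqn p1 p2 w))%:C) z (G z) (G z)^*%C.
  move=> z1.
  have w1 := wirt_ln (tpos z1) (wsq _ _ _ _ _ (dt1 z z1) (dt2 z z1)).
  have w2 := wirt_ln (ppos z1) (wsq _ _ _ _ _ (dp1 z z1) (dp2 z z1)).
  have := wirt_sub w1 w2; rewrite /G conjcB (conjcM (_ + _)) (conjcM (_ + _)).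
  rewrite !conjc_inv !conjc_real.
  apply: wirt_eq_disk => // w w1'.
  by rewrite ln_div ?posrE ?tpos ?ppos// rmorphB.
have WG z : normc z < 1 -> exists a b, wirt G z a b.
  move=> z1.
  have [t1'' dt1'] := ht1' z z1; have [t2'' dt2'] := ht2' z z1.
  have [p1'' dp1'] := hp1' z z1; have [p2'' dp2'] := hp2' z z1.
  have a1 := wirt_gram dt1' dt2' (dt1 z z1) (dt2 z z1).
  have a2 := wirt_gram dp1' dp2' (dp1 z z1) (dp2 z z1).
  have n1 : (sqn t1 t2 z)%:C != 0 by rewrite fmorph_eq0 gt_eqF// tpos.
  have n2 : (sqn p1 p2 z)%:C != 0 by rewrite fmorph_eq0 gt_eqF// ppos.
  have b1 := wirt_chain (wirt_inv n1) (wsq _ _ _ _ _ (dt1 z z1) (dt2 z z1)).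
  have b2 := wirt_chain (wirt_inv n2) (wsq _ _ _ _ _ (dp1 z z1) (dp2 z z1)).
  eexists; eexists.
  exact: wirt_sub (wirt_mul a1 b1) (wirt_mul a2 b2).
have hG : chol G.
  move=> z z1; have [a [b wG]] := WG z z1; exists a.
  (* The logarithm being real, its second coefficient is the conjugate of [G]; so the Laplacian is 4
     times the conjugate of the second coefficient of [G]. *)
  have := laplacian_wirt z1 WL (wirt_conj wG); rewrite lap0// => /esym/eqP.
  rewrite mulf_eq0 pnatr_eq0/= conjc_eq0 => /eqP b0.
  by rewrite b0 in wG.
have [L dL] := chol_primitive hG.
pose h z := ln (sqn t1 t2 z / sqn p1 p2 z).
pose D z := (h z)%:C - (L z + (L z)^*%C).
have WD z : normc z < 1 -> wirt D z 0 0.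
  move=> z1; have := wirt_sub (WL z z1) (wirt_add (dL z z1) (wirt_conj (dL z z1))).
  by rewrite conjc0 addr0 add0r !subrr.
(* The derivative vanishes along the segment from 0 to [z]. *)
have Dc z : normc z < 1 -> D z = D 0.
  move=> z1; apply/eqP; rewrite -subr_eq0; apply/eqP/normc_le0 => e e0.
  have cd t : 0 <= t <= 1 -> cder (fun s : R => D (s%:C * z)) t 0.
    move=> /andP[t0 t_1].
    have tz : normc (t%:C * z) < 1.
      rewrite normcM normc_real ger0_norm//; apply: le_lt_trans z1.
      by rewrite ler_piMl ?normc_ge0.
    have := cder_wirt (h := fun s : R => s%:C * z) (WD _ tz) (cderM (cder_real_id t) (cder_cst z t)).
    by rewrite !mul0r addr0.
  have := mean_le ler01 cd (M := 0); rewrite mulr0 mul0r mul1r mul0r => H.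
  by apply: le_trans (H _) (ltW e0) => t _; rewrite Normc.normc0.
have D0r : exists r : R, D 0 = r%:C.
  exists (complex.Re (D 0)); rewrite /D addcJ.
  by case: (L 0) => a b; simpc; rewrite /=; congr (_ +i* _); ring.
have [r Dr] := D0r.
exists (fun z => cexp (L z + (r / 2)%:C)); split.
- move=> z z1; eexists.
  have w := wirt_add (dL z z1) (wirt_cst (r / 2)%:C z); rewrite !addr0 in w.
  exact: (wirt_cplx_chain (f := fun z => L z + (r / 2)%:C) (wirt_cexp _) w).
- by move=> z _; exact: cexp_neq0.
move=> z z1; have := Dc z z1; rewrite Dr /D addcJ => E.
have {}E : h z = 2 * complex.Re (L z) + r.
  have := congr1 (@complex.Re R) E; case: (L z) => a b /=; simpc => /=; lra.
rewrite abs2E normc_cexp ReD /= expr2 -expRD.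
rewrite (_ : _ + _ = h z); last by rewrite E; field.
rewrite /h lnK ?posrE ?divr_gt0 ?tpos ?ppos// divfK// gt_eqF// ppos//.
Qed.

End Rigidity.

(** * Equal pointwise norms and constant unitaries *)

Section Unitary.
Context {R : realType}.

(** The matrix with rows [(a, b)] and [(c, d)]: first orthonormality of the columns, then of the
    rows, so that both products with the adjoint are at hand. *)
Definition unitary2 (a b c d : R[i]) :=
  [/\ a * a^*%C + c * c^*%C = 1, b * b^*%C + d * d^*%C = 1,
      a * b^*%C + c * d^*%C = 0 &
   [/\ a * a^*%C + b * b^*%C = 1, c * c^*%C + d * d^*%C = 1 &
      a * c^*%C + b * d^*%C = 0]].

(** In [C^2] a vector is recovered from its inner product with a fixed nonzero vector and its
    determinant against it. Equal Gram matrices give equal inner products, and equal determinants up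
    to one common factor [l] of modulus 1. *)
Lemma gram_unitary (A1 A2 B1 B2 : nat -> R[i]) :
  (forall n m, A1 n * (A1 m)^*%C + A2 n * (A2 m)^*%C = B1 n * (B1 m)^*%C + B2 n * (B2 m)^*%C) ->
  A1 0%N * (A1 0%N)^*%C + A2 0%N * (A2 0%N)^*%C != 0 ->
  exists a b c d, unitary2 a b c d /\
    forall n, A1 n = a * B1 n + b * B2 n /\ A2 n = c * B1 n + d * B2 n.
Proof.
move=> gram N0; set N := _ + _ in N0.
have NB : B1 0%N * (B1 0%N)^*%C + B2 0%N * (B2 0%N)^*%C = N by rewrite -gram.
have NA : A1 0%N * (A1 0%N)^*%C + A2 0%N * (A2 0%N)^*%C = N by [].
pose al n := A1 0%N * A2 n - A2 0%N * A1 n.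
pose be n := B1 0%N * B2 n - B2 0%N * B1 n.
(* Products of one such determinant with the conjugate of another are polynomials in the Gram
   entries. *)
have abE n m : al n * (al m)^*%C = be n * (be m)^*%C.
  have E (x1 x2 y1 y2 z1 z2 : R[i]) : (x1 * y2 - x2 * y1) * (x1 * z2 - x2 * z1)^*%C =
     (x1 * x1^*%C + x2 * x2^*%C) * (y1 * z1^*%C + y2 * z2^*%C)
     - (y1 * x1^*%C + y2 * x2^*%C) * (x1 * z1^*%C + x2 * z2^*%C).
    by rewrite conjcB !conjcM; ring.
  by rewrite /al /be !E !gram.
have [l [ll lE]] : exists l, l * l^*%C = 1 /\ forall n, al n = l * be n.
  have [[m bm]|H] := pselect (exists m, be m != 0).
    have am : al m != 0.
      apply: contraNneq bm => am; have := abE m m; rewrite am mul0r => /esym/eqP.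
      by rewrite mulf_eq0 conjc_eq0 orbb.
    have amJ : (al m)^*%C != 0 by rewrite conjc_eq0.
    have bmJ : (be m)^*%C != 0 by rewrite conjc_eq0.
    exists (al m / be m); split.
      rewrite conjcM conjc_inv.
      have -> : al m / be m * ((al m)^*%C / (be m)^*%C) = al m * (al m)^*%C / (be m * (be m)^*%C).
        by field; rewrite bm bmJ.
      by rewrite abE divff// mulf_neq0.
    move=> n; apply: (mulIf amJ); rewrite abE.
    have -> : al m / be m * be n * (al m)^*%C = be n * (al m * (al m)^*%C) / be m by field.
    by rewrite abE; field.
  exists 1; split; first by rewrite conjc1 mulr1.
  move=> n; rewrite mul1r; have bn : be n = 0.
    by apply/eqP/negPn/negP => b; apply: H; exists n.
  have := abE n n; rewrite bn mul0r => /eqP.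
  by rewrite mulf_eq0 conjc_eq0 orbb => /eqP.
move: NA NB; rewrite /al /be in lE.
have G0 n := gram n 0%N; move: G0 lE.
move: (A1 0%N) (A2 0%N) (B1 0%N) (B2 0%N) => a1 a2 b1 b2 G0 lE NA NB.
have NJ : N^*%C = N by rewrite -NA conjcD !conjcM !conjcK (mulrC a1) (mulrC a2).
(* The matrix that sends [(b1, b2)] to [(a1, a2)] and the orthogonal vector [(- conj b2, conj b1)]
   to [l] times [(- conj a2, conj a1)]. *)
exists ((a1 * b1^*%C + l * a2^*%C * b2) / N), ((a1 * b2^*%C - l * a2^*%C * b1) / N),
  ((a2 * b1^*%C - l * a1^*%C * b2) / N), ((a2 * b2^*%C + l * a1^*%C * b1) / N).
split.
  have NB' : b2 * b2^*%C + b1 * b1^*%C = N by rewrite addrC.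
  have NA' : a2 * a2^*%C + a1 * a1^*%C = N by rewrite addrC.
  have N1 : N * N / (N * N) = 1 by rewrite divff// mulf_neq0.
  split; [| | |split].
  all: rewrite ?conjcM ?conjc_inv ?NJ ?conjcD ?conjcN ?conjcM ?conjcK.
  - transitivity ((a1 * a1^*%C + a2 * a2^*%C) * (b1 * b1^*%C + l * l^*%C * (b2 * b2^*%C)) / (N * N)); first by field.
    by rewrite ll mul1r NA NB.
  - transitivity ((a1 * a1^*%C + a2 * a2^*%C) * (b2 * b2^*%C + l * l^*%C * (b1 * b1^*%C)) / (N * N)); first by field.
    by rewrite ll mul1r NA NB'.
  - transitivity ((a1 * a1^*%C + a2 * a2^*%C) * (b1^*%C * b2) * (1 - l * l^*%C) / (N * N)).
      by field.
    by rewrite ll subrr mulr0 mul0r.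
  - transitivity ((b1 * b1^*%C + b2 * b2^*%C) * (a1 * a1^*%C + l * l^*%C * (a2 * a2^*%C)) / (N * N)); first by field.
    by rewrite ll mul1r NB NA.
  - transitivity ((b1 * b1^*%C + b2 * b2^*%C) * (a2 * a2^*%C + l * l^*%C * (a1 * a1^*%C)) / (N * N)); first by field.
    by rewrite ll mul1r NB NA'.
  - transitivity ((b1 * b1^*%C + b2 * b2^*%C) * (a1 * a2^*%C) * (1 - l * l^*%C) / (N * N)).
      by field.
    by rewrite ll subrr mulr0 mul0r.
move=> n; split.
  transitivity ((a1 * (B1 n * b1^*%C + B2 n * b2^*%C) - a2^*%C * (l * (b1 * B2 n - b2 * B1 n))) / N).
    rewrite -G0 -lE; transitivity (A1 n * (a1 * a1^*%C + a2 * a2^*%C) / N); last by field.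
    by rewrite NA mulfK.
  by field.
transitivity ((a2 * (B1 n * b1^*%C + B2 n * b2^*%C) + a1^*%C * (l * (b1 * B2 n - b2 * B1 n))) / N).
  rewrite -G0 -lE; transitivity (A2 n * (a1 * a1^*%C + a2 * a2^*%C) / N); last by field.
  by rewrite NA mulfK.
by field.
Qed.

(** The derivative is determined only on the disk, hence the choice. *)
Definition nderiv (f : R[i] -> R[i]) : R[i] -> R[i] :=
  xget (fun=> 0) [set g | chol g /\ forall w, normc w < 1 -> wirt f w (g w) 0].

Lemma nderivP f : chol f -> chol (nderiv f) /\
  forall w, normc w < 1 -> wirt f w (nderiv f w) 0.
Proof.
move=> /chol_deriv[g hg dg]; rewrite /nderiv.
by case: xgetP => [_ _ //|/(_ g)]; case.
Qed.

Definition nderivs f n := iter n nderiv f.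

Lemma nderivs_chol f n : chol f -> chol (nderivs f n).
Proof. by move=> hf; elim: n => //= n /nderivP[]. Qed.

Lemma wirt_nderivs f n w : chol f -> normc w < 1 -> wirt (nderivs f n) w (nderivs f n.+1 w) 0.
Proof. by move=> /(@nderivs_chol f n)/nderivP[_]; exact. Qed.

(* Holomorphic differentiation in z and in z^* of the identity
   <T(z), T(z)> = <Q(z), Q(z)> gives <T^(n), T^(m)> = <Q^(n), Q^(m)>. *)
Lemma unitary_exists (t1 t2 q1 q2 : R[i] -> R[i]) : chol t1 -> chol t2 -> chol q1 -> chol q2 ->
  0 < sqn t1 t2 0 -> (forall z, normc z < 1 -> sqn t1 t2 z = sqn q1 q2 z) ->
  exists a b c d, unitary2 a b c d /\ forall z, normc z < 1 ->
    t1 z = a * q1 z + b * q2 z /\ t2 z = c * q1 z + d * q2 z.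
Proof.
move=> h1 h2 h3 h4 t0 tq.
have gram n m z : normc z < 1 ->
    nderivs t1 n z * (nderivs t1 m z)^*%C + nderivs t2 n z * (nderivs t2 m z)^*%C =
    nderivs q1 n z * (nderivs q1 m z)^*%C + nderivs q2 n z * (nderivs q2 m z)^*%C.
  have W k l w (w1 : normc w < 1) f1 f2 (hf1 : chol f1) (hf2 : chol f2) :=
    wirt_gram (wirt_nderivs k hf1 w1) (wirt_nderivs k hf2 w1)
              (wirt_nderivs l hf1 w1) (wirt_nderivs l hf2 w1).
  elim: n m z => [|n ih] m z; last first.
    move=> z1; have [E _] := wirt_uniq (W n m z z1 _ _ h1 h2) (wirt_eq_disk z1 (fun w hw => esym (ih m w hw)) (W n m z z1 _ _ h3 h4)).
    exact: E.
  elim: m z => [|m ih] z z1; first by rewrite /= -!sqnE tq.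
  have [_ E] := wirt_uniq (W 0%N m z z1 _ _ h1 h2) (wirt_eq_disk z1 (fun w hw => esym (ih w hw)) (W 0%N m z z1 _ _ h3 h4)).
  exact: E.
have n0 : normc (0 : R[i]) < 1 by rewrite Normc.normc0.
have [|a [b [c [d [U E]]]]] := @gram_unitary (fun n => nderivs t1 n 0) (fun n => nderivs t2 n 0)
  (fun n => nderivs q1 n 0) (fun n => nderivs q2 n 0) (fun n m => gram n m 0 n0).
  by rewrite /= -sqnE fmorph_eq0 gt_eqF.
exists a, b, c, d; split=> // z z1.
have key f u v : chol f -> (forall n, nderivs f n 0 = u * nderivs q1 n 0 + v * nderivs q2 n 0) ->
    f z = u * q1 z + v * q2 z.
  move=> hf Hf; apply/eqP; rewrite -subr_eq0; apply/eqP.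
  have wD n w : normc w < 1 -> wirt (fun w => nderivs f n w - (u * nderivs q1 n w + v * nderivs q2 n w)) w
      (nderivs f n.+1 w - (u * nderivs q1 n.+1 w + v * nderivs q2 n.+1 w)) 0.
    move=> w1; have := wirt_sub (wirt_nderivs n hf w1) (wirt_add
      (wirt_scaleM u (wirt_nderivs n h3 w1)) (wirt_scaleM v (wirt_nderivs n h4 w1))).
    by rewrite !mulr0 addr0 subr0.
  apply: (@chol_eq0 _ (fun w => f w - (u * q1 w + v * q2 w))
    (fun n w => nderivs f n w - (u * nderivs q1 n w + v * nderivs q2 n w))) => //.
    by move=> w w1; eexists; exact: (wD 0%N).
  by move=> n; rewrite Hf subrr.
by split; [apply: (key t1)|apply: (key t2)] => // n; have [] := E n.
Qed.

End Unitary.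

(** * Rotations of the plane and the area measure *)

(** Transparent, so that the values of the packed measure unfold to those of [pushforward]. *)
Definition pushm d1 d2 (T1 : measurableType d1) (T2 : measurableType d2) (R : realType)
  (m : {measure set T1 -> \bar R}) (f : T1 -> T2) (mf : measurable_fun setT f) :
  {measure set T2 -> \bar R}.
Proof. by refine (pushforward m f). Defined.

Section Plane.
Context {R : realType}.
Local Notation lam := (@lebesgue_measure R).
Local Notation R2 := (measurableTypeR R * measurableTypeR R)%type.

Lemma lebesgue_measure_translate (a : R) (A : set (measurableTypeR R)) : measurable A ->
  lam ((fun y : measurableTypeR R => y + a : measurableTypeR R) @^-1` A) = lam A.
Proof.
move=> mA.
have mt : measurable_fun setT (fun y : measurableTypeR R => y + a : measurableTypeR R).
  by apply: measurable_funD => //; exact: measurable_cst.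
apply/esym; pose m := pushm lam mt.
apply: (@lebesgue_measure_unique _ m) => //= _ [[u v]] _ <-.
rewrite /m /pushm/= /pushforward.
have -> : (fun y : measurableTypeR R => y + a : measurableTypeR R) @^-1` `]u, v] = `](u - a), (v - a)]%classic.
  by apply/seteqP; split => y; rewrite /= !in_itv/= ltrBlDr lerBrDr.
rewrite !lebesgue_measure_itv/= !lte_fin ltrD2r; case: ifPn => // _.
by rewrite -!EFinB; congr EFin; ring.
Qed.

Lemma lebesgue_measure_dilate (r : R) (A : set (measurableTypeR R)) : 0 < r -> measurable A ->
  lam ((fun y : measurableTypeR R => r * y : measurableTypeR R) @^-1` A) = (r^-1%:E * lam A)%E.
Proof.
move=> r0 mA.
have mt : measurable_fun setT (fun y : measurableTypeR R => r * y : measurableTypeR R).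
  by apply: measurable_funM => //; exact: measurable_cst.
pose m := mscale (NngNum (ltW r0)) (pushm lam mt).
suff -> : lam A = m A.
  rewrite /m /mscale/= /pushm/= /pushforward muleA -EFinM mulVf ?mul1e//.
  by rewrite gt_eqF.
apply: (@lebesgue_measure_unique _ m) => //= _ [[u v]] _ <-.
rewrite /m /mscale/= /pushm/= /pushforward.
have -> : (fun y : measurableTypeR R => r * y : measurableTypeR R) @^-1` `]u, v] = `](u / r), (v / r)]%classic.
  by apply/seteqP; split => y; rewrite /= !in_itv/= ltr_pdivrMr// ler_pdivlMr// (mulrC y).
rewrite !lebesgue_measure_itv/= !lte_fin ltr_pM2r ?invr_gt0//.
case: ifPn => _; last by rewrite mule0.
by rewrite -!EFinB -EFinM; congr EFin; field; rewrite gt_eqF.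
Qed.

Definition shear (a : R) (p : R2) : R2 := (p.1, p.2 + a * p.1).
Definition pswap (p : R2) : R2 := (p.2, p.1).
Definition dilate (r : R) (p : R2) : R2 := (r * p.1, r * p.2).

Lemma measurable_shear a : measurable_fun setT (shear a).
Proof.
apply/measurable_fun_pairP; split; first exact: measurable_fst.
apply: measurable_funD; first exact: measurable_snd.
by apply: measurable_funM; [exact: measurable_cst|exact: measurable_fst].
Qed.

Lemma measurable_pswap : measurable_fun setT pswap.
Proof. by apply/measurable_fun_pairP; split; [exact: measurable_snd|exact: measurable_fst]. Qed.

Lemma measurable_dilate r : measurable_fun setT (dilate r).
Proof.
apply/measurable_fun_pairP; split; apply: measurable_funM => //.
Qed.

(** Each vertical section is translated, and the product measure is the integral of the measures of
    the sections. *)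
Lemma area_shear a A : measurable A -> area (shear a @^-1` A) = area A.
Proof.
move=> mA; apply: eq_integral => x _ /=.
have mX : measurable (xsection A x) by exact: measurable_xsection.
by rewrite -(lebesgue_measure_translate (a * x) mX); congr (lam _).
Qed.

Lemma area_swap A : measurable A -> area (pswap @^-1` A) = area A.
Proof.
move=> mA; apply/esym.
have ms := measurable_pswap.
pose m := pushm area ms.
apply: (@product_measure_unique _ _ _ _ _ _ _ m) => // B C mB mC.
rewrite /m /pushm/= /pushforward.
have -> : pswap @^-1` (B `*` C) = C `*` B.
  by apply/seteqP; split => -[x y] /= [].
by rewrite /area product_measure1E// muleC.
Qed.

Lemma area_dilate r A : 0 < r -> measurable A ->
  area (dilate r @^-1` A) = ((r^-1 ^+ 2)%:E * area A)%E.
Proof.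
move=> r0 mA.
have md := measurable_dilate r.
have r20 : 0 <= r ^+ 2 by rewrite sqr_ge0.
pose m := mscale (NngNum r20) (pushm area md).
suff -> : area A = m A.
  rewrite /m /mscale/= /pushm/= /pushforward muleA -EFinM -exprMn mulVf ?expr1n ?mul1e//.
  by rewrite gt_eqF.
apply: (@product_measure_unique _ _ _ _ _ _ _ m) => // B C mB mC.
transitivity ((r ^+ 2)%:E * area (dilate r @^-1` (B `*` C)))%E => //.
have -> : dilate r @^-1` (B `*` C) =
    ((fun y : measurableTypeR R => r * y : measurableTypeR R) @^-1` B) `*`
    ((fun y : measurableTypeR R => r * y : measurableTypeR R) @^-1` C).
  by apply/seteqP; split => -[x y].
have mr X : measurable X -> measurable ((fun y : measurableTypeR R => r * y : measurableTypeR R) @^-1` X).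
  move=> mX; rewrite -[X in measurable X]setTI; exact: measurable_funM.
have E := @product_measure1E _ _ _ _ _ lam lam _ _ (mr _ mB) (mr _ mC).
transitivity ((r ^+ 2)%:E * ((r^-1)%:E * lam B * ((r^-1)%:E * lam C)))%E.
  by congr (_ * _)%E; rewrite -!lebesgue_measure_dilate//; exact: E.
have rE : (r ^+ 2) * (r^-1 * r^-1) = 1 by field; rewrite gt_eqF.
have aux (u v w : R) (x y : \bar R) : u * (v * w) = 1 ->
    (u%:E * (v%:E * x * (w%:E * y)) = x * y)%E.
  by move=> uvw; rewrite (muleACA v%:E x w%:E y) -(EFinM v w) (muleA u%:E (v * w)%:E) -(EFinM u) uvw mul1e.
exact: aux.
Qed.

Definition plane_rot (c s : R) (p : R2) : R2 := (c * p.1 - s * p.2, s * p.1 + c * p.2).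

Lemma measurable_rot c s : measurable_fun setT (plane_rot c s).
Proof.
apply/measurable_fun_pairP; split.
  by apply: measurable_funB; apply: measurable_funM => //; exact: measurable_cst.
by apply: measurable_funD; apply: measurable_funM => //; exact: measurable_cst.
Qed.

(* A rotation is a product of three shears. *)
Lemma area_rot c s A : c ^+ 2 + s ^+ 2 = 1 -> s != 0 -> measurable A ->
  area (plane_rot c s @^-1` A) = area A.
Proof.
(* For an angle [t] this is [- tan (t / 2)], the coefficient of the two outer shears; the middle one
   has coefficient [s]. *)
move=> cs s0 mA; pose a := (c - 1) / s.
have -> : plane_rot c s = pswap \o shear a \o pswap \o shear s \o pswap \o shear a \o pswap.
  apply/funext => -[x y]; rewrite /plane_rot /shear /pswap /=; congr pair.
    rewrite (_ : y + s * (x + a * y) = s * x + (1 + s * a) * y); last by ring.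
    have -> : 1 + s * a = c by rewrite /a; field.
    have -> : x + a * y + a * (s * x + c * y) =
       (x + (c - 1) * x) + (c ^+ 2 - 1) / s * y by rewrite /a; field.
    have -> : c ^+ 2 - 1 = - s ^+ 2 by rewrite -cs; ring.
    by field.
  rewrite /a.
  have -> : y + s * (x + (c - 1) / s * y) = s * x + (1 + (c - 1)) * y by field.
  by ring.
rewrite !comp_preimage.
have mp B : measurable B -> measurable (pswap @^-1` B).
  move=> mB; rewrite -[X in measurable X]setTI.
  exact: measurable_pswap.
have ms b B : measurable B -> measurable (shear b @^-1` B).
  by move=> mB; rewrite -[X in measurable X]setTI; exact: measurable_shear.
have m1 := mp _ mA; have m2 := ms a _ m1; have m3 := mp _ m2.
have m4 := ms s _ m3; have m5 := mp _ m4; have m6 := ms a _ m5.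
by rewrite area_swap// area_shear// area_swap// area_shear// area_swap// area_shear// area_swap.
Qed.

End Plane.

(** * Integrability of the weight on the disk *)

Section Weight.
Context {R : realType}.
Local Notation R2 := (measurableTypeR R * measurableTypeR R)%type.

Definition zz (p : R2) : R[i] := p.1 +i* p.2.

Definition rsq (p : R2) : R := abs2 (zz p).

(** The parameter bounds the square of the radius, which makes the area linear in [t]. *)
Definition rdisk (t : R) : set R2 := [set p | rsq p < t].

Lemma measurable_rsq D : measurable_fun D rsq.
Proof.
apply: measurable_funTS; apply: measurable_funD; apply: measurable_funX.
  exact: measurable_fst.
exact: measurable_snd.
Qed.

Lemma measurable_rdisk t : measurable (rdisk t).
Proof.
rewrite /rdisk (_ : [set p | _] = rsq @^-1` `]-oo, t[); last first.
  by apply/seteqP; split => p; rewrite /= in_itv.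
by rewrite -[X in measurable X]setTI; exact: measurable_rsq.
Qed.

Lemma disk2E : @disk2 R = rdisk 1.
Proof.
apply/seteqP; split => p; rewrite /disk2 /rdisk /= diskE /rsq abs2E => h.
  by rewrite expr_lt1// normc_ge0.
by rewrite expr_lt1 ?normc_ge0 in h.
Qed.

Lemma measurable_disk2 : measurable (@disk2 R).
Proof. by rewrite disk2E; exact: measurable_rdisk. Qed.

Lemma rsq_ge0 p : 0 <= rsq p.
Proof. by rewrite addr_ge0 ?sqr_ge0. Qed.

Lemma area_disk_lty : (area (@disk2 R) < +oo)%E.
Proof.
pose Q := `[(-1), 1]%classic : set (measurableTypeR R).
have mQ : measurable Q by exact: measurable_itv.
apply: (@le_lt_trans _ _ (area (Q `*` Q))).
  apply: le_measure; rewrite ?inE; [exact: measurable_disk2|exact: measurableX|].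
  move=> [x y]; rewrite disk2E /rdisk /rsq /abs2 /Q /= !in_itv/= => h.
  have hx : x ^+ 2 <= 1 by have := sqr_ge0 y; lra.
  have hy : y ^+ 2 <= 1 by have := sqr_ge0 x; lra.
  by rewrite -!ler_norml -!(@ler_sqr _ `|_|) ?nnegrE// !real_normK ?num_real// expr1n.
have -> : area (Q `*` Q) = (lebesgue_measure Q * lebesgue_measure Q)%E.
  exact: product_measure1E.
rewrite lebesgue_measure_itv/= lte_fin.
have -> : (-1 : R) < 1 by lra.
by rewrite -EFinB -EFinM ltry.
Qed.

Definition area0 : R := fine (area (@disk2 R)).

Lemma area0E : area (@disk2 R) = area0%:E.
Proof. by rewrite fineK// ge0_fin_numE// area_disk_lty. Qed.

Lemma area_rdisk t : 0 < t -> area (rdisk t) = (t * area0)%:E.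
Proof.
move=> t0; have st : 0 < (Num.sqrt t)^-1 by rewrite invr_gt0 sqrtr_gt0.
have := @area_dilate R _ _ st measurable_disk2.
rewrite invrK sqr_sqrtr ?ltW// area0E -EFinM => <-; congr (area _).
apply/seteqP; split => p; rewrite disk2E /rdisk/= /rsq /abs2/= !exprMn -mulrDr exprVn sqr_sqrtr ?ltW//.
  by rewrite -ltr_pdivlMl ?invr_gt0// invrK mulr1.
by rewrite -ltr_pdivlMl ?invr_gt0// invrK mulr1.
Qed.

Definition pw (alpha : R) (p : R2) : R := (1 - rsq p) `^ alpha.

Lemma pw_ge0 alpha p : 0 <= pw alpha p. Proof. exact: powR_ge0. Qed.

Lemma measurable_pw alpha D : measurable_fun D (pw alpha).
Proof.
apply: measurable_funTS.
apply: (@measurableT_comp _ _ _ _ _ _ (fun x : R => x `^ alpha)).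
  exact: measurable_powR.
by apply: measurable_funB; [exact: measurable_cst|exact: measurable_rsq].
Qed.

(** Summation over the annuli where [1 - |z|^2] lies between [2^-(n+1)] and [2^-n]. The area is of
    order [2^-n] and the weight at most [2^-(n+1)] to the power [alpha], so the sum is geometric
    with ratio [q = 2^-(alpha + 1) < 1]. *)
Lemma pw_integral_neg alpha : -1 < alpha -> alpha < 0 ->
  (\int[area]_(p in @disk2 R) (pw alpha p)%:E < +oo)%E.
Proof.
move=> a1 a0.
pose h n : R := 2^-1 ^+ n.
have h0 n : 0 < h n by rewrite exprn_gt0.
have h1 n : h n <= 1 by rewrite exprn_ile1// ?invr_ge0// invf_le1// ler1n.
pose F n := rdisk (1 - h n).
have mF n : measurable (F n) by exact: measurable_rdisk.
have hS n : h n = h n.+1 + h n.+1 by rewrite /h exprS; field.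
have ndF : nondecreasing_seq F.
  apply/nondecreasing_seqP => n; apply/subsetPset => p; rewrite /F /rdisk/=.
  by have := hS n; have := h0 n.+1; lra.
have mf n : measurable_fun (F n) (fun p => (pw alpha p)%:E).
  by apply/measurable_EFinP; exact: measurable_pw.
have f0 n p : F n p -> (0 <= (pw alpha p)%:E)%E by rewrite lee_fin pw_ge0.
have A0 : 0 <= area0 by rewrite fine_ge0.
pose q : R := 2^-1 `^ (alpha + 1).
have q0 : 0 < q by rewrite powR_gt0// invr_gt0.
have q1 : q < 1.
  have <- : (1 : R) `^ (alpha + 1) = 1 by rewrite powR1.
  rewrite gt0_ltr_powR ?nnegrE//; first lra.
  by rewrite invf_lt1// ltr1n.
have bound n : (\int[area]_(p in F n) (pw alpha p)%:E <= (area0 * (1 - q ^+ n) / (1 - q) + area0)%:E)%E.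
  have : (\int[area]_(p in F n) (pw alpha p)%:E <= (area0 * (1 - q ^+ n) / (1 - q))%:E)%E.
    elim: n => [|n ih].
      rewrite (_ : F 0%N = set0) ?integral_set0 ?expr0 ?subrr ?mulr0 ?mul0r//.
      apply/seteqP; split => p //=; rewrite /F /rdisk /= /h expr0 subrr.
      by rewrite ltNge rsq_ge0.
    have FE : F n.+1 = F n `|` (F n.+1 `\` F n).
      by rewrite setDUK//; apply/subsetPset; exact: ndF.
    have mD : measurable (F n.+1 `\` F n) by exact: measurableD.
    have mfU : measurable_fun (F n `|` (F n.+1 `\` F n)) (fun p => (pw alpha p)%:E).
      by rewrite -FE.
    have dF : [disjoint F n & F n.+1 `\` F n] by apply/disj_setPS => p [? []].
    rewrite FE ge0_integral_setU//; last by move=> p _; rewrite lee_fin pw_ge0.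
    have -> : area0 * (1 - q ^+ n.+1) / (1 - q) = area0 * (1 - q ^+ n) / (1 - q) + q ^+ n * area0.
      by rewrite exprS; field; rewrite subr_eq0 eq_sym lt_eqF.
    rewrite EFinD leeD//.
    apply: (@le_trans _ _ (\int[area]_(p in F n.+1 `\` F n) (cst (h n.+1 `^ alpha)%:E) p)%E).
      apply: ge0_le_integral => //.
      - by move=> p _; rewrite lee_fin pw_ge0.
      - by apply/measurable_EFinP; exact: measurable_pw.
      move=> p [pn _]; rewrite lee_fin /pw.
      have hp : h n.+1 <= 1 - rsq p by move: pn; rewrite /F /rdisk/=; lra.
      rewrite -[alpha]opprK !(powRN _ (- alpha)) lef_pV2 ?posrE ?powR_gt0//; last first.
        exact: lt_le_trans hp.
      by rewrite ge0_ler_powR ?nnegrE ?(ltW (h0 _))//; have := h0 n.+1; lra.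
    rewrite integral_cst//.
    have mD' : (area (F n.+1 `\` F n) <= (h n.+1 * area0)%:E)%E.
      have E1 : area (F n.+1) = (area (F n) + area (F n.+1 `\` F n))%E.
        rewrite {1}FE measureU// setDE setICA setICr setI0//.
      (* [F 0] is empty, while [area_rdisk] asks for a positive parameter; hence the case
         distinction. *)
      case: n {ih mfU dF} FE E1 mD => [|n] FE E1 mD.
        have F0 : F 0%N = set0.
          apply/seteqP; split => p //=; rewrite /F /rdisk /= /h expr0 subrr.
          by rewrite ltNge rsq_ge0.
        rewrite F0 setD0 area_rdisk; last by rewrite /h expr1; lra.
        by rewrite lee_fin ler_wpM2r// /h expr1; lra.
      have hh m : h m.+1 < 1.
        have := hS m; have := h0 m.+1; have := h1 m; lra.
      move: E1; rewrite !area_rdisk ?subr_gt0// => E1.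
      have fin : area (F n.+2 `\` F n.+1) \is a fin_num.
        rewrite ge0_fin_numE//; apply: (@le_lt_trans _ _ (area (@disk2 R))); last exact: area_disk_lty.
        apply: le_measure; rewrite ?inE//; first exact: measurable_disk2.
        by move=> p [+ _]; rewrite disk2E /F /rdisk/=; have := h0 n.+2; lra.
      move: E1; rewrite -(fineK fin) -EFinD => -[E1].
      rewrite lee_fin; have := hS n.+1; move: E1; nra.
    apply: (@le_trans _ _ ((h n.+1 `^ alpha)%:E * (h n.+1 * area0)%:E)%E).
      by rewrite lee_wpmul2l// lee_fin powR_ge0.
    rewrite -EFinM lee_fin mulrA ler_wpM2r//.
    have -> : h n.+1 `^ alpha * h n.+1 = q ^+ n.+1.
      rewrite -[X in _ * X](powRr1 (ltW (h0 n.+1))) -powRD; last by apply/implyP => _; rewrite (gt_eqF (h0 _)).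
      have hE : h n.+1 = 2^-1 `^ n.+1%:R by rewrite powR_mulrn// invr_ge0.
      by rewrite -(powR_mulrn n.+1 (ltW q0)) hE /q -!powRrM mulrC.
    by rewrite exprS ler_piMl ?exprn_ge0 ?(ltW q0) ?(ltW q1).
  by move=> /le_trans; apply; rewrite lee_fin lerDl.
have UF : \bigcup_n F n = @disk2 R.
  rewrite disk2E; apply/seteqP; split => p.
    by move=> [n _]; rewrite /F /rdisk/=; have := h0 n; lra.
  rewrite /rdisk/= => p1.
  have [||N HN] := @pow_small R 2^-1 (1 - rsq p).
  - by rewrite invr_ge0 ler0n/= invf_lt1// ltr1n.
  - by rewrite subr_gt0.
  by exists N => //; rewrite /F /rdisk/=; have := HN N (leqnn _); rewrite /h; lra.
have := ge0_nondecreasing_set_cvg_integral (mu := area) ndF mF mf f0; rewrite UF => cv.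
apply: (@le_lt_trans _ _ (area0 / (1 - q) + area0)%:E); last by rewrite ltry.
apply: (@cvge_le _ _ _ _ _ _ _ _ cv).
apply: nearW => n; apply: le_trans (bound n) _.
rewrite lee_fin lerD2r// ler_wpM2r ?invr_ge0 ?subr_ge0 ?(ltW q1)//.
by rewrite ler_piMr// gerBl exprn_ge0// ltW.
Qed.

Lemma pw_integrable alpha : -1 < alpha -> area.-integrable (@disk2 R) (EFin \o pw alpha).
Proof.
move=> a1; apply/integrableP; split.
  by apply/measurable_EFinP; exact: measurable_pw.
under eq_integral do rewrite /= ger0_norm ?pw_ge0//.
have [a0|a0] := leP 0 alpha; last exact: pw_integral_neg.
apply: (@le_lt_trans _ _ (\int[area]_(p in @disk2 R) (cst 1%:E) p)%E).
  apply: ge0_le_integral => //.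
  - exact: measurable_disk2.
  - by move=> p _; rewrite lee_fin pw_ge0.
  - by apply/measurable_EFinP; exact: measurable_pw.
  move=> p; rewrite disk2E /rdisk/= => p1; rewrite lee_fin /pw.
  apply: (@le_trans _ _ (1 `^ alpha)); last by rewrite powR1.
  rewrite ge0_ler_powR ?nnegrE//; first lra.
  by rewrite gerBl rsq_ge0.
rewrite integral_cst; first by rewrite mul1e area_disk_lty.
exact: measurable_disk2.
Qed.

End Weight.

(** * Complex-valued integrals over plane sets *)

Section ComplexIntegral.
Context {R : realType}.
Local Notation R2 := (measurableTypeR R * measurableTypeR R)%type.
Implicit Types (f g h : R[i] -> R[i]) (A : set R2).

Definition dint A f : R[i] :=
  (\int[area]_(p in A) complex.Re (f (zz p))) +i* (\int[area]_(p in A) complex.Im (f (zz p))).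

Definition mfun A f := measurable_fun A (fun p : R2 => complex.Re (f (zz p))) /\
  measurable_fun A (fun p : R2 => complex.Im (f (zz p))).

Definition dintg A f := area.-integrable A (fun p : R2 => (complex.Re (f (zz p)))%:E) /\
  area.-integrable A (fun p : R2 => (complex.Im (f (zz p)))%:E).

Lemma mfunD A f g : mfun A f -> mfun A g -> mfun A (fun z => f z + g z).
Proof.
move=> [f1 f2] [g1 g2]; split.
  by under eq_fun do rewrite ReD; exact: measurable_funD.
by under eq_fun do rewrite ImD; exact: measurable_funD.
Qed.

Lemma mfunM A f g : mfun A f -> mfun A g -> mfun A (fun z => f z * g z).
Proof.
have ReM (z w : R[i]) : complex.Re (z * w) =
    complex.Re z * complex.Re w - complex.Im z * complex.Im w by case: z w => a b [].
have ImM (z w : R[i]) : complex.Im (z * w) =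
    complex.Re z * complex.Im w + complex.Im z * complex.Re w by case: z w => a b [].
move=> [f1 f2] [g1 g2]; split.
  by under eq_fun do rewrite ReM; apply: measurable_funB; exact: measurable_funM.
by under eq_fun do rewrite ImM; apply: measurable_funD; exact: measurable_funM.
Qed.

Lemma mfun_conj A f : mfun A f -> mfun A (fun z => (f z)^*%C).
Proof.
have ReC (z : R[i]) : complex.Re z^*%C = complex.Re z by case: z.
have ImC (z : R[i]) : complex.Im z^*%C = - complex.Im z by case: z.
move=> [f1 f2]; split; first by under eq_fun do rewrite ReC.
by under eq_fun do rewrite ImC; apply: measurableT_comp.
Qed.

Lemma mfun_cst A c : mfun A (fun=> c).
Proof. by split; exact: measurable_cst. Qed.

Lemma mfun_id A : mfun A id.
Proof.
by split; apply: measurable_funTS; [exact: measurable_fst|exact: measurable_snd].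
Qed.

Lemma mfunX A f n : mfun A f -> mfun A (fun z => f z ^+ n).
Proof.
move=> mf; elim: n => [|n ih]; first exact: mfun_cst.
by under eq_fun do rewrite exprS; exact: mfunM.
Qed.

(** A holomorphic function is the pointwise limit of the partial sums of its power series, which are
    measurable as polynomials. *)
Lemma mfun_chol A f : A `<=` @disk2 R -> chol f -> mfun A f.
Proof.
move=> AD /chol_pseries[a af].
have mp n : mfun A (psum a n).
  elim: n => [|n ih].
    rewrite (_ : psum a 0 = fun=> 0) ?funeqE; first exact: mfun_cst.
    by move=> w; rewrite /psum big_ord0.
  rewrite (_ : psum a n.+1 = fun w => psum a n w + a n * w ^+ n).
    by apply: mfunD => //; apply: mfunM; [exact: mfun_cst|apply/mfunX/mfun_id].
  by rewrite funeqE => w; rewrite psumS.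
have cv p : A p -> clim (fun n => psum a n (zz p)) (f (zz p)).
  by move=> /AD; rewrite /disk2/= diskE => hp; exact: luc_clim hp.
have Im_clim u l : clim u l -> complex.Im (u n) @[n --> \oo] --> (complex.Im l : R).
  move=> ul; have := clim_Re (climZ (- 'i%C) ul).
  have E (z : R[i]) : complex.Re (- 'i%C * z) = complex.Im z by case: z => x y; simpc.
  by rewrite E; under eq_fun do rewrite E.
split.
  apply: (measurable_fun_cvg (h := fun n (p : R2) => complex.Re (psum a n (zz p)) : R)).
    by move=> n; exact: (mp n).1.
  by move=> p Ap /=; exact: clim_Re (cv p Ap).
apply: (measurable_fun_cvg (h := fun n (p : R2) => complex.Im (psum a n (zz p)) : R)).
  by move=> n; exact: (mp n).2.
by move=> p Ap /=; exact: Im_clim (cv p Ap).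
Qed.

Lemma dintg_le A f (g : R2 -> R) : measurable A -> mfun A f ->
  (forall p, A p -> normc (f (zz p)) <= g p) -> area.-integrable A (EFin \o g) ->
  dintg A f.
Proof.
move=> mA [f1 f2] fg ig; split; apply: (le_integrable mA) ig.
- exact/measurable_EFinP.
- move=> p /fg fgp; rewrite /= lee_fin (le_trans (normc_ge_Re _))//.
  exact: le_trans fgp (ler_norm _).
- exact/measurable_EFinP.
- move=> p /fg fgp; rewrite /= lee_fin (le_trans (normc_ge_Im _))//.
  exact: le_trans fgp (ler_norm _).
Qed.

Lemma eq_dint A f g : (forall p, A p -> f (zz p) = g (zz p)) -> dint A f = dint A g.
Proof.
by move=> fg; congr (_ +i* _); apply: eq_Rintegral => p /set_mem/fg ->.
Qed.

Lemma dintgD A f g : measurable A -> dintg A f -> dintg A g -> dintg A (fun z => f z + g z).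
Proof.
move=> mA [f1 f2] [g1 g2]; split.
  by under eq_fun do rewrite ReD EFinD; exact: integrableD.
by under eq_fun do rewrite ImD EFinD; exact: integrableD.
Qed.

Lemma dintD A f g : measurable A -> dintg A f -> dintg A g ->
  dint A (fun z => f z + g z) = dint A f + dint A g.
Proof.
move=> mA [f1 f2] [g1 g2]; rewrite /dint; simpc; congr (_ +i* _).
  by under eq_Rintegral do rewrite ReD; rewrite RintegralD.
by under eq_Rintegral do rewrite ImD; rewrite RintegralD.
Qed.

Lemma dintZ A c f : measurable A -> dintg A f -> 
  dintg A (fun z => c * f z) /\ dint A (fun z => c * f z) = c * dint A f.
Proof.
move=> mA [f1 f2]; case: c => a b.
have ReM (w : R[i]) : complex.Re ((a +i* b) * w) =
    a * complex.Re w + (- b) * complex.Im w by case: w => x y; simpc.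
have ImM (w : R[i]) : complex.Im ((a +i* b) * w) =
    a * complex.Im w + b * complex.Re w by case: w => x y; simpc.
have iZ (k : R) (u : R2 -> R) : area.-integrable A (EFin \o u) ->
    area.-integrable A (EFin \o (fun p => k * u p)).
  by move=> iu; have := integrableZl mA k iu; apply: eq_integrable.
split; first split.
- under eq_fun do rewrite ReM EFinD.
  by apply: integrableD => //; exact: iZ.
- under eq_fun do rewrite ImM EFinD.
  by apply: integrableD => //; exact: iZ.
rewrite /dint; simpc; congr (_ +i* _).
  under eq_Rintegral do rewrite ReM.
  by rewrite RintegralD ?RintegralZl ?mulNr//; exact: iZ.
under eq_Rintegral do rewrite ImM.
by rewrite RintegralD ?RintegralZl//; exact: iZ.
Qed.

Lemma dint_conj A f : measurable A -> dintg A f ->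
  dint A (fun z => (f z)^*%C) = (dint A f)^*%C.
Proof.
have ReC (z : R[i]) : complex.Re z^*%C = complex.Re z by case: z.
have ImC (z : R[i]) : complex.Im z^*%C = (-1) * complex.Im z by case: z => a b /=; ring.
move=> mA [f1 f2]; rewrite /dint/=; congr (_ +i* _).
  by under eq_Rintegral do rewrite ReC.
by under eq_Rintegral do rewrite ImC; rewrite RintegralZl// mulN1r.
Qed.

Lemma dint_norm A f (g : R2 -> R) : measurable A -> mfun A f ->
  (forall p, A p -> normc (f (zz p)) <= g p) -> area.-integrable A (EFin \o g) ->
  normc (dint A f) <= 2 * \int[area]_(p in A) g p.
Proof.
move=> mA mf fg ig; have [f1 f2] := dintg_le mA mf fg ig.
have aux (u : R2 -> R) : area.-integrable A (EFin \o u) ->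
    (forall p, A p -> `|u p| <= g p) -> `|\int[area]_(p in A) u p| <= \int[area]_(p in A) g p.
  move=> iu ug; apply: le_trans (le_normr_Rintegral mA iu) _.
  by apply: le_Rintegral => //; have := integrable_norm iu; apply: eq_integrable.
rewrite (le_trans (normc_le_ReIm _))//= mulr_natl mulr2n lerD//; apply: aux => //.
  by move=> p /fg; apply: le_trans; exact: normc_ge_Re.
by move=> p /fg; apply: le_trans; exact: normc_ge_Im.
Qed.

Lemma rsq_rot c s p : c ^+ 2 + s ^+ 2 = 1 -> rsq (plane_rot c s p) = rsq p :> R.
Proof.
move=> cs; rewrite /rsq /abs2/= -[RHS]mul1r -cs; ring.
Qed.

(** Both the disk and the area measure are invariant under the rotation; integrability for the
    pushed-forward measure comes from the change of variables for the absolute value. *)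
Lemma dint_rot (t c s : R) f : c ^+ 2 + s ^+ 2 = 1 -> s != 0 -> t <= 1 ->
  mfun setT f -> dintg (rdisk t) f ->
  dint (rdisk t) (fun z => f ((c +i* s) * z)) = dint (rdisk t) f.
Proof.
move=> cs s0 t1 [m1 m2] [i1 i2].
have mr := @measurable_rot R c s.
have rE : plane_rot c s @^-1` (rdisk t) = rdisk t.
  by apply/seteqP; split => p; rewrite /rdisk/= rsq_rot.
have zE p : (c +i* s) * zz p = zz (plane_rot c s p) :> R[i].
  by rewrite /zz /plane_rot; simpc; congr (_ +i* _); exact: addrC.
have aux (u : R2 -> R) : measurable_fun setT u -> area.-integrable (rdisk t) (EFin \o u) ->
    \int[area]_(p in rdisk t) u (plane_rot c s p) = \int[area]_(p in rdisk t) u p.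
  move=> mu iu; rewrite /Rintegral; congr fine.
  have mu' : measurable_fun setT (EFin \o u) by exact/measurable_EFinP.
  have E : (\int[pushm area mr]_(p in rdisk t) (u p)%:E = \int[area]_(p in rdisk t) (u p)%:E)%E.
    by apply: eq_measure_integral => B mB _; exact: area_rot.
  rewrite -E.
  have := @integral_pushforward _ _ _ _ _ _ mr area (rdisk t) _ mu'.
  rewrite rE => K; apply/esym; apply: K; last exact: measurable_rdisk.
  apply/integrableP; split.
    apply: measurable_funTS; exact: (@measurableT_comp _ _ _ _ _ _ (EFin \o u)).
  have mn : measurable_fun (rdisk t) (fun p : R2 => `|(u p)%:E|%E).
    by apply: measurable_funTS; apply: measurableT_comp.
  have n0 : {in rdisk t, forall p : R2, (0 <= `|(u p)%:E|)%E} by [].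
  have := @ge0_integral_pushforward _ _ _ _ _ _ mr area (rdisk t) _ (@measurable_rdisk R t) mn n0.
  rewrite rE => K.
  have K2 : (\int[pushm area mr]_(p in rdisk t) `|(u p)%:E| = \int[area]_(p in rdisk t) `|(u p)%:E|)%E.
    by apply: eq_measure_integral => B mB _; exact: area_rot.
  have /integrableP[_ K3] := iu.
  by move: K3; rewrite /= -K2; apply: le_lt_trans; rewrite -K.
congr (_ +i* _).
  by rewrite -(aux (fun p => complex.Re (f (zz p))) m1 i1); under eq_Rintegral do rewrite zE.
by rewrite -(aux (fun p => complex.Im (f (zz p))) m2 i2); under eq_Rintegral do rewrite zE.
Qed.

(** Dominated convergence. On each of the smaller disks a power series converges uniformly, which
    [dot_coef] exploits. *)
Lemma dint_exhaust f : dintg (@disk2 R) f ->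
  clim (fun n => dint (rdisk (1 - n.+1%:R^-1)) f) (dint (@disk2 R) f).
Proof.
move=> [i1 i2]; have mD := @measurable_disk2 R.
pose F n : set R2 := rdisk (1 - n.+1%:R^-1).
have FD n : @disk2 R `&` F n = F n.
  apply/seteqP; split => p; first by case.
  rewrite disk2E /F /rdisk/= => h; split => //; apply: lt_le_trans h _.
  by rewrite gerBl invr_ge0.
have aux (u : R2 -> R) : area.-integrable (@disk2 R) (EFin \o u) ->
    \int[area]_(p in F n) u p @[n --> \oo] --> \int[area]_(p in @disk2 R) u p.
  move=> iu; have mu : measurable_fun (@disk2 R) (EFin \o u) by have /integrableP[] := iu.
  apply: fine_cvg; rewrite fineK; last exact: integrable_fin_num.
  have E n : (\int[area]_(p in F n) (u p)%:E = \int[area]_(p in @disk2 R) (((EFin \o u) \_ (F n)) p))%E.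
    by rewrite -integral_mkcondr FD.
  under eq_fun do rewrite E.
  have nu : area.-integrable (@disk2 R) (fun p => `|(u p)%:E|)%E by exact: integrable_abse.
  apply: (dominated_cvg mD _ _ _ nu).
  - move=> n; apply/measurable_restrict => //; first exact: measurable_rdisk.
    by apply: measurable_funS mu => // p [].
  - move=> p; rewrite disk2E /rdisk/= => p1.
    apply: cvg_near_cst.
    have e0 : 0 < 1 - rsq p by rewrite subr_gt0.
    have [N _ HN] := near_infty_natSinv_lt (PosNum e0).
    exists N => // n /= Nn; rewrite patchE ifT// inE /F /rdisk/=.
    by have /= := HN n Nn; move: (n.+1%:R^-1) => x; lra.
  - by [].
  - move=> n p Dp; rewrite patchE; case: ifPn => _ //; by rewrite abse0.
move=> e e0; have e20 : 0 < e / 2 by rewrite divr_gt0.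
have /cvgrPdist_lt/(_ _ e20)[N1 _ H1] := aux _ i1.
have /cvgrPdist_lt/(_ _ e20)[N2 _ H2] := aux _ i2.
exists (maxn N1 N2) => n; rewrite geq_max => /andP[n1 n2].
rewrite normcBC (le_trans (normc_le_ReIm _))// /dint/=.
by have := H1 n n1; have := H2 n n2; rewrite /F; lra.
Qed.

End ComplexIntegral.

(** * Weighted Bergman spaces *)

Section Bergman.
Context {R : realType} (alpha : R) (ha : -1 < alpha).
Local Notation R2 := (measurableTypeR R * measurableTypeR R)%type.
Local Notation D := (@disk2 R).
Local Notation W := (bergman_weight alpha).
Local Notation dot := (bergman_dot alpha).
Implicit Types f g h : R[i] -> R[i].

Let mD : measurable D := @measurable_disk2 R.

Let K : R := pi^-1 * (alpha + 1).

Let K0 : 0 < K.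
Proof. by rewrite mulr_gt0 ?invr_gt0 ?pi_gt0//; move: ha; lra. Qed.

Lemma weight_ge0 z : 0 <= W z.
Proof. by rewrite mulr_ge0 ?powR_ge0// ltW. Qed.

Lemma measurable_weight A : measurable_fun A (fun p : R2 => W (zz p)).
Proof. by apply: measurable_funM; [exact: measurable_cst|exact: measurable_pw]. Qed.

Lemma weight_integrable : area.-integrable D (EFin \o (fun p : R2 => W (zz p))).
Proof.
by have := integrableZl mD K (pw_integrable ha); apply: eq_integrable.
Qed.

Lemma mfun_weight A : mfun A (fun z => (W z)%:C).
Proof. by split; [exact: measurable_weight|exact: measurable_cst]. Qed.

Definition sqw f (p : R2) : R := abs2 (f (zz p)) * W (zz p).

Lemma sqw_ge0 f p : 0 <= sqw f p.
Proof. by rewrite mulr_ge0 ?weight_ge0// abs2E sqr_ge0. Qed.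

Lemma measurable_sqw f : chol f -> measurable_fun D (sqw f).
Proof.
move=> /(mfun_chol (@subset_refl _ D))[f1 f2]; apply: measurable_funM.
  by apply: measurable_funD; apply: measurable_funX.
exact: measurable_weight.
Qed.

Lemma bergmanP f : bergman alpha f <->
  [/\ chol f, forall z, ~ disk z -> f z = 0 & area.-integrable D (EFin \o sqw f)].
Proof.
split=> [[/holomorphicE hf f0 fi]|[hf f0 /integrableP[_ fi]]]; split => //.
- apply/integrableP; split; first by apply/measurable_EFinP; exact: measurable_sqw.
  by under eq_integral do rewrite /= ger0_norm ?sqw_ge0//; exact: fi.
- exact/holomorphicE.
- apply: le_lt_trans fi; rewrite le_eqVlt; apply/orP; left; apply/eqP; apply: eq_integral => p _.
  by rewrite /= ger0_norm ?sqw_ge0.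
Qed.

Lemma bergman_chol f : bergman alpha f -> chol f.
Proof. by move=> /bergmanP[]. Qed.

Lemma bergman_off f z : bergman alpha f -> ~ disk z -> f z = 0.
Proof. by move=> /bergmanP[_ + _]; exact. Qed.

Lemma disk_zz p : D p -> normc (zz p) < 1.
Proof. by rewrite /disk2/= diskE. Qed.

Lemma chol_lin (a : R[i]) f g : chol f -> chol g -> chol (fun z => a * f z + g z).
Proof.
move=> hf hg z z1; have [b wb] := hf z z1; have [c wc] := hg z z1.
exists (a * b + c); rewrite -[X in wirt _ _ _ X](addr0 0) -[X in wirt _ _ _ (X + _)](mulr0 a).
by apply: wirt_add => //; exact: wirt_scaleM.
Qed.

Lemma chol_mul f g : chol f -> chol g -> chol (fun z => f z * g z).
Proof.
move=> hf hg z z1; have [b wb] := hf z z1; have [c wc] := hg z z1.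
by exists (b * g z + f z * c); have := wirt_mul wb wc; rewrite mulr0 mul0r addr0.
Qed.

Lemma abs2_ge0 z : 0 <= abs2 z :> R.
Proof. by rewrite abs2E sqr_ge0. Qed.

Lemma abs2D z w : abs2 (z + w) <= 2 * abs2 z + 2 * abs2 w :> R.
Proof.
rewrite !abs2E; have := normcD z w; have := normc_ge0 (z + w).
have := normc_ge0 z; have := normc_ge0 w.
move: (normc (z + w)) (normc z) (normc w) => u x y x0 y0 u0 uxy; have := sqr_ge0 (x - y); nra.
Qed.

Lemma abs2M z w : abs2 (z * w) = abs2 z * abs2 w :> R.
Proof. by rewrite !abs2E normcM exprMn. Qed.

Lemma bergman_lin a f g : bergman alpha f -> bergman alpha g ->
  bergman alpha (fun z => a * f z + g z).
Proof.
move=> /bergmanP[hf f0 fi] /bergmanP[hg g0 gi]; apply/bergmanP; split.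
- exact: chol_lin.
- by move=> z nz; rewrite f0// g0// mulr0 addr0.
have hl := chol_lin a hf hg.
have gi' := integrableD mD (integrableZl mD (2 * abs2 a) fi) (integrableZl mD 2 gi).
apply: (le_integrable mD _ _ gi').
  by apply/measurable_EFinP; exact: measurable_sqw.
move=> p _; rewrite /= !ger0_norm ?sqw_ge0 ?lee_fin//; last first.
  by rewrite addr_ge0// mulr_ge0 ?sqw_ge0// mulr_ge0 ?abs2_ge0.
rewrite /sqw (mulrA (2 * abs2 a)) (mulrA 2 (abs2 (g _))) -mulrDl ler_wpM2r ?weight_ge0//.
have := abs2D (a * f (zz p)) (g (zz p)); by rewrite abs2M mulrA.
Qed.

Lemma bergman_mul f h (M : R) : bergman alpha f -> chol h ->
  (forall z, normc z < 1 -> normc (h z) <= M) -> bergman alpha (fun z => h z * f z).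
Proof.
move=> /bergmanP[hf f0 fi] hh hM; apply/bergmanP; split.
- exact: chol_mul.
- by move=> z nz; rewrite f0// mulr0.
apply: (le_integrable mD _ _ (integrableZl mD (M ^+ 2) fi)).
  by apply/measurable_EFinP; apply: measurable_sqw; exact: chol_mul.
move=> p /disk_zz p1; rewrite /= !ger0_norm ?sqw_ge0 ?lee_fin//; last first.
  by rewrite mulr_ge0 ?sqw_ge0 ?sqr_ge0.
rewrite /sqw (mulrA (M ^+ 2)) ler_wpM2r ?weight_ge0// abs2M ler_wpM2r ?abs2_ge0//.
rewrite abs2E ler_sqr ?nnegrE ?normc_ge0//; first exact: hM.
exact: le_trans (normc_ge0 _) (hM _ p1).
Qed.

(** Members of [bergman] vanish off the disk, so a bounded holomorphic function is cut off to become
    one. *)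
Definition dres f (z : R[i]) : R[i] := if normc z < 1 then f z else 0.

Lemma dresE f z : normc z < 1 -> dres f z = f z.
Proof. by rewrite /dres => ->. Qed.

Lemma chol_dres f : chol f -> chol (dres f).
Proof.
move=> hf z z1; have [a wa] := hf z z1; exists a; apply: wirt_eq_disk wa => // w w1.
by rewrite dresE.
Qed.

Lemma bergman_bounded h (M : R) : chol h ->
  (forall z, normc z < 1 -> normc (h z) <= M) -> bergman alpha (dres h).
Proof.
move=> hh hM; have hd := chol_dres hh; apply/bergmanP; split => //.
  by move=> z; rewrite diskE /dres; case: ifP.
apply: (le_integrable mD _ _ (integrableZl mD (M ^+ 2) weight_integrable)).
  by apply/measurable_EFinP; exact: measurable_sqw.
move=> p /disk_zz p1; rewrite /= !ger0_norm ?sqw_ge0 ?lee_fin//; last first.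
  by rewrite mulr_ge0 ?weight_ge0 ?sqr_ge0.
rewrite /sqw ler_wpM2r ?weight_ge0// dresE// abs2E ler_sqr ?nnegrE ?normc_ge0//; first exact: hM.
exact: le_trans (normc_ge0 _) (hM _ p1).
Qed.

Definition bker f g (z : R[i]) : R[i] := f z * (g z)^*%C * (W z)%:C.

Lemma dotE f g : dot f g = dint D (bker f g).
Proof. by []. Qed.

Lemma mfun_bker f g : chol f -> chol g -> mfun D (bker f g).
Proof.
move=> hf hg; apply: mfunM (mfun_weight _); apply: mfunM; first exact: mfun_chol.
by apply: mfun_conj; exact: mfun_chol.
Qed.

Lemma normc_bker f g z : normc (bker f g z) = normc (f z) * normc (g z) * W z.
Proof. by rewrite /bker !normcM normcJ normc_real ger0_norm ?weight_ge0. Qed.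

Lemma bergman_dintg f g : bergman alpha f -> bergman alpha g -> dintg D (bker f g).
Proof.
move=> /bergmanP[hf _ fi] /bergmanP[hg _ gi].
have i := integrableD mD fi gi.
apply: (@dintg_le _ _ _ (fun p => sqw f p + sqw g p)) => //; first exact: mfun_bker.
move=> p _; rewrite normc_bker /sqw -mulrDl ler_wpM2r ?weight_ge0// !abs2E.
have := normc_ge0 (f (zz p)); have := normc_ge0 (g (zz p)).
move: (normc _) (normc _) => x y x0 y0; have := sqr_ge0 (x - y); nra.
Qed.

Lemma dot_lin a f g h : bergman alpha f -> bergman alpha g -> bergman alpha h ->
  dot (fun z => a * f z + g z) h = a * dot f h + dot g h.
Proof.
move=> bf bg bh; rewrite !dotE.
have [i E] := dintZ a mD (bergman_dintg bf bh).
rewrite -E -dintD//; last exact: bergman_dintg.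
by apply: eq_dint => p _; rewrite /bker; ring.
Qed.

Lemma dot_conj f g : bergman alpha f -> bergman alpha g -> dot g f = (dot f g)^*%C.
Proof.
move=> bf bg; rewrite !dotE -dint_conj//; last exact: bergman_dintg.
apply: eq_dint => p _; rewrite /bker !conjcM conjcK.
have -> : ((W (zz p))%:C : R[i])^*%C = (W (zz p))%:C by simpc.
ring.
Qed.

Lemma dot_self f : dot f f = (\int[area]_(p in D) sqw f p)%:C.
Proof.
rewrite dotE /dint.
have E z : bker f f z = (abs2 (f z) * W z)%:C by rewrite /bker -abs2_mulJ; simpc.
congr (_ +i* _); first by apply: eq_Rintegral => p _; rewrite E.
by under eq_Rintegral do rewrite E/=; rewrite /Rintegral integral0.
Qed.

Lemma dot_self_ge0 f : 0 <= complex.Re (dot f f).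
Proof. by rewrite dot_self; apply: Rintegral_ge0 => p _; exact: sqw_ge0. Qed.

End Bergman.

(** * Moments, orthogonality of monomials, Taylor coefficients *)

Section Kernel.
Context {R : realType} (alpha : R) (ha : -1 < alpha).
Local Notation R2 := (measurableTypeR R * measurableTypeR R)%type.
Local Notation D := (@disk2 R).
Local Notation W := (bergman_weight alpha).
Local Notation dot := (bergman_dot alpha).
Implicit Types f g h : R[i] -> R[i].

Let mD : measurable D := @measurable_disk2 R.

Lemma area0_gt0 : 0 < area0 :> R.
Proof.
pose Q := `[(- 2^-1), 2^-1]%classic : set (measurableTypeR R).
have mQ : measurable Q by exact: measurable_itv.
rewrite -lte_fin -area0E; apply: (@lt_le_trans _ _ (area (Q `*` Q))).
  have -> : area (Q `*` Q) = (lebesgue_measure Q * lebesgue_measure Q)%E.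
    exact: product_measure1E.
  rewrite lebesgue_measure_itv/= lte_fin.
  have -> : (- 2^-1 : R) < 2^-1 by lra.
  by rewrite -EFinB -EFinM lte_fin; lra.
apply: le_measure; rewrite ?inE//; first exact: measurableX.
move=> [x y]; rewrite disk2E /rdisk /rsq /abs2 /Q /= !in_itv/= => -[/andP[x1 x2] /andP[y1 y2]].
by nra.
Qed.

(** Squared norms of the monomials; their reciprocals are the coefficients of the reproducing
    kernel. *)
Definition mom n : R := \int[area]_(p in D) (rsq p ^+ n * W (zz p)).

Lemma mom_integrable n : area.-integrable D (EFin \o (fun p : R2 => rsq p ^+ n * W (zz p))).
Proof.
apply: (le_integrable mD _ _ (weight_integrable ha)).
  apply/measurable_EFinP; apply: measurable_funM; last exact: measurable_weight.
  by apply: measurable_funX; exact: measurable_rsq.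
move=> p; rewrite disk2E /rdisk/= => p1; rewrite lee_fin normrM ler_piMl//.
by rewrite ger0_norm ?exprn_ge0 ?rsq_ge0// exprn_ile1 ?rsq_ge0// ltW.
Qed.

(** On the annulus where [|z|^2] lies between [s] and some [s' < 1], the integrand is at least
    [s ^+ n] times a positive constant. *)
Lemma mom_lower (s : R) : 0 < s < 1 -> exists2 A, 0 < A & forall n, A * s ^+ n <= mom n.
Proof.
move=> /andP[s0 s1]; have [s' [ss s'1]] := between_ex s1.
pose B : set R2 := rdisk s' `\` rdisk s.
have mB : measurable B by apply: measurableD; exact: measurable_rdisk.
have BD : B `&` D = B.
  by apply/setIidl => p [+ _]; rewrite disk2E /rdisk/=; lra.
have aB : area B = ((s' - s) * area0)%:E.
  have E1 : area (rdisk s') = (area (rdisk s) + area B)%E.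
    rewrite -measureU//; try exact: measurable_rdisk; last by rewrite /B setDE setICA setICr setI0.
    by rewrite setDUK// => p; rewrite /rdisk/=; lra.
  have fB : area B \is a fin_num.
    rewrite ge0_fin_numE//; apply: (@le_lt_trans _ _ (area D)); last exact: area_disk_lty.
    by apply: le_measure; rewrite ?inE// -BD.
  have s'0 := lt_trans s0 ss.
  rewrite -(fineK fB) (area_rdisk s0) (area_rdisk s'0) -EFinD in E1.
  by case: E1 => E1; rewrite -(fineK fB); congr EFin; rewrite mulrBl; lra.
(* The exponent [|alpha|] gives a lower bound of the weight for either sign of [alpha], the base
   lying in ]0, 1]. *)
pose m : R := pi^-1 * (alpha + 1) * (1 - s') `^ `|alpha|.
have m0 : 0 < m.
  rewrite !mulr_gt0 ?invr_gt0 ?pi_gt0 ?powR_gt0 ?subr_gt0//; move: ha; lra.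
exists (m * ((s' - s) * area0)).
  by apply: mulr_gt0 => //; apply: mulr_gt0; rewrite ?subr_gt0 ?area0_gt0.
move=> n.
have i1 : area.-integrable D (EFin \o (\1_B : R2 -> R)).
  apply/integrableP; split; first by apply/measurable_EFinP; exact: measurable_indic.
  under eq_integral do rewrite /= ger0_norm ?indicE ?ler0n// -indicE.
  by rewrite integral_indic// BD aB ltry.
have i2 : area.-integrable D (EFin \o (fun p : R2 => m * s ^+ n * \1_B p)).
  by have := integrableZl mD (m * s ^+ n) i1; apply: eq_integrable.
have E : \int[area]_(p in D) (m * s ^+ n * \1_B p) = m * ((s' - s) * area0) * s ^+ n.
  by rewrite RintegralZl// /Rintegral integral_indic//= BD aB/=; ring.
rewrite -E; apply: le_Rintegral => //; first exact: mom_integrable.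
move=> p; rewrite disk2E /rdisk/= => p1; rewrite indicE; case: (boolP (p \in B)) => pB; last first.
  by rewrite mulr0 mulr_ge0 ?weight_ge0 ?exprn_ge0 ?rsq_ge0.
move: pB; rewrite inE /B /rdisk/= => -[p2 /negP]; rewrite -leNgt => p3.
rewrite mulr1 mulrC ler_pM ?exprn_ge0 ?(ltW s0) ?(ltW m0)//.
  by rewrite lerXn2r ?nnegrE ?rsq_ge0// ltW.
rewrite ler_pM2l; last by rewrite mulr_gt0 ?invr_gt0 ?pi_gt0//; move: ha; lra.
have q1 : 0 < 1 - rsq p by rewrite subr_gt0.
apply: (@le_trans _ _ ((1 - rsq p) `^ `|alpha|)).
  by rewrite ge0_ler_powR ?nnegrE//; lra.
rewrite -[abs2 (zz p)]/(rsq p).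
have q2 : 1 - rsq p <= 1 by rewrite gerBl rsq_ge0.
have := @ger_powR R (1 - rsq p); rewrite q1 q2 => /(_ isT); apply; exact: ler_norm.
Qed.

Lemma mom_gt0 n : 0 < mom n.
Proof.
have h : 0 < (2^-1 : R) < 1 by rewrite invr_gt0 ltr0n/= invf_lt1// ltr1n.
have [A A0 HA] := mom_lower h.
by apply: lt_le_trans (HA n); rewrite mulr_gt0// exprn_gt0; case/andP: h.
Qed.

Lemma subset_rdisk t : t <= 1 -> rdisk t `<=` D.
Proof. by move=> t1 p; rewrite disk2E /rdisk/= => /lt_le_trans; apply. Qed.

Lemma dintgS f t : t <= 1 -> dintg D f -> dintg (rdisk t) f.
Proof.
move=> t1 [i1 i2]; have mt := @measurable_rdisk R t.
by split; [apply: integrableS i1|apply: integrableS i2] => //; exact: subset_rdisk.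
Qed.

Definition zmono n m (z : R[i]) : R[i] := z ^+ n * (z ^+ m)^*%C * (W z)%:C.

Lemma mfun_mono n m A : mfun A (zmono n m).
Proof.
apply: mfunM (mfun_weight _ _); apply: mfunM; first exact/mfunX/mfun_id.
exact/mfun_conj/mfunX/mfun_id.
Qed.

Lemma normc_mono_le n m z : normc z < 1 -> normc (zmono n m z) <= W z.
Proof.
move=> z1; rewrite /zmono !normcM normcJ !normcX normc_real (ger0_norm (weight_ge0 ha z)).
rewrite ler_piMl ?weight_ge0//.
by rewrite mulr_ile1 ?exprn_ge0 ?normc_ge0// exprn_ile1 ?normc_ge0// ltW.
Qed.

Lemma dintg_mono n m : dintg D (zmono n m).
Proof.
apply: dintg_le (weight_integrable ha) => //; first exact: mfun_mono.
by move=> p /disk_zz; exact: normc_mono_le.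
Qed.

Lemma rotation_exists n m : n != m -> exists c s : R,
  [/\ c ^+ 2 + s ^+ 2 = 1, s != 0 & (c +i* s) ^+ n * ((c +i* s) ^+ m)^*%C != 1].
Proof.
(* With this angle, [k * th] stays in ]0, 1] for [0 < k <= n + m], where the sine is positive. So no
   such power of the rotation is 1, in particular not the one of exponent [|n - m|]. *)
move=> nm; pose th : R := (n + m).+1%:R^-1.
have th0 : 0 < th by rewrite invr_gt0.
have sin_neq0 (x : R) : 0 < x <= 1 -> sin x != 0.
  move=> /andP[x0 x1]; rewrite gt_eqF// sin_gt0_pi// x0/=.
  by apply: le_lt_trans x1 _; apply: lt_le_trans (pi_ge2 R); lra.
have E : cos th +i* sin th = cexp ('i%C * th%:C) :> R[i].
  by rewrite /cexp/=; simpc; rewrite /= expR0 !mul1r.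
exists (cos th), (sin th); split; first exact: cos2Dsin2.
  by rewrite sin_neq0// th0/= invf_le1// ler1n.
set om := _ +i* _.
have n1 : normc om = 1 by rewrite /om E normc_cexp /=; simpc; rewrite /= expR0.
have omJ : om * om^*%C = 1 by rewrite -abs2_mulJ abs2E n1 expr1n.
have key k : (0 < k <= n + m)%N -> om ^+ k != 1.
  move=> /andP[k0 kn]; rewrite /om E cexpX.
  have -> : k%:R * ('i%C * th%:C) = 'i%C * (k%:R * th)%:C :> R[i].
    by rewrite rmorphM/= rmorph_nat; ring.
  have : sin (k%:R * th) != 0.
    rewrite sin_neq0// mulr_gt0 ?ltr0n//= ler_pdivrMr// mul1r ler_nat.
    by rewrite (leq_trans kn).
  apply: contraNN => /eqP; rewrite /cexp/=; simpc => /=.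
  by rewrite expR0 !mul1r => -[_ ->].
rewrite conjcX; have [nm'|mn|nm'] := ltngtP n m; last by rewrite nm' eqxx in nm.
  rewrite -(subnKC (ltnW nm')) exprD mulrA -exprMn omJ expr1n mul1r.
  apply/negP => /eqP h.
  have := key (m - n)%N; rewrite subn_gt0 nm' (leq_trans (leq_subr _ _)) ?leq_addl// => /(_ isT)/eqP; apply.
  by have := congr1 (fun x => om ^+ (m - n) * x) h; rewrite -exprMn omJ expr1n mulr1 => ->.
rewrite -(subnKC (ltnW mn)) exprD mulrAC -exprMn omJ expr1n mul1r.
by apply: key; rewrite subn_gt0 mn (leq_trans (leq_subr _ _)) ?leq_addr.
Qed.

(* Rotating the plane by [om] multiplies the integral by [om ^ n * (om^* ) ^ m]. *)
Lemma mono_orth n m t : n != m -> t <= 1 -> dint (rdisk t) (zmono n m) = 0.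
Proof.
move=> nm t1; have [c [s [cs s0 om1]]] := rotation_exists nm.
have dg := dintgS t1 (dintg_mono n m).
have := dint_rot cs s0 t1 (mfun_mono n m setT) dg.
have mt := @measurable_rdisk R t.
have [_ E] := dintZ ((c +i* s) ^+ n * ((c +i* s) ^+ m)^*%C) mt dg.
have nE z : abs2 ((c +i* s) * z) = abs2 z by rewrite abs2M {1}/abs2/= cs mul1r.
under [X in dint _ X]eq_fun => z.
  rewrite (_ : zmono n m ((c +i* s) * z) = ((c +i* s) ^+ n * ((c +i* s) ^+ m)^*%C) * zmono n m z); last first.
    rewrite /zmono /bergman_weight nE !exprMn conjcM; ring.
over.
rewrite E => /eqP; rewrite -subr_eq0 -{2}[dint _ _]mul1r -mulrBl mulf_eq0 subr_eq0 (negbTE om1)/=.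
by move=> /eqP.
Qed.

Definition zpow n : R[i] -> R[i] := dres (fun z => z ^+ n).

Lemma chol_pow n : chol (fun z : R[i] => z ^+ n).
Proof.
elim: n => [|n ih]; first by move=> z _; exists 0; exact: wirt_cst.
have hid : chol (fun z : R[i] => z) by move=> z _; exists 1; exact: wirt_id.
by have := chol_mul hid ih; congr chol; rewrite funeqE => z; rewrite exprS.
Qed.

Lemma bergman_zpow n : bergman alpha (zpow n).
Proof.
apply: (bergman_bounded ha (M := 1)); first exact: chol_pow.
by move=> z z1; rewrite normcX exprn_ile1 ?normc_ge0// ltW.
Qed.

Lemma dot_zpow_self n : dot (zpow n) (zpow n) = (mom n)%:C.
Proof.
rewrite dot_self; congr (_%:C); apply: eq_Rintegral => p /set_mem/disk_zz p1.
by rewrite /sqw /zpow dresE// abs2E normcX -exprM mulnC exprM -abs2E.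
Qed.

Lemma dint_psum_mono a N n t : t <= 1 -> 
  dintg (rdisk t) (fun z => psum a N z * (z ^+ n)^*%C * (W z)%:C) /\
  dint (rdisk t) (fun z => psum a N z * (z ^+ n)^*%C * (W z)%:C) =
  (if (n < N)%N then a n else 0) * dint (rdisk t) (zmono n n).
Proof.
move=> t1; have mt := @measurable_rdisk R t; elim: N => [|N [ih1 ih2]].
  have E : (fun z => psum a 0 z * (z ^+ n)^*%C * (W z)%:C) = (fun z => 0 * zmono n n z).
    by rewrite funeqE => z; rewrite /psum big_ord0 !mul0r.
  by rewrite E; rewrite ltn0; apply: dintZ => //; exact: dintgS (dintg_mono n n).
have [i1 i2] := dintZ (a N) mt (dintgS t1 (dintg_mono N n)).
have E : (fun z => psum a N.+1 z * (z ^+ n)^*%C * (W z)%:C) =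
    (fun z => psum a N z * (z ^+ n)^*%C * (W z)%:C + a N * zmono N n z).
  by rewrite funeqE => z; rewrite psumS /zmono; ring.
rewrite E; split; first exact: dintgD.
rewrite dintD// ih2 i2; case: (eqVneq N n) => [->|Nn].
  by rewrite ltnn ltnSn mul0r add0r.
by rewrite (mono_orth Nn t1) mulr0 addr0 (ltnS n N) (leq_eqVlt n N) (eq_sym n N) (negbTE Nn).
Qed.

Lemma rdisk_sqrt (t : R) (p : R2) : 0 <= t -> rdisk t p -> normc (zz p) < Num.sqrt t.
Proof.
move=> t0; rewrite /rdisk/= /rsq abs2E => h.
rewrite ltNge; apply/negP => k; move: h; rewrite ltNge => /negP; apply.
have := sqr_sqrtr t0; have := sqrtr_ge0 t; move: k.
by move: (Num.sqrt t) (normc _) => x y xy x0 <-; rewrite lerXn2r ?nnegrE// (le_trans x0).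
Qed.

(** The power series converges uniformly on smaller disks. There [mono_orth] singles out the term of
    index [n], and [dint_exhaust] passes to the whole disk. *)
Lemma dot_coef a f n : bergman alpha f -> pseries a f ->
  dot f (zpow n) = a n * (mom n)%:C.
Proof.
move=> bf af; have hf := bergman_chol ha bf; have bz := bergman_zpow n.
pose F z := f z * (z ^+ n)^*%C * (W z)%:C.
have -> : dot f (zpow n) = dint D F.
  by apply: eq_dint => p /disk_zz p1; rewrite /F /zpow dresE.
have -> : (mom n)%:C = dint D (zmono n n).
  by rewrite -dot_zpow_self; apply: eq_dint => p /disk_zz p1; rewrite /zpow dresE.
have dF : dintg D F.
  have := bergman_dintg ha bf bz.
  by case=> i1 i2; split; [apply: eq_integrable i1|apply: eq_integrable i2] => //
    p /set_mem/disk_zz p1; rewrite /bker /zpow dresE.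
have mF : mfun D F.
  apply: mfunM (mfun_weight _ _); apply: mfunM; first exact: mfun_chol.
  exact/mfun_conj/mfunX/mfun_id.
apply: clim_uniq (dint_exhaust dF) _.
have cm := climZ (a n) (dint_exhaust (dintg_mono n n)).
suff E k : dint (rdisk (1 - k.+1%:R^-1)) F = a n * dint (rdisk (1 - k.+1%:R^-1)) (zmono n n).
  by under eq_fun do rewrite E.
set t := 1 - _; have t01 : 0 <= t < 1.
  by rewrite subr_ge0 invf_le1// ler1n gtrBl invr_gt0 ltr0Sn.
case/andP: t01 => t0 t1.
have st1 : Num.sqrt t < 1 by rewrite -sqrtr1 ltr_sqrt.
have mt := @measurable_rdisk R t.
apply/eqP; rewrite -subr_eq0; apply/eqP/normc_le0 => e e0.
pose J := 2 * \int[area]_(p in rdisk t) W (zz p).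
have iW : area.-integrable (rdisk t) (EFin \o (fun p : R2 => W (zz p))).
  by apply: integrableS (weight_integrable ha) => //; apply: subset_rdisk; exact: ltW.
have J0 : 0 <= J by rewrite mulr_ge0// Rintegral_ge0// => p _; exact: weight_ge0.
have d0 : 0 < e / (J + 1) by rewrite divr_gt0// ltr_wpDl.
have [N HN] := af _ _ st1 d0.
(* At least [n + 1] terms, so that the one of index [n] is among them. *)
have [p1 p2] := dint_psum_mono a (maxn N n.+1) n (ltW t1).
move: p2; rewrite leq_max ltnSn orbT => <-.
set P := fun z => _ in p1 *.
have [q1 q2] := dintZ (-1) mt p1.
have -> : dint (rdisk t) F - dint (rdisk t) P = dint (rdisk t) (fun z => F z + -1 * P z).
  by rewrite dintD// ?q2 ?mulN1r//; exact: dintgS (ltW t1) dF.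
apply: (@le_trans _ _ (2 * \int[area]_(p in rdisk t) (e / (J + 1) * W (zz p)))).
  apply: dint_norm => //.
  - apply: mfunD; first by split; [case: mF => + _|case: mF => _ +];
      apply: measurable_funS => //; apply: subset_rdisk; exact: ltW.
    apply: mfunM; first exact: mfun_cst.
    apply: mfunM (mfun_weight _ _); apply: mfunM; last exact/mfun_conj/mfunX/mfun_id.
    apply: mfun_chol; first by apply: subset_rdisk; exact: ltW.
    by move=> z _; exists (psum (dcoef a) (maxn N n.+1).-1 z); exact: wirt_psum.
  - move=> p pt; have pz := rdisk_sqrt t0 pt.
    have -> : F (zz p) + -1 * P (zz p) = (f (zz p) - psum a (maxn N n.+1) (zz p)) * ((zz p ^+ n)^*%C * (W (zz p))%:C).
      by rewrite /F /P; ring.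
    rewrite normcM ler_pM ?normc_ge0//; first by rewrite normcBC HN// leq_maxl.
    rewrite normcM normcJ normcX normc_real (ger0_norm (weight_ge0 ha _)).
    by rewrite ler_piMl ?weight_ge0// exprn_ile1 ?normc_ge0// ltW// (lt_trans pz).
  by have := integrableZl mt (e / (J + 1)) iW; apply: eq_integrable.
rewrite RintegralZl// mulrCA -/J -mulrA ler_piMr ?(ltW e0)//.
by rewrite mulrC ler_pdivrMr ?mul1r ?ltr_wpDl// lerDl.
Qed.

End Kernel.

(** * The reproducing kernel *)

Section Reproducing.
Context {R : realType} (alpha : R) (ha : -1 < alpha).
Local Notation R2 := (measurableTypeR R * measurableTypeR R)%type.
Local Notation D := (@disk2 R).
Local Notation W := (bergman_weight alpha).
Local Notation dot := (bergman_dot alpha).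
Local Notation mom := (mom alpha).
Implicit Types f g h : R[i] -> R[i].

Let mD : measurable D := @measurable_disk2 R.

Definition kcoef n : R[i] := ((mom n)^-1)%:C.

(** [mom_lower] at a level [s] between [rho] and 1 bounds the coefficients by a constant times
    [s^-n]. *)
Lemma kcoef_pbounded : pbounded kcoef.
Proof.
move=> rho /andP[r0 r1]; have [s [rs s1]] := between_ex r1.
have s0 : 0 < s by exact: le_lt_trans rs.
have [|A A0 HA] := @mom_lower R alpha ha s; first by rewrite s0.
exists A^-1; first by rewrite invr_ge0 ltW.
move=> i; have m0 := mom_gt0 ha i.
rewrite /kcoef normc_real ger0_norm ?invr_ge0 ?(ltW m0)// mulrC ler_pdivrMr// mulrC ler_pdivlMr//.
rewrite mulrC; apply: le_trans (HA i); rewrite ler_pM2l//.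
by rewrite lerXn2r ?nnegrE// ltW.
Qed.

(** The kernel depends on [z * conj w] alone; [kap] is this function of one variable, classically
    [(1 - x)^(- alpha - 2)], given here by its coefficients. *)
Definition kap : R[i] -> R[i] := projT1 (cid (pbounded_exists kcoef_pbounded)).

Lemma kapP : pseries kcoef kap.
Proof. exact: projT2 (cid (pbounded_exists kcoef_pbounded)). Qed.

Lemma chol_kap : chol kap.
Proof. exact: pseries_chol kapP. Qed.

Definition kern (w : R[i]) : R[i] -> R[i] := dres (fun z => kap (z * w^*%C)).

Lemma normc_mulJ_lt (z w : R[i]) : normc z < 1 -> normc w < 1 -> normc (z * w^*%C) <= normc w.
Proof. by move=> z1 w1; rewrite normcM normcJ ler_piMl ?normc_ge0// ltW. Qed.

Lemma chol_comp_mulr f (c : R[i]) : chol f -> normc c < 1 -> chol (fun z => f (z * c)).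
Proof.
move=> hf c1 z z1; have zc : normc (z * c) < 1.
  by rewrite normcM mulr_ilt1 ?normc_ge0.
have [a wa] := hf _ zc; exists (a * c); have wc : wirt (fun x => x * c) z c 0.
  by under eq_fun do rewrite mulrC; exact: wirt_scale.
exact: (wirt_cplx_chain (f := fun x => x * c) wa wc).
Qed.

Lemma bergman_kern w : normc w < 1 -> bergman alpha (kern w).
Proof.
move=> w1; have [r [wr r1]] := between_ex w1; have [M _ HM] := chol_bounded chol_kap r1.
apply: (bergman_bounded ha (M := M)); first by apply: chol_comp_mulr; [exact: chol_kap|rewrite normcJ].
by move=> z z1; apply: HM; apply: le_lt_trans wr; exact: normc_mulJ_lt.
Qed.

Lemma dot_linr a f g h : bergman alpha f -> bergman alpha g -> bergman alpha h ->
  dot f (fun z => a * g z + h z) = a^*%C * dot f g + dot f h.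
Proof.
move=> bf bg bh; have bl := bergman_lin ha a bg bh.
by rewrite (dot_conj ha bl bf) dot_lin// conjcD conjcM -!dot_conj.
Qed.

(** The integrand is at most [e * |f|] times the weight, and [|f| <= |f|^2 + 1] makes this
    integrable. *)
Lemma dot_close f g h (e : R) : bergman alpha f -> bergman alpha g -> bergman alpha h ->
  (forall z, normc z < 1 -> normc (g z - h z) <= e) ->
  normc (dot f g - dot f h) <= e * (2 * \int[area]_(p in D) (sqw alpha f p + W (zz p))).
Proof.
move=> bf bg bh gh.
have [[hf _ fi] hg hh] : [/\ [/\ chol f, True & area.-integrable D (EFin \o sqw alpha f)], chol g & chol h].
  by have /(bergmanP ha)[? _ ?] := bf; split => //; exact: (bergman_chol ha).
have E : dot f g - dot f h = dot f (fun z => -1 * h z + g z).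
  by rewrite dot_linr// rmorphN1 mulN1r addrC.
have e0 : 0 <= e by apply: le_trans (gh 0 _); rewrite ?normc_ge0// Normc.normc0.
have i : area.-integrable D (EFin \o (fun p : R2 => sqw alpha f p + W (zz p))).
  by have := integrableD mD fi (weight_integrable ha); apply: eq_integrable.
have -> : e * (2 * \int[area]_(p in D) (sqw alpha f p + W (zz p))) =
    2 * \int[area]_(p in D) (e * (sqw alpha f p + W (zz p))).
  by rewrite RintegralZl// mulrCA.
rewrite E dotE; apply: dint_norm => //.
- by apply: mfun_bker => //; exact: chol_lin.
- move=> p /disk_zz p1; rewrite normc_bker// mulrAC mulrC.
  have -> : -1 * h (zz p) + g (zz p) = g (zz p) - h (zz p) by ring.
  apply: ler_pM; [exact: normc_ge0| |exact: gh|].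
    by apply: mulr_ge0; [exact: normc_ge0|exact: weight_ge0].
  have -> : sqw alpha f p + W (zz p) = (abs2 (f (zz p)) + 1) * W (zz p) by rewrite /sqw; ring.
  rewrite ler_wpM2r ?weight_ge0// abs2E.
  by have := sqr_ge0 (normc (f (zz p)) - 1); have := sqr_ge0 (normc (f (zz p))); nra.
- by have := integrableZl mD e i; apply: eq_integrable.
Qed.

Lemma bergman0 : bergman alpha (fun=> 0).
Proof.
have -> : (fun=> 0) = dres (fun=> 0 : R[i]) by rewrite funeqE => z; rewrite /dres if_same.
apply: (bergman_bounded ha (M := 0)); last by move=> z _; rewrite Normc.normc0.
by move=> z _; exists 0; exact: wirt_cst.
Qed.

Lemma dot0l f : bergman alpha f -> dot (fun=> 0) f = 0.
Proof.
move=> bf; have := dot_lin ha 1 bergman0 bergman0 bf; rewrite mulr0 addr0 mul1r => /eqP.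
by rewrite -subr_eq0 opprD addrA subrr add0r oppr_eq0 => /eqP.
Qed.

(** The kernel is a uniform limit on the disk of the polynomials [g N], for which [dot_coef] turns
    the pairing into a partial sum of the series of [f] at [w]. *)
Lemma reproducing f w : bergman alpha f -> normc w < 1 -> dot f (kern w) = f w.
Proof.
move=> bf w1; have bk := bergman_kern w1.
have [a af] := chol_pseries (bergman_chol ha bf).
pose g N := dres (fun z => psum kcoef N (z * w^*%C)).
have gS N : g N.+1 = fun z => (kcoef N * w^*%C ^+ N) * zpow N z + g N z.
  rewrite funeqE => z; rewrite /g /zpow /dres; case: ifP => _; last by rewrite mulr0 addr0.
  by rewrite psumS exprMn; ring.
have g0 : g 0%N = fun=> 0.
  by rewrite funeqE => z; rewrite /g /dres /psum big_ord0 if_same.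
have key N : bergman alpha (g N) /\ dot f (g N) = psum a N w.
  elim: N => [|N [ih1 ih2]].
    rewrite g0; split; first exact: bergman0.
    by rewrite (dot_conj ha bergman0 bf) dot0l// /psum big_ord0 conjc0.
  rewrite gS; split; first exact: (bergman_lin ha _ (bergman_zpow ha N) ih1).
  rewrite dot_linr ?ih2//; last exact: (bergman_zpow ha).
  rewrite (dot_coef ha N bf af) psumS addrC; congr (_ + _).
  have kJ : (kcoef N)^*%C = kcoef N by rewrite /kcoef; simpc.
  rewrite conjcM kJ conjcX conjcK /kcoef mulrCA mulrAC -mulrA.
  by congr (_ * _); rewrite mulrA -rmorphM/= mulVf ?mul1r// gt_eqF ?mom_gt0.
have fa := luc_clim af w1.
apply: clim_uniq fa => e e0.
set J := 2 * \int[area]_(p in D) (sqw alpha f p + W (zz p)).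
have J0 : 0 <= J.
  by rewrite mulr_ge0// Rintegral_ge0// => p _; rewrite addr_ge0 ?sqw_ge0 ?weight_ge0.
have d0 : 0 < e / (J + 1) by rewrite divr_gt0// ltr_wpDl.
have [r [wr r1]] := between_ex w1; have [N HN] := kapP r1 d0.
exists N => n nN; have [bg <-] := key n.
have := @dot_close f (g n) (kern w) (e / (J + 1)) bf bg bk.
rewrite -/J => h; apply: le_trans (h _) _.
  move=> z z1; rewrite /g /kern !dresE//; apply: HN => //.
  by apply: le_lt_trans wr; exact: normc_mulJ_lt.
by rewrite mulrAC ler_pdivrMr ?ltr_wpDl// ler_pM2l// lerDl.
Qed.

Lemma kern_kern v w : normc v < 1 -> normc w < 1 -> dot (kern w) (kern v) = kap (v * w^*%C).
Proof. by move=> v1 w1; rewrite (reproducing (bergman_kern w1) v1) /kern dresE. Qed.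

(** Partial sums of [kap] on the positive axis. All terms are nonnegative, so bounds on [kap] there
    can be read off from bounds on the partial sums, and conversely. *)
Definition rsum n (r : R) : R := \sum_(i < n) r ^+ i / mom i.

Lemma psum_rsum n r : psum kcoef n r%:C = (rsum n r)%:C.
Proof.
rewrite /psum /rsum rmorph_sum/=; apply: eq_bigr => i _.
by rewrite /kcoef -rmorphXn -rmorphM mulrC.
Qed.

Lemma rsum_ge0 n r : 0 <= r -> 0 <= rsum n r.
Proof.
by move=> r0; apply: sumr_ge0 => i _; rewrite divr_ge0 ?exprn_ge0// ltW// mom_gt0.
Qed.

Lemma rsum_le n m r : 0 <= r -> (n <= m)%N -> rsum n r <= rsum m r.
Proof.
move=> r0; elim: m => [|m ih]; first by rewrite leqn0 => /eqP ->.
rewrite leq_eqVlt => /predU1P[->//|/ih/le_trans]; apply.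
by rewrite /rsum big_ord_recr/= lerDl divr_ge0 ?exprn_ge0// ltW// mom_gt0.
Qed.

Lemma kap_ge n r : 0 <= r < 1 -> rsum n r <= normc (kap r%:C).
Proof.
move=> /andP[r0 r1]; have nr : normc (r%:C : R[i]) < 1 by rewrite normc_real ger0_norm.
apply/ler_addgt0Pr => e e0; have [N HN] := luc_clim kapP nr e0.
have := HN (maxn N n) (leq_maxl _ _); rewrite psum_rsum => h.
apply: le_trans (rsum_le r0 (leq_maxr N n)) _.
have := normcD ((rsum (maxn N n) r)%:C - kap r%:C) (kap r%:C).
rewrite subrK normc_real ger0_norm ?rsum_ge0// => /le_trans; apply.
by rewrite addrC lerD2l.
Qed.

Lemma kap_le r M : 0 <= r < 1 -> (forall n, rsum n r <= M) -> normc (kap r%:C) <= M.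
Proof.
move=> /andP[r0 r1] h; have nr : normc (r%:C : R[i]) < 1 by rewrite normc_real ger0_norm.
apply: (clim_norm_le (luc_clim kapP nr)); exists 0%N => n _.
by rewrite psum_rsum normc_real ger0_norm ?rsum_ge0.
Qed.

Lemma kap_gt0 r : 0 <= r < 1 -> 0 < normc (kap r%:C).
Proof.
move=> r01; apply: lt_le_trans (kap_ge 1 r01).
by rewrite /rsum big_ord1 expr0 mul1r invr_gt0 mom_gt0.
Qed.

End Reproducing.

Lemma le_div_swap (R : realType) (x y e : R) : 0 < x -> 0 < y -> y <= e * x -> x^-1 <= e / y.
Proof. by move=> x0 y0 yx; rewrite ler_pdivlMr// ler_pdivrMl// mulrC. Qed.

(** The terms from [N] on are compared one by one; the first [N] are bounded by their values at
    [r = 1]. *)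
Lemma sum_compare (R : realType) (a b : nat -> R) N n (r e : R) :
  (forall i, 0 <= a i) -> (forall i, 0 <= b i) -> 0 <= e ->
  (forall i, (N <= i)%N -> a i <= e * b i) -> 0 <= r -> r <= 1 ->
  \sum_(i < n) r ^+ i * a i <= \sum_(i < N) 1 * a i + e * \sum_(i < n) r ^+ i * b i.
Proof.
move=> a0 b0 e0 ab r0 r1.
(* The head is cut off at [k]: it grows with the sum while [k < N] and stays fixed afterwards. *)
have S k : \sum_(i < k) r ^+ i * a i <= \sum_(i < N | (i < k)%N) a i + e * \sum_(i < k) r ^+ i * b i.
  rewrite -(big_mkord (fun=> true) (fun i => r ^+ i * a i)) -(big_mkord (fun=> true) (fun i => r ^+ i * b i)).
  rewrite -(big_mkord (fun i => i < k)%N a).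
  elim: k => [|k ih]; first by rewrite [leLHS]big_geq// [X in _ * X]big_geq// mulr0 addr0 big_pred0.
  rewrite !big_nat_recr//= mulrDr.
  have [kN|Nk] := ltnP k N.
    have -> : \sum_(0 <= i < N | (i < k.+1)%N) a i = \sum_(0 <= i < N | (i < k)%N) a i + a k.
      have <- : \sum_(0 <= i < N | i == k) a i = a k by rewrite big_nat1_eq kN.
      rewrite big_mkcond [X in _ = X + _]big_mkcond [X in _ = _ + X]big_mkcond -big_split/=.
      apply: eq_bigr => i _; rewrite ltnS leq_eqVlt.
      by case: (eqVneq i k) => [->|] /=; rewrite ?ltnn ?add0r// addr0.
    have h1 : r ^+ k * a k <= a k by rewrite ler_piMl// exprn_ile1.
    have h2 : 0 <= e * (r ^+ k * b k) by rewrite !mulr_ge0// exprn_ge0.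
    by move: ih h1 h2; lra.
  have -> : \sum_(0 <= i < N | (i < k.+1)%N) a i = \sum_(0 <= i < N | (i < k)%N) a i.
    apply: congr_big_nat => // i /andP[_ iN]; have ik := leq_trans iN Nk.
    by rewrite ik ltnS ltnW.
  have h : r ^+ k * a k <= e * (r ^+ k * b k) by rewrite mulrCA ler_wpM2l ?exprn_ge0// ab.
  by move: ih h; lra.
apply: le_trans (S n) _; rewrite lerD2r.
rewrite [leRHS](bigID (fun i : 'I_N => (i < n)%N))/=.
under [X in _ <= X + _]eq_bigr do rewrite mul1r.
by rewrite lerDl sumr_ge0// => i _; rewrite mul1r.
Qed.

(** * Comparison of the kernels for two weights *)

Section Comparison.
Context {R : realType} (alpha beta : R) (ha : -1 < alpha) (hb : -1 < beta) (hab : alpha < beta).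
Local Notation R2 := (measurableTypeR R * measurableTypeR R)%type.
Local Notation D := (@disk2 R).

Let mD : measurable D := @measurable_disk2 R.

(** The disk is split at [|z|^2 = s = 1 - d]. Near the circle the quotient of the weights is at most
    [C * d ^ (beta - alpha)], and [d] is chosen to make this at most [e / 2]. Inside,
    [|z|^(2n) <= s^n], which is negligible against [mom alpha n >= A * s'^n] for [s < s']. *)
Lemma mom_ratio e : 0 < e -> exists N, forall n, (N <= n)%N -> mom beta n <= e * mom alpha n.
Proof.
move=> e0; pose C := (beta + 1) / (alpha + 1).
have a1 : 0 < alpha + 1 by move: ha; lra.
have b1 : 0 < beta + 1 by move: hb; lra.
have C0 : 0 < C by rewrite divr_gt0.
pose g := beta - alpha; have g0 : 0 < g by rewrite subr_gt0.
pose d := Num.min 2^-1 ((e / 2 / C) `^ g^-1).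
have eC : 0 < e / 2 / C by rewrite !divr_gt0.
have d0 : 0 < d by rewrite lt_min invr_gt0 ltr0n powR_gt0.
have d1 : d <= 2^-1 by rewrite ge_min lexx.
have dg : C * d `^ g <= e / 2.
  rewrite mulrC -ler_pdivlMr//.
  have -> : e / 2 / C = ((e / 2 / C) `^ g^-1) `^ g.
    by rewrite -powRrM mulVf ?gt_eqF// powRr1// ltW.
  by rewrite ge0_ler_powR ?nnegrE ?powR_ge0 ?(ltW d0) ?(ltW g0)// ge_min lexx orbT.
pose s := 1 - d; have s0 : 0 < s by rewrite /s; lra.
have s1 : s < 1 by rewrite /s; lra.
have [s' [ss s'1]] := between_ex s1; have s'0 := lt_trans s0 ss.
have [|A A0 HA] := @mom_lower R alpha ha s'; first by rewrite s'0.
have m0 := mom_gt0 ha 0.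
have upper n : mom beta n <= C * (d `^ g * mom alpha n + s ^+ n * mom alpha 0).
  have iZ k j : area.-integrable D (EFin \o (fun p : R2 => k * (rsq p ^+ j * bergman_weight alpha (zz p)))).
    by have := integrableZl mD k (mom_integrable ha j); apply: eq_integrable.
  have iD : area.-integrable D (EFin \o (fun p : R2 => d `^ g * (rsq p ^+ n * bergman_weight alpha (zz p)) + s ^+ n * (rsq p ^+ 0 * bergman_weight alpha (zz p)))).
    by have := integrableD mD (iZ (d `^ g) n) (iZ (s ^+ n) 0%N); apply: eq_integrable.
  rewrite /mom -!RintegralZl//; try exact: mom_integrable.
  rewrite -RintegralD// -RintegralZl//.
  apply: le_Rintegral => //; first exact: mom_integrable.
    by have := integrableZl mD C iD; apply: eq_integrable.
  move=> p; rewrite disk2E /rdisk/= => p1; rewrite /bergman_weight -[abs2 (zz p)]/(rsq p) expr0 mul1r.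
  have x0 : 0 <= rsq p := rsq_ge0 p.
  move: (rsq p) p1 x0 => x x1 x0.
  have y0 : 0 < 1 - x by rewrite subr_gt0.
  have P0 := powR_ge0 (1 - x) alpha.
  have E : (1 - x) `^ beta = (1 - x) `^ g * (1 - x) `^ alpha.
    rewrite -powRD; last by apply/implyP => _; rewrite gt_eqF.
    by rewrite /g subrK.
  have -> : C * (d `^ g * (x ^+ n * (pi^-1 * (alpha + 1) * (1 - x) `^ alpha)) +
      s ^+ n * (pi^-1 * (alpha + 1) * (1 - x) `^ alpha)) =
      pi^-1 * (beta + 1) * ((d `^ g * x ^+ n + s ^+ n) * (1 - x) `^ alpha).
    by rewrite /C; move: (pi^-1) => k; field; rewrite (gt_eqF a1).
  have -> : x ^+ n * (pi^-1 * (beta + 1) * (1 - x) `^ beta) =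
      pi^-1 * (beta + 1) * (x ^+ n * (1 - x) `^ g * (1 - x) `^ alpha) by rewrite E; ring.
  rewrite ler_wpM2l ?mulr_ge0 ?invr_ge0 ?pi_ge0 ?(ltW b1)// ler_wpM2r//.
  have G0 := powR_ge0 d g.
  have [xs|xs] := ltP x s.
    apply: (@le_trans _ _ (s ^+ n)); last by rewrite lerDr mulr_ge0 ?exprn_ge0.
    rewrite -[leRHS]mulr1 ler_pM ?exprn_ge0 ?powR_ge0//; first by rewrite lerXn2r ?nnegrE// ltW.
    apply: (@le_trans _ _ (1 `^ g)); last by rewrite powR1.
    by rewrite ge0_ler_powR ?nnegrE ?(ltW y0) ?(ltW g0)// gerBl.
  apply: (@le_trans _ _ (d `^ g * x ^+ n)); last by rewrite lerDl exprn_ge0 ?ltW.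
  rewrite mulrC ler_wpM2r ?exprn_ge0// ge0_ler_powR ?nnegrE ?(ltW y0) ?(ltW g0) ?(ltW d0)//.
  by move: xs; rewrite /s; lra.
have q01 : 0 <= s / s' < 1.
  by rewrite divr_ge0 ?(ltW s0) ?(ltW s'0)//= ltr_pdivrMr// mul1r.
have k0 : 0 < C * mom alpha 0 / A by rewrite divr_gt0// mulr_gt0.
have [|N HN] := pow_small q01 (_ : 0 < e / 2 / (C * mom alpha 0 / A)).
  by rewrite divr_gt0// divr_gt0.
exists N => n nN; apply: le_trans (upper n) _.
have -> : C * (d `^ g * mom alpha n + s ^+ n * mom alpha 0) =
    C * d `^ g * mom alpha n + C * mom alpha 0 / A * (s / s') ^+ n * (A * s' ^+ n).
  by rewrite expr_div_n; field; rewrite (gt_eqF A0) expf_neq0// gt_eqF.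
rewrite [in leRHS](splitr e) (mulrDl (e / 2)) lerD//.
  by rewrite ler_wpM2r// ltW// mom_gt0.
apply: (@le_trans _ _ (e / 2 * (A * s' ^+ n))).
  rewrite ler_wpM2r ?mulr_ge0 ?(ltW A0) ?exprn_ge0 ?(ltW s'0)//.
  by rewrite mulrC -ler_pdivlMr// ltW// HN.
by rewrite ler_wpM2l ?divr_ge0 ?(ltW e0).
Qed.

Lemma mom_le_mom0 n : mom beta n <= mom beta 0.
Proof.
apply: le_Rintegral => //; try exact: mom_integrable.
move=> p; rewrite disk2E /rdisk/= => p1; rewrite ler_wpM2r ?weight_ge0// expr0.
by rewrite exprn_ile1 ?rsq_ge0// ltW.
Qed.

(** [mom_ratio] handles the terms from [N] on. The first [N] are bounded by a constant [C], and the
    kernel for [beta] is unbounded near 1, its coefficients being at least [1 / mom beta 0]; so [C]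
    is absorbed as well. *)
Lemma kap_ratio e : 0 < e -> exists2 r0, 0 <= r0 < 1 & forall r, r0 <= r < 1 ->
  normc (kap ha r%:C) <= e * normc (kap hb r%:C).
Proof.
move=> e0; have e20 : 0 < e / 2 by rewrite divr_gt0.
have [N HN] := mom_ratio e20.
pose C := rsum alpha N 1; have C0 : 0 <= C := rsum_ge0 ha N ler01.
have m0 := mom_gt0 hb 0.
(* With [r0 = 1 - 1 / (2 m)], Bernoulli's inequality gives [r ^+ m >= 1 / 2] for [r >= r0], so the
   first [m] terms sum to at least [m / (2 mom beta 0)]; [m >= X] makes [e / 2] times this at least
   [C]. *)
pose X := C * 2 * mom beta 0 / (e / 2); have X0 : 0 <= X by rewrite !mulr_ge0 ?invr_ge0// ltW.
pose m := (Num.truncn X).+1.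
have mX : X <= m%:R by rewrite /m ltW// truncnS_gt.
pose r0 : R := 1 - (2 * m%:R)^-1.
have m1 : 0 < 2 * m%:R :> R by rewrite mulr_gt0.
have r00 : 0 <= r0.
  by rewrite subr_ge0 invf_le1// /m -natrM ler1n muln_gt0.
have bern k : 1 - k%:R / (2 * m%:R) <= r0 ^+ k.
  elim: k => [|k ih]; first by rewrite mul0r subr0 expr0.
  rewrite exprS; apply: le_trans (ler_wpM2l r00 ih).
  rewrite /r0 -natr1; have := ler0n R k; move: (k%:R) => x x0.
  have : 0 < (2 * m%:R : R)^-1 by rewrite invr_gt0.
  move: ((2 * m%:R)^-1) => y y0; nra.
exists r0; first by rewrite r00/= gtrBl invr_gt0.
move=> r /andP[rr r1]; have rge0 : 0 <= r := le_trans r00 rr.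
have r01 : 0 <= r < 1 by rewrite rge0.
have big : C <= e / 2 * normc (kap hb r%:C).
  have : m%:R / 2 / mom beta 0 <= normc (kap hb r%:C).
    apply: le_trans (kap_ge hb m r01).
    have -> : m%:R / 2 / mom beta 0 = \sum_(i < m) (2^-1 / mom beta 0).
      by rewrite sumr_const card_ord -[RHS]mulr_natl mulrA.
    apply: ler_sum => i _.
    rewrite ler_pM ?invr_ge0 ?(ltW m0)//; last by rewrite lef_pV2 ?posrE ?mom_gt0// mom_le_mom0.
    have rm : 2^-1 <= r ^+ m.
      apply: (@le_trans _ _ (r0 ^+ m)); last by rewrite lerXn2r ?nnegrE.
      apply: le_trans (bern m); rewrite invfM mulrCA divff ?mulr1 ?pnatr_eq0//; lra.
    by apply: le_trans rm _; apply: ler_wiXn2l; [|exact: ltW|exact: ltnW (ltn_ord i)].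
  move=> h; apply: le_trans (ler_wpM2l (ltW e20) h).
  have -> : e / 2 * (m%:R / 2 / mom beta 0) = m%:R * (e / 2) / mom beta 0 / 2 by ring.
  rewrite ler_pdivlMr// ler_pdivlMr//.
  by move: mX; rewrite /X ler_pdivrMr.
apply: kap_le => // n; rewrite [e]splitr mulrDl.
have hN i : (N <= i)%N -> (mom alpha i)^-1 <= e / 2 * (mom beta i)^-1.
  by move=> /HN; apply: le_div_swap; exact: mom_gt0.
have aV i : 0 <= (mom alpha i)^-1 by rewrite invr_ge0; exact: ltW (mom_gt0 ha i).
have bV i : 0 <= (mom beta i)^-1 by rewrite invr_ge0; exact: ltW (mom_gt0 hb i).
have := @sum_compare R _ _ N n r (e / 2) aV bV (ltW e20) hN rge0 (ltW r1).
move=> /le_trans; apply; apply: lerD; last by rewrite ler_pM2l//; exact: kap_ge.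
by apply: le_trans big; apply: eqW; apply: eq_bigr => i _; rewrite expr1n.
Qed.

End Comparison.

(** * Hilbert spaces and projections *)

Section InnerProduct.
Context {R : realType} {V : lmodType R[i]}.
Implicit Types (S T : set V) (u v w : V).

Definition linear_set S := S 0 /\ forall (a : R[i]) u v, S u -> S v -> S (a *: u + v).

(** The pairings of interest are defined on a whole function space but behave well on the members of
    the Hilbert space, hence axioms relative to [S]. Positivity is semidefinite. *)
Definition inner_on S (dot : V -> V -> R[i]) := [/\ linear_set S,
  (forall a u v w, S u -> S v -> S w -> dot (a *: u + v) w = a * dot u w + dot v w),
  (forall u v, S u -> S v -> dot v u = (dot u v)^*%C) &
  (forall u, S u -> 0 <= complex.Re (dot u u))].

Definition complete_on T (dot : V -> V -> R[i]) := forall s : nat -> V, (forall n, T (s n)) ->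
  (forall e : R, 0 < e -> exists N, forall n m, (N <= n)%N -> (N <= m)%N ->
     complex.Re (dot (s n - s m) (s n - s m)) <= e) ->
  exists2 l, T l & forall e : R, 0 < e -> exists N, forall n, (N <= n)%N ->
     complex.Re (dot (s n - l) (s n - l)) <= e.

Context (S : set V) (dot : V -> V -> R[i]) (ip : inner_on S dot).

Let q u : R := complex.Re (dot u u).

Let Slin a u v : S u -> S v -> S (a *: u + v). Proof. by case: ip => -[_ +] _ _ _; exact. Qed.

Let S0 : S 0. Proof. by case: ip => -[]. Qed.

Lemma ip_sub u v : S u -> S v -> S (u - v).
Proof. by move=> su sv; rewrite addrC -scaleN1r; exact: Slin. Qed.

Lemma ip_linl a u v w : S u -> S v -> S w -> dot (a *: u + v) w = a * dot u w + dot v w.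
Proof. by case: ip => _ + _ _; exact. Qed.

Lemma ip_conj u v : S u -> S v -> dot v u = (dot u v)^*%C.
Proof. by case: ip => _ _ + _; exact. Qed.

Lemma ip_linr a u v w : S u -> S v -> S w -> dot w (a *: u + v) = a^*%C * dot w u + dot w v.
Proof.
move=> su sv sw; have sl := Slin a su sv.
by rewrite (ip_conj sl sw) ip_linl// conjcD conjcM -!ip_conj.
Qed.

Lemma ip_subl u v w : S u -> S v -> S w -> dot (u - v) w = dot u w - dot v w.
Proof. by move=> su sv sw; rewrite addrC -scaleN1r ip_linl// mulN1r addrC. Qed.

Lemma ip_subr u v w : S u -> S v -> S w -> dot w (u - v) = dot w u - dot w v.
Proof.
move=> su sv sw; rewrite (ip_conj (ip_sub su sv) sw) ip_subl// conjcB.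
by rewrite -!ip_conj.
Qed.

Lemma ip_lin_sq a u v : S u -> S v ->
  q (a *: u + v) = normc a ^+ 2 * q u + 2 * complex.Re (a * dot u v) + q v.
Proof.
move=> su sv; rewrite /q ip_linl ?ip_linr//; try exact: Slin.
rewrite (ip_conj su sv) -abs2E.
have -> : a * (a^*%C * dot u u + dot u v) + (a^*%C * (dot u v)^*%C + dot v v) =
    dot u u * (abs2 a)%:C + (a * dot u v + (a * dot u v)^*%C) + dot v v.
  by rewrite abs2_mulJ conjcM; ring.
rewrite !ReD ReM_real.
have ReC (z : R[i]) : complex.Re z^*%C = complex.Re z by case: z.
by rewrite ReC; ring.
Qed.

Lemma ip_scale a b u v : S u -> S v -> dot (a *: u) (b *: v) = a * b^*%C * dot u v.
Proof.
move=> su sv; have z0 w : S w -> dot 0 w = 0.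
  move=> sw; have := ip_linl (-1) S0 S0 sw.
  by rewrite scaler0 addr0 mulN1r addNr.
have zr w : S w -> dot w 0 = 0.
  by move=> sw; rewrite (ip_conj S0 sw) z0// conjc0.
have sb : S (b *: v) by rewrite -[_ *: _]addr0; exact: Slin.
rewrite -[a *: u]addr0 ip_linl// z0// addr0 -[b *: v]addr0 ip_linr// zr// addr0.
by rewrite mulrA.
Qed.

Lemma ip_ge0 u : S u -> 0 <= q u.
Proof. by case: ip => _ _ _; exact. Qed.

(** Discriminant of a quadratic form. With [e = q v] it is the Cauchy-Schwarz inequality; with [e]
    the excess of a near-minimizer over the infimum it gives near-orthogonality. *)
Lemma ip_min u v (e : R) : S u -> S v ->
  (forall a, 0 <= normc a ^+ 2 * q u + 2 * complex.Re (a * dot u v) + e) ->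
  normc (dot u v) ^+ 2 <= q u * e.
Proof.
move=> su sv h; set m := normc (dot u v) ^+ 2.
have qu := ip_ge0 su.
have key (t : R) : 0 <= t ^+ 2 * m * q u - 2 * t * m + e.
  have := h ((- t)%:C * (dot u v)^*%C).
  rewrite normcM normcJ normc_real normrN exprMn real_normK ?num_real// -/m.
  have -> : (- t)%:C * (dot u v)^*%C * dot u v = (- t * m)%:C.
    by rewrite -mulrA (mulrC _^*%C) -abs2_mulJ abs2E -/m; simpc.
  by rewrite /=; lra.
have m0 : 0 <= m by rewrite sqr_ge0.
have [q0|q0] := eqVneq (q u) 0.
  rewrite q0 mul0r; rewrite q0 in key.
  have [//|m1] := leP m 0.
  (* For [q u = 0] the expression is affine in [t], and this [t] gives [- e - 2], negative because
     [t = 0] gives [e >= 0]. *)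
  have := key ((e + 1) / m).
  have -> : ((e + 1) / m) ^+ 2 * m * 0 - 2 * ((e + 1) / m) * m + e = - e - 2.
    by field; rewrite gt_eqF.
  by have := key 0; lra.
have q1 : 0 < q u by rewrite lt_def q0.
(* The minimum of the quadratic in [t]. *)
have := key (q u)^-1.
have -> : (q u)^-1 ^+ 2 * m * q u - 2 * (q u)^-1 * m + e = (q u * e - m) / q u by field.
by rewrite pmulr_lge0 ?invr_gt0// subr_ge0.
Qed.

Lemma cauchy_schwarz u v : S u -> S v -> normc (dot u v) ^+ 2 <= q u * q v.
Proof.
move=> su sv; apply: ip_min => // a.
by rewrite -ip_lin_sq//; apply: ip_ge0; exact: Slin.
Qed.

(** A minimizing sequence for the distance to [u] is Cauchy by the parallelogram law. Its limit is
    orthogonal by [ip_min], applied to the near-minimizers and not to the limit itself. *)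
Lemma projection_exists T u : T `<=` S -> linear_set T -> complete_on T dot -> S u ->
  exists2 l, T l & forall w, T w -> dot (u - l) w = 0.
Proof.
move=> TS [T0 Tlin] Tc su.
pose E := [set q (u - t) | t in T].
have lbE : has_lbound E by exists 0 => _ [t Tt <-]; apply: ip_ge0; exact: ip_sub (TS _ Tt).
have iE : has_inf E by split => //; exists (q (u - 0)), 0.
pose I := inf E.
have Ile t : T t -> I <= q (u - t) by move=> Tt; apply: ge_inf => //; exists t.
have ex n : exists t, T t /\ q (u - t) < I + n.+1%:R^-1.
  have n0 : 0 < (n.+1%:R^-1 : R) by rewrite invr_gt0.
  by have [_ [t Tt <-] h] := inf_adherent n0 iE; exists t.
have [s hs] := choice ex.
have Ts n : T (s n) := (hs n).1.
have Ss n : S (s n) := TS _ (Ts n).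
have Su n : S (u - s n) by exact: ip_sub.
have small (e : R) : 0 < e -> exists N, forall n, (N <= n)%N -> n.+1%:R^-1 <= e.
  move=> e0; have [N _ HN] := near_infty_natSinv_lt (PosNum e0).
  by exists N => n nN; apply: ltW; exact: HN.
have variational n a w : T w ->
    0 <= normc a ^+ 2 * q w + 2 * complex.Re (a * dot w (u - s n)) + n.+1%:R^-1.
  move=> Tw; have Sw := TS _ Tw.
  have : I <= q (a *: w + (u - s n)).
    have -> : a *: w + (u - s n) = u - ((- a) *: w + s n).
      by rewrite scaleNr opprD opprK addrCA addrA.
    by apply: Ile; exact: Tlin.
  rewrite ip_lin_sq//; have aux (x A B r : R) : I <= A + B + x -> x < I + r -> 0 <= A + B + r.
    by clearbody I; lra.
  by move=> h; apply: aux h (hs n).2.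
have Cs : forall e : R, 0 < e -> exists N, forall n m, (N <= n)%N -> (N <= m)%N -> q (s n - s m) <= e.
  move=> e e0; have e40 : 0 < e / 4 by rewrite divr_gt0.
  have [N HN] := small _ e40; exists N => n m /HN nn /HN mm.
  (* The parallelogram law; the midpoint lies in [T], so its squared distance to [u] is at least
     [I]. *)
  have par : q (s n - s m) = 2 * q (u - s n) + 2 * q (u - s m) - 4 * q (u - (2^-1 *: (s n - s m) + s m)).
    have Tm : S (s n - s m) by exact: ip_sub.
    have -> : u - s n = (-1) *: (s n - s m) + (u - s m).
      by rewrite scaleN1r opprB [RHS]addrC addrA subrK.
    have -> : u - (2^-1 *: (s n - s m) + s m) = (- 2^-1) *: (s n - s m) + (u - s m).
      by rewrite scaleNr opprD addrCA.
    rewrite !ip_lin_sq// normcN normcN Normc.normc1 expr1n mul1r.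
    have h2 : (2^-1 : R[i]) = (2^-1 : R)%:C by rewrite fmorphV rmorph_nat.
    rewrite h2 normc_real ger0_norm ?invr_ge0// -[- (2^-1)%:C]rmorphN/= mulN1r.
    have ReN (z : R[i]) : complex.Re (- z) = - complex.Re z by case: z.
    by rewrite (mulrC _%:C) ReM_real ReN; field.
  have Th : T (2^-1 *: (s n - s m) + s m).
    by apply: (Tlin) => //; rewrite addrC -scaleN1r; exact: Tlin.
  have aux (x y z r r' : R) : I <= z -> x < I + r -> y < I + r' -> r <= e / 4 -> r' <= e / 4 ->
      2 * x + 2 * y - 4 * z <= e by clear; lra.
  by rewrite par; exact: aux (Ile _ Th) (hs n).2 (hs m).2 nn mm.
have [l Tl hl] := Tc s Ts Cs.
have Sl := TS _ Tl.
exists l => // w Tw; have Sw := TS _ Tw; have qw := ip_ge0 Sw.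
apply: normc_le0 => e e0; have e20 : 0 < e / 2 by rewrite divr_gt0.
have d0 : 0 < (e / 2) ^+ 2 / (q w + 1) by rewrite divr_gt0 ?exprn_gt0// ltr_wpDl.
have [N1 H1] := small _ d0; have [N2 H2] := hl _ d0.
pose n := maxn N1 N2.
have b1 : normc (dot w (u - s n)) <= e / 2.
  rewrite -ler_sqr ?nnegrE ?normc_ge0 ?(ltW e20)//.
  apply: le_trans (ip_min Sw (Su n) (fun a => variational n a w Tw)) _.
  apply: le_trans (ler_wpM2l qw (H1 n (leq_maxl _ _))) _.
  by rewrite mulrC mulrAC ler_pdivrMr ?ltr_wpDl// ler_wpM2l ?sqr_ge0// lerDl.
have b2 : normc (dot w (s n - l)) <= e / 2.
  rewrite -ler_sqr ?nnegrE ?normc_ge0 ?(ltW e20)//.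
  apply: le_trans (cauchy_schwarz Sw (ip_sub (Ss n) Sl)) _.
  apply: le_trans (ler_wpM2l qw (H2 n (leq_maxr _ _))) _.
  by rewrite mulrC mulrAC ler_pdivrMr ?ltr_wpDl// ler_wpM2l ?sqr_ge0// lerDl.
rewrite (ip_conj Sw (ip_sub su Sl)) normcJ.
have -> : dot w (u - l) = dot w (u - s n) + dot w (s n - l).
  by rewrite !ip_subr// addrA subrK.
by rewrite (le_trans (normcD _ _))// [leRHS]splitr lerD.
Qed.

End InnerProduct.

(** * Completeness of the Bergman space *)

Section Completeness.
Context {R : realType} (alpha : R) (ha : -1 < alpha).
Local Notation R2 := (measurableTypeR R * measurableTypeR R)%type.
Local Notation D := (@disk2 R).
Local Notation dot := (bergman_dot alpha).
Local Notation F := (R[i] -> R[i] : lmodType R[i]).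

Let mD : measurable D := @measurable_disk2 R.

Lemma bergman_inner : inner_on (bergman alpha : set F) dot.
Proof.
split; first split.
- exact: bergman0.
- by move=> a u v; exact: bergman_lin.
- by move=> a u v w; exact: dot_lin.
- by move=> u v; exact: dot_conj.
- by move=> u _; exact: dot_self_ge0.
Qed.

Definition bsq (f : F) : R := complex.Re (dot f f).

Lemma bsqE f : bsq f = \int[area]_(p in D) sqw alpha f p.
Proof. by rewrite /bsq dot_self. Qed.

(** Cauchy-Schwarz against the reproducing kernel at [w], whose squared norm is bounded on smaller
    disks. *)
Lemma point_bound (rho : R) : rho < 1 -> exists2 M, 0 <= M &
  forall f w, bergman alpha f -> normc w < rho -> normc (f w) ^+ 2 <= M * bsq f.
Proof.
move=> r1; have [M M0 HM] := chol_bounded (chol_kap ha) r1.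
exists M => // f w bf wr; have w1 : normc w < 1 := lt_trans wr r1.
have bk := bergman_kern ha w1.
have := cauchy_schwarz bergman_inner bf bk.
rewrite (reproducing ha bf w1) kern_kern// => /le_trans; apply.
rewrite mulrC ler_wpM2r ?dot_self_ge0//.
apply: le_trans (ler_norm _) _; apply: le_trans (normc_ge_Re _) _.
by apply: HM; apply: le_lt_trans wr; exact: normc_mulJ_lt.
Qed.

(** By [point_bound] a Cauchy sequence converges locally uniformly, to a holomorphic limit by
    [Weierstrass]; Fatou's lemma then gives convergence in norm. *)
Lemma bergman_complete : complete_on (bergman alpha : set F) dot.
Proof.
move=> s bs Cs.
have bsub n m : bergman alpha (s n - s m) by exact: (ip_sub bergman_inner).
have unif (rho e : R) : rho < 1 -> 0 < e -> exists N, forall n m w, (N <= n)%N -> (N <= m)%N ->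
    normc w < rho -> normc (s n w - s m w) <= e.
  move=> r1 e0; have [M M0 HM] := point_bound r1.
  have d0 : 0 < e ^+ 2 / (M + 1) by rewrite divr_gt0 ?exprn_gt0// ltr_wpDl.
  have [N HN] := Cs _ d0; exists N => n m w nN mN wr.
  rewrite -ler_sqr ?nnegrE ?normc_ge0 ?(ltW e0)//.
  apply: le_trans (HM _ _ (bsub n m) wr) _.
  apply: le_trans (ler_wpM2l M0 (HN n m nN mN)) _.
  by rewrite mulrC mulrAC ler_pdivrMr ?ltr_wpDl// ler_wpM2l ?sqr_ge0// lerDl.
have ex w : exists l : R[i], normc w < 1 -> clim (fun n => s n w) l.
  have [w1|w1] := ltP (normc w) 1; last by exists 0.
  have [r [wr r1]] := between_ex w1.
  have [|l hl] := @clim_cauchy R (fun n => s n w); last by exists l.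
  move=> e e0; have [N HN] := unif _ _ r1 e0; exists N => n m nN mN; exact: HN.
have [g hg] := choice ex.
have luc_s : luc s (dres g).
  move=> rho e r1 e0; have [N HN] := unif _ _ r1 e0; exists N => n nN w wr.
  have w1 := lt_trans wr r1; rewrite dresE// normcBC.
  have := climD (hg w w1) (clim_cst (- s n w)) => cv.
  by apply: (clim_norm_le cv); exists N => m mN; exact: HN.
have cg : chol (dres g).
  have wn n w : exists a, normc w < 1 -> wirt (s n) w a 0.
    have [w1|w1] := ltP (normc w) 1; last by exists 0.
    by have [a wa] := bergman_chol ha (bs n) w1; exists a.
  have wn' n : exists h : R[i] -> R[i], forall w, normc w < 1 -> wirt (s n) w (h w) 0.
    by have wnn := wn n; have [h hh] := choice wnn; exists h.
  have [gn hgn] := choice wn'.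
  by have [g' hg' _] := Weierstrass luc_s (fun n w => hgn n w); move=> w w1; exists (g' w); exact: hg'.
have mfd n : measurable_fun D (sqw alpha (s n - dres g)).
  apply: measurable_sqw.
  have := chol_lin (-1) cg (bergman_chol ha (bs n)).
  by congr chol; rewrite funeqE => z; rewrite mulN1r addrC.
have key e : 0 < e -> exists N, forall n, (N <= n)%N ->
    (\int[area]_(p in D) (sqw alpha (s n - dres g) p)%:E <= e%:E)%E.
  move=> e0; have [N HN] := Cs _ e0; exists N => n nN.
  (* Shifted by [N], so that every member of the sequence given to Fatou's lemma has integral at
     most [e]. *)
  pose u m p : \bar R := (sqw alpha (s n - s (N + m)%N) p)%:E.
  have mu m : measurable_fun D (u m).
    by apply/measurable_EFinP; apply: measurable_sqw; exact: (bergman_chol ha (bsub n (N + m)%N)).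
  have u0 m p : D p -> (0 <= u m p)%E by rewrite lee_fin sqw_ge0.
  have := fatou area mD mu u0.
  have -> : (\int[area]_(p in D) limn_einf (u^~ p) = \int[area]_(p in D) (sqw alpha (s n - dres g) p)%:E)%E.
    apply: eq_integral => p /set_mem/disk_zz p1.
    have cv : u m p @[m --> \oo] --> (sqw alpha (s n - dres g) p)%:E.
      apply: cvg_EFin; first by near=> m.
      rewrite /comp/=; apply: cvgMl.
      have cr : clim (fun m => (s n - s (N + m)%N) (zz p)) ((s n - dres g) (zz p)).
        move=> d d0; have [N' HN'] := hg _ p1 _ d0; exists N' => m mN.
        rewrite -[(s n - _) _]/(s n (zz p) - s (N + m)%N (zz p)) -[(s n - dres g) _]/(s n (zz p) - dres g (zz p)).
        have -> : s n (zz p) - s (N + m)%N (zz p) - (s n (zz p) - dres g (zz p)) =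
            dres g (zz p) - s (N + m)%N (zz p) by ring.
        rewrite normcBC dresE// HN'//.
        by rewrite (leq_trans mN)// leq_addl.
      have ci := climZ (- 'i%C) cr.
      have E (z : R[i]) : complex.Re (- 'i%C * z) = complex.Im z by case: z => x y; simpc.
      have := clim_Re ci; rewrite E; under eq_fun do rewrite E.
      move=> cI; have cR := clim_Re cr.
      exact: cvgD (cvgM cR cR) (cvgM cI cI).
    by rewrite (cvg_limn_einf_sup cv).1.
  move=> /le_trans; apply.
  rewrite limn_einf_lim; apply: lime_le; first exact: is_cvg_einfs.
  apply: nearW => m; apply: (@le_trans _ _ (\int[area]_(p in D) u m p)%E).
    by apply: ereal_inf_lbound; exists m => /=.
  have := HN n (N + m)%N nN (leq_addr _ _); rewrite -[complex.Re _]/(bsq _) bsqE -lee_fin.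
  rewrite /Rintegral fineK//; apply: integrable_fin_num => //.
  by have /(bergmanP ha)[] := bsub n (N + m)%N.
have [N1 HN1] := key 1 ltr01.
have bd : bergman alpha (s N1 - dres g).
  apply/(bergmanP ha); split.
  - have := chol_lin (-1) cg (bergman_chol ha (bs N1)).
    by congr chol; rewrite funeqE => z; rewrite mulN1r addrC.
  - move=> z nz; rewrite -[LHS]/(s N1 z - dres g z) (bergman_off ha (bs N1) nz) /dres.
    by move: nz; rewrite diskE => /negP/negbTE ->; rewrite subr0.
  - apply/integrableP; split; first exact/measurable_EFinP.
    under eq_integral do rewrite /= ger0_norm ?sqw_ge0//.
    by apply: le_lt_trans (HN1 _ (leqnn _)) _; rewrite ltry.
have bg : bergman alpha (dres g).
  (* The limit is in the space as a difference of two members. *)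
  have -> : dres g = s N1 - (s N1 - dres g) by rewrite opprB addrC subrK.
  exact: (ip_sub bergman_inner).
exists (dres g) => // e e0; have [N HN] := key e e0; exists N => n nN.
have bn : bergman alpha (s n - dres g) by exact: (ip_sub bergman_inner).
have := HN n nN; rewrite -[complex.Re _]/(bsq _) bsqE -lee_fin /Rintegral fineK//.
apply: integrable_fin_num => //.
by have /(bergmanP ha)[] := bn.
Unshelve. all: by end_near.
Qed.

End Completeness.

(** * Quotient modules *)

Section Quotient.
Context {R : realType} (alpha : R) (ha : -1 < alpha) (t1 t2 : R[i] -> R[i]).
Context (ht1 : bounded_holomorphic t1) (ht2 : bounded_holomorphic t2) (hT : corona t1 t2).
Local Notation dot := (bergman_dot alpha).
Local Notation H2 := (tensor_C2 (bergman_module alpha)).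
Local Notation dot2 := (hm_dot H2).
Local Notation ran := (M_Theta t1 t2 @` bergman alpha : set H2).
Local Notation Q := (hm_orth ran : set H2).
Local Notation bergman2 := (hm_space H2).
Implicit Types (F G u v : H2).

Let mD : measurable (@disk2 R) := @measurable_disk2 R.

Lemma bounded_holomorphicP f : bounded_holomorphic f -> chol f /\
  exists2 M : R, 0 <= M & forall z, normc z < 1 -> normc (f z) <= M.
Proof.
move=> [/holomorphicE hf [M HM]]; split => //.
have h z : normc z < 1 -> normc (f z) <= M.
  by move=> z1; have := HM z; rewrite diskE normE lecR => /(_ z1).
by exists M => //; apply: le_trans (h 0 _); rewrite ?normc_ge0// Normc.normc0.
Qed.

Lemma bergman_bmul f h : bounded_holomorphic h -> bergman alpha f -> bergman alpha (h \* f).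
Proof. by move=> /bounded_holomorphicP[hh [M _ HM]] bf; exact: (bergman_mul ha (M := M) bf hh HM). Qed.

Lemma bergman_poly (p : {poly R[i]}) f : bergman alpha f -> bergman alpha (fun z => p.[z] * f z).
Proof.
move=> bf; have E : horner p = psum (fun i => p`_i) (size p).
  by rewrite funeqE => z; rewrite horner_coef.
apply: (bergman_mul ha (M := \sum_(i < size p) normc (p`_i)) bf).
  by move=> z _; rewrite E; exists (psum (dcoef (fun i => p`_i)) (size p).-1 z); exact: wirt_psum.
move=> z z1; rewrite horner_coef; apply: le_trans (normc_sum _ _ _) _; apply: ler_sum => i _.
by rewrite normcM normcX ler_piMr ?normc_ge0// exprn_ile1 ?normc_ge0// ltW.
Qed.

Lemma dot2E u v : dot2 u v = dot u.1 v.1 + dot u.2 v.2.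
Proof. by []. Qed.

Lemma bergman2_inner : inner_on bergman2 dot2.
Proof.
have bi := bergman_inner ha; split; first split.
- by split; exact: bergman0.
- by move=> a u v [u1 u2] [v1 v2]; split; exact: (bergman_lin ha).
- move=> a u v w [u1 u2] [v1 v2] [w1 w2]; rewrite !dot2E.
  have E1 := ip_linl bi a u1 v1 w1; have E2 := ip_linl bi a u2 v2 w2.
  transitivity ((a * dot u.1 w.1 + dot v.1 w.1) + (a * dot u.2 w.2 + dot v.2 w.2)).
    by congr (_ + _).
  ring.
- by move=> u v [u1 u2] [v1 v2]; rewrite !dot2E conjcD -!dot_conj.
- by move=> u _; rewrite dot2E ReD addr_ge0// dot_self_ge0.
Qed.

Lemma ran_sub : ran `<=` bergman2.
Proof. by move=> _ [f bf <-]; split; exact: bergman_bmul. Qed.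

Lemma ran_linear : linear_set ran.
Proof.
have MT (a : R[i]) f g : M_Theta t1 t2 (fun z => a * f z + g z) =
    a *: (M_Theta t1 t2 f : H2) + (M_Theta t1 t2 g : H2).
  by congr (_, _); rewrite funeqE => z /=;
    [transitivity (a * (t1 z * f z) + t1 z * g z) => //|transitivity (a * (t2 z * f z) + t2 z * g z) => //]; ring.
split.
  exists (fun=> 0); first exact: bergman0.
  by congr (_, _); rewrite funeqE => z /=; rewrite mulr0.
move=> a _ _ [f bf <-] [g bg <-]; exists (fun z => a * f z + g z); first exact: bergman_lin.
exact: MT.
Qed.

Lemma MT_sub f g : (M_Theta t1 t2 f : H2) - M_Theta t1 t2 g = M_Theta t1 t2 ((f : R[i] -> R[i] : lmodType R[i]) - g).
Proof.
by congr (_, _); rewrite funeqE => z /=;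
  [transitivity (t1 z * f z - t1 z * g z) => //|transitivity (t2 z * f z - t2 z * g z) => //]; rewrite -mulrBr.
Qed.

Lemma MT_sq f : bergman alpha f -> complex.Re (dot2 (M_Theta t1 t2 f) (M_Theta t1 t2 f)) =
  \int[area]_(p in disk2) ((abs2 (t1 (zz p)) + abs2 (t2 (zz p))) * sqw alpha f p).
Proof.
move=> bf; have b1 := bergman_bmul ht1 bf; have b2 := bergman_bmul ht2 bf.
have /(bergmanP ha)[_ _ i1] := b1; have /(bergmanP ha)[_ _ i2] := b2.
rewrite dot2E !dot_self ReD/= -RintegralD//; apply: eq_Rintegral => p _.
by rewrite /sqw !abs2M; ring.
Qed.

(** The lower bound is the corona condition integrated against [|f|^2]; it lets Cauchy sequences in
    the range be pulled back, whence [ran_complete]. *)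
Lemma MT_sq_bounds : exists e M : R, [/\ 0 < e, 0 <= M & forall f, bergman alpha f ->
  e * bsq alpha f <= complex.Re (dot2 (M_Theta t1 t2 f) (M_Theta t1 t2 f)) <= M * bsq alpha f].
Proof.
have [e e0 He] := hT.
have [c1 [M1 M10 HM1]] := bounded_holomorphicP ht1.
have [c2 [M2 M20 HM2]] := bounded_holomorphicP ht2.
exists e, (M1 ^+ 2 + M2 ^+ 2); split => //; first by rewrite addr_ge0 ?sqr_ge0.
move=> f bf; have /(bergmanP ha)[hf _ fi] := bf.
have iZ (k : R) : area.-integrable disk2 (EFin \o (fun p => k * sqw alpha f p)).
  by have := integrableZl mD k fi; apply: eq_integrable.
have up p : disk2 p -> abs2 (t1 (zz p)) + abs2 (t2 (zz p)) <= M1 ^+ 2 + M2 ^+ 2.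
  by move=> /disk_zz p1; rewrite !abs2E lerD// ler_sqr ?nnegrE ?normc_ge0// ?HM1 ?HM2.
have iM : area.-integrable disk2 (EFin \o (fun p => (abs2 (t1 (zz p)) + abs2 (t2 (zz p))) * sqw alpha f p)).
  have /(bergmanP ha)[_ _ i1] := bergman_bmul ht1 bf; have /(bergmanP ha)[_ _ i2] := bergman_bmul ht2 bf.
  have := integrableD mD i1 i2; apply: eq_integrable => // p _ /=.
  by rewrite -EFinD; congr EFin; rewrite /sqw !abs2M; ring.
rewrite MT_sq// bsqE -!RintegralZl//; apply/andP; split; apply: le_Rintegral => //.
  by move=> p /He; apply: ler_wpM2r; exact: sqw_ge0.
by move=> p /up; apply: ler_wpM2r; exact: sqw_ge0.
Qed.

Lemma ran_complete : complete_on ran dot2.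
Proof.
move=> s rs Cs; have rs' n : exists f, bergman alpha f /\ M_Theta t1 t2 f = s n.
  by have [f bf E] := rs n; exists f.
have [h hh] := choice rs'.
have [e1 [M [e10 M0 HM]]] := MT_sq_bounds.
have bh n : bergman alpha (h n) by exact: (hh n).1.
have sub f g : bergman alpha f -> bergman alpha g -> bergman alpha ((f : R[i] -> R[i] : lmodType R[i]) - g).
  by move=> bf bg; exact: (ip_sub (bergman_inner ha) bf bg).
have [|l bl hl] := bergman_complete ha bh.
  move=> e e0; have d0 : 0 < e1 * e by rewrite mulr_gt0.
  have [N HN] := Cs _ d0; exists N => n m nN mN.
  have := HN n m nN mN; rewrite -(hh n).2 -(hh m).2 MT_sub => k.
  have /andP[k1 _] := HM _ (sub _ _ (bh n) (bh m)).
  by have := le_trans k1 k; rewrite ler_pM2l.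
exists (M_Theta t1 t2 l); first by exists l.
move=> e e0; have d0 : 0 < e / (M + 1) by rewrite divr_gt0// ltr_wpDl.
have [N HN] := hl _ d0; exists N => n nN.
rewrite -(hh n).2 MT_sub; have /andP[_ k2] := HM _ (sub _ _ (bh n) bl).
apply: le_trans k2 _; apply: le_trans (ler_wpM2l M0 (HN n nN)) _.
by rewrite mulrCA ler_piMr ?(ltW e0)// ler_pdivrMr ?ltr_wpDl// mul1r lerDl.
Qed.

(* [<F, eker w>] is the determinant of [(Theta w, F w)], which vanishes on the range of [M_Theta]. *)
Definition eker (w : R[i]) : H2 :=
  (fun z => - (t2 w)^*%C * kern ha w z, fun z => (t1 w)^*%C * kern ha w z).

Lemma bergmanZ a f : bergman alpha f -> bergman alpha (fun z => a * f z).
Proof.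
by move=> bf; have := bergman_lin ha a bf (bergman0 ha); under eq_fun do rewrite addr0.
Qed.

Lemma dotZr a f g : bergman alpha f -> bergman alpha g ->
  dot f (fun z => a * g z) = a^*%C * dot f g.
Proof.
move=> bf bg; have := dot_linr ha a bf bg (bergman0 ha); under eq_fun do rewrite addr0.
by move=> ->; rewrite (dot_conj ha (bergman0 ha) bf) dot0l// conjc0 addr0.
Qed.

Lemma bergman2_eker w : normc w < 1 -> bergman2 (eker w).
Proof. by move=> w1; split; apply: bergmanZ; exact: bergman_kern. Qed.

Lemma dot2_eker F w : bergman2 F -> normc w < 1 ->
  dot2 F (eker w) = - t2 w * F.1 w + t1 w * F.2 w.
Proof.
move=> [F1 F2] w1; have bk := bergman_kern ha w1.
by rewrite dot2E !dotZr// !reproducing// conjcN !conjcK.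
Qed.

Lemma orth_eker w : normc w < 1 -> Q (eker w).
Proof.
move=> w1; split; first exact: bergman2_eker.
move=> _ [f bf <-]; have be := bergman2_eker w1.
have br : bergman2 (M_Theta t1 t2 f) by apply: ran_sub; exists f.
rewrite (ip_conj bergman2_inner br be) dot2_eker//=.
have -> : - t2 w * (t1 w * f w) + t1 w * (t2 w * f w) = 0 by ring.
exact: conjc0.
Qed.

Lemma dot2_eker_eker (v w : R[i]) : normc v < 1 -> normc w < 1 ->
  dot2 (eker w) (eker v) = (t1 v * (t1 w)^*%C + t2 v * (t2 w)^*%C) * kap ha (v * w^*%C).
Proof.
move=> v1 w1; rewrite dot2_eker//; last exact: bergman2_eker.
by rewrite /= /kern !dresE//; ring.
Qed.

Lemma decomposition F : bergman2 F -> exists2 r, ran r & Q (F - r).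
Proof.
move=> bF; have [r rr hr] := projection_exists bergman2_inner ran_sub ran_linear ran_complete bF.
by exists r => //; split => //; exact: (ip_sub bergman2_inner bF (ran_sub rr)).
Qed.

Lemma projP F : bergman2 F -> Q (hm_proj Q F) /\ forall w, Q w -> dot2 (F - hm_proj Q F) w = 0.
Proof.
move=> bF; have [r rr hr] := decomposition bF.
suff : [set v | Q v /\ forall w, Q w -> dot2 (F - v) w = 0] (hm_proj Q F) by [].
(* The projection exists, so [hm_proj] does not fall back on its default value. *)
apply: (xgetPex 0); exists (F - r); split => // w Qw.
by rewrite opprB addrC subrK (ip_conj bergman2_inner Qw.1 (ran_sub rr)) (Qw.2 _ rr) conjc0.
Qed.

Lemma bergman2_act (p : {poly R[i]}) F : bergman2 F -> bergman2 (hm_act H2 p F).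
Proof. by move=> [F1 F2]; split; exact: bergman_poly. Qed.

(** Against the vector [eker w] of [Q] the projection may be dropped, and the pairing evaluates at
    [w]. Hence [eker w] is an eigenvector of the adjoint action. *)
Lemma dot2_act_eker (p : {poly R[i]}) F w : Q F -> normc w < 1 ->
  dot2 (hm_proj Q (hm_act H2 p F)) (eker w) = p.[w] * dot2 F (eker w).
Proof.
move=> QF w1; have bp := bergman2_act p QF.1; have [Qp hp] := projP bp.
have Qe := orth_eker w1.
have := hp _ Qe; rewrite (ip_subl bergman2_inner bp Qp.1 Qe.1) => /eqP; rewrite subr_eq0 => /eqP <-.
by rewrite !dot2_eker//=; [ring|exact: QF.1].
Qed.

(** The eigenvector equation lifts from the quotient to the whole space, where it determines the
    Taylor coefficients of each component up to a scalar: both are multiples of the kernel at [w].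
    Orthogonality to the range ties the two scalars together. *)
Lemma eigenvector G w : normc w < 1 -> Q G ->
  (forall F n, Q F -> dot2 (hm_proj Q (hm_act H2 'X^n F)) G = w ^+ n * dot2 F G) ->
  exists c : R[i], G = c *: eker w.
Proof.
move=> w1 QG hG.
(* The range is invariant under the action and orthogonal to [G], so a general [F] may be replaced
   by its component in [Q]. *)
have eig F n : bergman2 F -> dot2 (hm_act H2 'X^n F) G = w ^+ n * dot2 F G.
  move=> bF; have [r rr Qr] := decomposition bF; have br := ran_sub rr.
  have act_r : ran (hm_act H2 'X^n r).
    have [f bf <-] := rr; exists (fun z => ('X^n).[z] * f z); first exact: bergman_poly.
    by congr (_, _); rewrite funeqE => z /=; ring.
  have E0 v : ran v -> dot2 v G = 0.
    by move=> rv; rewrite (ip_conj bergman2_inner QG.1 (ran_sub rv)) (QG.2 _ rv) conjc0.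
  have bq := bergman2_act 'X^n Qr.1; have [Qp hp] := projP bq.
  have E1 : dot2 (hm_act H2 'X^n (F - r)) G = dot2 (hm_proj Q (hm_act H2 'X^n (F - r))) G.
    by have := hp _ QG; rewrite (ip_subl bergman2_inner bq Qp.1 QG.1) => /eqP; rewrite subr_eq0 => /eqP.
  have E2 : hm_act H2 'X^n (F - r) = hm_act H2 'X^n F - hm_act H2 'X^n r.
    by congr (_, _); rewrite funeqE => z /=;
      [transitivity (('X^n).[z] * (F.1 z - r.1 z))|transitivity (('X^n).[z] * (F.2 z - r.2 z))] => //;
      rewrite mulrBr.
  have bn := bergman2_act 'X^n bF; have brn := ran_sub act_r.
  have := hG _ n Qr; rewrite -E1 E2.
  rewrite (ip_subl bergman2_inner bn brn QG.1) (ip_subl bergman2_inner bF br QG.1).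
  by rewrite (E0 _ act_r) (E0 _ rr) !subr0.
have [[bG1 bG2] _] := QG.
(* By [dot_coef] the equation reads off the coefficient of index [n]: it is [conj w ^ n / mom n]
   times a constant, as for the kernel. *)
have one g : bergman alpha g -> (forall n, dot (zpow n) g = w ^+ n * dot (zpow 0) g) ->
    exists l : R[i], g = fun z => l * kern ha w z.
  move=> bg hg; have [a ag] := chol_pseries (bergman_chol ha bg).
  exists (dot g (zpow 0)); rewrite funeqE => z.
  have [z1|z1] := ltP (normc z) 1; last first.
    by rewrite (bergman_off ha bg) /kern /dres ?diskE ltNge z1/= ?mulr0.
  rewrite /kern dresE//; apply: clim_uniq (luc_clim ag z1) _.
  have zw : normc (z * w^*%C) < 1 by apply: le_lt_trans (normc_mulJ_lt z1 w1) w1.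
  have := climZ (dot g (zpow 0)) (luc_clim (kapP ha) zw).
  suff E n : psum a n z = dot g (zpow 0) * psum (kcoef alpha) n (z * w^*%C) by under eq_fun do rewrite -E.
  rewrite /psum mulr_sumr; apply: eq_bigr => i _.
  have m0 : ((mom alpha i)%:C : R[i]) != 0 by rewrite -normc_gt0 normc_real normr_gt0 gt_eqF// mom_gt0.
  apply: (mulIf m0); rewrite mulrAC -(dot_coef ha i bg ag).
  rewrite (dot_conj ha (bergman_zpow ha i) bg) hg conjcM -(dot_conj ha (bergman_zpow ha 0) bg).
  rewrite conjcX exprMn /kcoef.
  have -> : dot g (zpow 0) * (((mom alpha i)^-1)%:C * (z ^+ i * w^*%C ^+ i)) * (mom alpha i)%:C =
    (((mom alpha i)^-1)%:C * (mom alpha i)%:C) * (w^*%C ^+ i * dot g (zpow 0) * z ^+ i) by ring.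
  by rewrite -rmorphM/= mulVf ?mul1r// gt_eqF// mom_gt0.
have pE n : (fun z => ('X^n).[z] * zpow 0 z) = zpow n :> (R[i] -> R[i]).
  by rewrite funeqE => z; rewrite hornerXn /zpow /dres; case: ifP => _; rewrite ?mulr1 ?mulr0.
have b0 := bergman0 ha.
have d0 n : (fun z => ('X^n).[z] * 0) = (fun=> 0) :> (R[i] -> R[i]).
  by rewrite funeqE => z; rewrite mulr0.
have [l1 El1] : exists l : R[i], G.1 = fun z => l * kern ha w z.
  apply: one => // n; have := @eig (zpow 0, fun=> 0) n (conj (bergman_zpow ha 0) b0).
  by rewrite !dot2E/= pE d0 !dot0l// !addr0.
have [l2 El2] : exists l : R[i], G.2 = fun z => l * kern ha w z.
  apply: one => // n; have := @eig (fun=> 0, zpow 0) n (conj b0 (bergman_zpow ha 0)).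
  by rewrite !dot2E/= pE d0 !dot0l// !add0r.
have bk := bergman_kern ha w1.
(* Tested on the image of the constant 1, represented by [zpow 0]. *)
have rel : l1 * (t1 w)^*%C + l2 * (t2 w)^*%C = 0.
  have rz : ran (M_Theta t1 t2 (zpow 0)) by exists (zpow 0) => //; exact: bergman_zpow.
  have [r1 r2] := ran_sub rz.
  have := QG.2 _ rz; rewrite (ip_conj bergman2_inner (ran_sub rz) QG.1) dot2E El1 El2 !dotZr//.
  rewrite !reproducing//= /zpow dresE// expr0 !mulr1 => /(congr1 (fun z => z^*%C)).
  by rewrite conjcK conjc0 => /(congr1 (fun z => z^*%C)); rewrite conjc0 conjcD !conjcM !conjcK.
have [e e0 He] := hT.
pose S : R := abs2 (t1 w) + abs2 (t2 w).
have S0 : 0 < S by apply: lt_le_trans e0 (He w _); rewrite diskE.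
have SC : S%:C != 0 :> R[i] by rewrite -normc_gt0 normc_real normr_gt0 gt_eqF.
have SE : S%:C = t1 w * (t1 w)^*%C + t2 w * (t2 w)^*%C by rewrite /S rmorphD/= !abs2_mulJ.
(* By [rel], [(l1, l2)] is orthogonal to [(t1 w, t2 w)]. This is its coordinate along
   [(- conj (t2 w), conj (t1 w))], whose squared norm [S] is nonzero by the corona condition. *)
exists ((l2 * t1 w - l1 * t2 w) / S%:C).
have E1 : l1 = (l2 * t1 w - l1 * t2 w) / S%:C * - (t2 w)^*%C.
  apply: (mulIf SC); rewrite mulrAC divfK// SE.
  apply/eqP; rewrite -subr_eq0; apply/eqP.
  transitivity (t1 w * (l1 * (t1 w)^*%C + l2 * (t2 w)^*%C)); first by ring.
  by rewrite rel mulr0.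
have E2 : l2 = (l2 * t1 w - l1 * t2 w) / S%:C * (t1 w)^*%C.
  apply: (mulIf SC); rewrite mulrAC divfK// SE.
  apply/eqP; rewrite -subr_eq0; apply/eqP.
  transitivity (t2 w * (l1 * (t1 w)^*%C + l2 * (t2 w)^*%C)); first by ring.
  by rewrite rel mulr0.
rewrite [LHS]surjective_pairing El1 El2.
by congr (_, _); rewrite funeqE => z; [rewrite {1}E1 -mulrA|rewrite {1}E2 -mulrA].
Qed.

End Quotient.

(** * Isomorphisms of quotient modules *)

Section KernelRelation.
Context {R : realType}.
Implicit Types (t p : R[i] -> R[i]).

Definition gram2 (t1 t2 : R[i] -> R[i]) v w : R[i] := t1 v * (t1 w)^*%C + t2 v * (t2 w)^*%C.

(* [gram2 t1 t2 v w * kap (v * w^* )] is the reproducing kernel of the quotient module. *)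
Definition kernel_rel (al be : R) (ha : -1 < al) (hb : -1 < be) t1 t2 p1 p2 (d : R[i] -> R[i]) :=
  forall v w, normc v < 1 -> normc w < 1 ->
  gram2 t1 t2 v w * kap ha (v * w^*%C) = d v * (d w)^*%C * (gram2 p1 p2 v w * kap hb (v * w^*%C)).

Lemma mulJ_real (w : R[i]) : w * w^*%C = (normc w ^+ 2)%:C.
Proof. by rewrite -abs2_mulJ abs2E. Qed.

Lemma sqr_normc_01 (w : R[i]) : normc w < 1 -> 0 <= normc w ^+ 2 < 1.
Proof. by move=> w1; rewrite sqr_ge0 expr_lt1// normc_ge0. Qed.

Lemma kernel_rel_diag al be (ha : -1 < al) (hb : -1 < be) t1 t2 p1 p2 d w :
  kernel_rel ha hb t1 t2 p1 p2 d -> normc w < 1 ->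
  sqn t1 t2 w * normc (kap ha (normc w ^+ 2)%:C) =
  normc (d w) ^+ 2 * (sqn p1 p2 w * normc (kap hb (normc w ^+ 2)%:C)).
Proof.
move=> KR w1; have := congr1 (fun z => normc z) (KR w w w1 w1).
rewrite /gram2 -!sqnE !mulJ_real !normcM !normc_real.
have s0 f1 f2 : 0 <= sqn f1 f2 w by rewrite addr_ge0 ?abs2_ge0.
by rewrite !ger0_norm// sqr_ge0.
Qed.

(** Exchanges the two modules, which reduces [beta < alpha] to [alpha < beta]. *)
Lemma kernel_rel_inv al be (ha : -1 < al) (hb : -1 < be) t1 t2 p1 p2 d :
  (forall w, normc w < 1 -> d w != 0) ->
  kernel_rel ha hb t1 t2 p1 p2 d -> kernel_rel hb ha p1 p2 t1 t2 (fun z => (d z)^-1).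
Proof.
move=> d0 KR v w v1 w1; rewrite KR// conjc_inv.
have dw := d0 w w1; have dJ : (d w)^*%C != 0 by rewrite conjc_eq0.
by have dv := d0 v v1; field; rewrite dJ.
Qed.

(** To be read on the diagonal relation, with [N = |d|^2], [T = |Theta|^2], [P = |Phi|^2] and [A],
    [B] the two kernels: a small quotient of kernels makes [|d|^2] small. *)
Lemma ratio_bound (T P A B N M e x : R) : 0 < A -> 0 < B -> 0 < M -> 0 < e -> 0 <= N ->
  T <= M -> e <= P -> T * A = N * (P * B) -> A <= x * e / M * B -> N <= x.
Proof.
move=> A0 B0 M0 e0 N0 TM eP E AB.
have eB : 0 < e * B by rewrite mulr_gt0.
rewrite -(ler_pM2r eB).
apply: (@le_trans _ _ (N * (P * B))); first by rewrite ler_wpM2l// ler_pM2r.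
rewrite -E; apply: (@le_trans _ _ (M * A)); first by rewrite ler_pM2r.
apply: le_trans (ler_wpM2l (ltW M0) AB) _; apply: eqW; field.
by rewrite gt_eqF.
Qed.

Section Factor.
Context (al be : R) (ha : -1 < al) (hb : -1 < be) (t1 t2 p1 p2 d : R[i] -> R[i]).
Context (ht1 : chol t1) (ht2 : chol t2) (hp1 : chol p1) (hp2 : chol p2).
Context (tpos : forall z, normc z < 1 -> 0 < sqn t1 t2 z).
Context (ppos : forall z, normc z < 1 -> 0 < sqn p1 p2 z).
Context (KR : kernel_rel ha hb t1 t2 p1 p2 d).

(** On the diagonal the left side of the relation is positive. *)
Lemma kernel_rel_neq0 w : normc w < 1 -> d w != 0.
Proof.
move=> w1; apply/eqP => dw; have := kernel_rel_diag KR w1.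
rewrite dw Normc.normc0 expr0n mul0r => /eqP; rewrite mulf_eq0.
by rewrite !gt_eqF ?tpos// kap_gt0// sqr_normc_01.
Qed.

(* [d] is a quotient of two functions holomorphic in the first variable of the kernels. *)
Lemma kernel_rel_chol : chol d.
Proof.
move=> w w1; have dw := kernel_rel_neq0 w1.
have dJ : (d w)^*%C != 0 by rewrite conjc_eq0.
have wJ : normc w^*%C < 1 by rewrite normcJ.
have cg f1 f2 : chol f1 -> chol f2 -> chol (fun v => gram2 f1 f2 v w).
  move=> h1 h2; have c0 : chol (fun=> 0 : R[i]) by move=> z _; exists 0; exact: wirt_cst.
  have := chol_lin (f1 w)^*%C h1 (chol_lin (f2 w)^*%C h2 c0).
  by congr chol; rewrite funeqE => z; rewrite /gram2 addr0 mulrC (mulrC (f2 z)).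
have ck a (h : -1 < a) : chol (fun v => kap h (v * w^*%C)).
  by apply: chol_comp_mulr => //; exact: chol_kap.
(* The summand 0 gives [N] the shape expected by [chol_lin]. *)
pose N v := (d w)^*%C * (gram2 p1 p2 v w * kap hb (v * w^*%C)) + 0.
pose A v := gram2 t1 t2 v w * kap ha (v * w^*%C).
have hN : chol N.
  apply: chol_lin; last by move=> z _; exists 0; exact: wirt_cst.
  by apply: chol_mul => //; exact: cg.
have hA : chol A by apply: chol_mul => //; exact: cg.
have Nw : N w != 0.
  rewrite /N addr0 mulf_neq0// mulf_neq0//.
    by rewrite /gram2 -sqnE -normc_gt0 normc_real normr_gt0 gt_eqF// ppos.
  by rewrite -normc_gt0 mulJ_real kap_gt0// sqr_normc_01.
have [a wA] := hA w w1; have [b wN] := hN w w1.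
have := wirt_div Nw wA wN; set D := (_ / _ ^+ 2) => wD; exists D.
have n0 : 0 < normc (N w) / 2 by rewrite divr_gt0// normc_gt0.
have [d1 d10 H1] := wirt_cont wN n0; have [d2 d20 H2] := near_disk w1.
apply: wirt_eq wD; exists (Num.min d1 d2); first by rewrite lt_min d10.
move=> k; rewrite lt_min => /andP[/H1 k1 /H2 k2].
have Nk : N (w + k) != 0.
  rewrite -normc_gt0; have := normcB (N (w + k)) (N (w + k) - N w).
  by rewrite opprB addrC subrK; move: n0 k1; lra.
apply: (mulIf Nk); rewrite divfK// /A /N addr0 KR//; ring.
Qed.

Lemma kernel_rel_ratio : al = be -> forall z, normc z < 1 ->
  sqn t1 t2 z / sqn p1 p2 z = abs2 (d z).
Proof.
(* [kap] takes the proof of the bound on the exponent as an argument, hence the appeal to proof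
   irrelevance. *)
move=> ab z z1; have kE : kap ha = kap hb.
  move: ha hb KR; rewrite ab => h h' _; by rewrite (Prop_irrelevance h h').
have := kap_gt0 hb (sqr_normc_01 z1); have := kernel_rel_diag KR z1; rewrite kE.
move: (normc (kap hb _)) => k E /lt0r_neq0 k0.
move: E; rewrite mulrA => /(mulIf k0) ->.
by rewrite abs2E; exact: (mulfK (lt0r_neq0 (ppos z1))).
Qed.

(** Cauchy's formula on a circle close to the boundary bounds the value at 0. *)
Lemma chol_null_at_boundary h : chol h ->
  (forall e : R, 0 < e -> exists2 r, 0 <= r < 1 & forall z, r <= normc z < 1 -> normc (h z) <= e) ->
  h 0 = 0.
Proof.
move=> hh bnd; apply: normc_le0 => e e0.
have [|r /andP[r0 r1] Hr] := bnd (e / 8); first by rewrite divr_gt0.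
(* With [rho >= 1 / 2], [chol_bound_of_circ] at radius 1/4 yields [2 * (e / 8) / (rho - 1 / 4)], at
   most [e]. *)
pose rho : R := Num.max r 2^-1.
have rho1 : rho < 1 by rewrite gt_max r1/= invf_lt1// ltr1n.
have rho2 : 2^-1 <= rho by rewrite le_max lexx orbT.
have rrho : r <= rho by rewrite le_max lexx.
have n0 : normc (0 : R[i]) < 4^-1 by rewrite Normc.normc0 invr_gt0.
have r4 : 4^-1 < rho by lra.
have h4 : forall v, 0 <= v <= 1 -> normc (h (circ rho v)) <= e / 8.
  by move=> v _; apply: Hr; rewrite normc_circ ?rrho//; lra.
apply: le_trans (chol_bound_of_circ hh n0 r4 rho1 h4) _.
rewrite mulrA ler_pdivrMr ?subr_gt0//.
have : 4^-1 <= rho - 4^-1 by lra.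
by move: (rho - 4^-1) => x x4; nra.
Qed.

(** Here [|d|^2] is at most [M / e] times the quotient of the kernels, which tends to 0 at the
    circle by [kap_ratio]; so [d 0 = 0], against [kernel_rel_neq0]. *)
Lemma kernel_rel_lt (M e : R) : al < be -> 0 < e ->
  (forall z, normc z < 1 -> sqn t1 t2 z <= M) -> (forall z, normc z < 1 -> e <= sqn p1 p2 z) ->
  False.
Proof.
move=> ab e0 tM pe.
have z1 : normc (0 : R[i]) < 1 by rewrite Normc.normc0.
have M0 : 0 < M := lt_le_trans (tpos z1) (tM 0 z1).
suff : d 0 = 0 by apply/eqP; exact: kernel_rel_neq0.
apply: chol_null_at_boundary => [|eta eta0]; first exact: kernel_rel_chol.
have x0 : 0 < eta ^+ 2 * e / M by rewrite divr_gt0// mulr_gt0// exprn_gt0.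
have [r0 /andP[r00 r01] Hr] := kap_ratio ha hb ab x0.
(* [kap] is evaluated at [|z|^2], hence the square root. *)
exists (Num.sqrt r0); first by rewrite sqrtr_ge0 -sqrtr1 ltr_sqrt.
move=> z /andP[rz zz1].
have rz2 : r0 <= normc z ^+ 2 by rewrite -(sqr_sqrtr r00) lerXn2r ?nnegrE ?sqrtr_ge0 ?normc_ge0.
have /andP[_ z21] := sqr_normc_01 zz1.
have rz3 : r0 <= normc z ^+ 2 < 1 by rewrite rz2 z21.
rewrite -ler_sqr ?nnegrE ?normc_ge0 ?(ltW eta0)//.
exact: ratio_bound (kap_gt0 ha (sqr_normc_01 zz1)) (kap_gt0 hb (sqr_normc_01 zz1)) M0 e0
  (sqr_ge0 _) (tM z zz1) (pe z zz1) (kernel_rel_diag KR zz1) (Hr _ rz3).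
Qed.

End Factor.
End KernelRelation.

Section OnlyIf.
Context {R : realType} (al be : R) (ha : -1 < al) (hb : -1 < be) (t1 t2 p1 p2 : R[i] -> R[i]).
Context (ht1 : bounded_holomorphic t1) (ht2 : bounded_holomorphic t2) (hT : corona t1 t2).
Context (hp1 : bounded_holomorphic p1) (hp2 : bounded_holomorphic p2) (hP : corona p1 p2).

(* The evaluation functionals are the joint eigenvectors of the adjoint action. *)
Lemma isomorphic_kernel_rel :
  hm_isomorphic (bergman_quotient al t1 t2) (bergman_quotient be p1 p2) ->
  exists d, kernel_rel ha hb t1 t2 p1 p2 d.
Proof.
move=> [X [[Xmap _ Xsurj] _ Xdot Xact]].
have Qe w : normc w < 1 -> hm_space (bergman_quotient al t1 t2) (eker ha t1 t2 w).
  exact: orth_eker.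
have ex w : exists c : R[i], normc w < 1 -> X (eker ha t1 t2 w) = c *: eker hb p1 p2 w.
  have [w1|w1] := ltP (normc w) 1; last by exists 0.
  have [|F n QF|c hc] := eigenvector hb hp1 hp2 hP w1 (G := X (eker ha t1 t2 w)).
  - exact: Xmap (Qe w w1).
  (* The eigenvector equation is transported by writing [F] as the image of some [u], since [X]
     intertwines the actions and preserves the pairing. *)
  - have [u Qu uF] := Xsurj _ QF.
    have Qa : hm_space (bergman_quotient al t1 t2) (hm_act (bergman_quotient al t1 t2) 'X^n u).
      by have [] := projP ha ht1 ht2 hT (bergman2_act ha 'X^n Qu.1).
    have E1 := Xdot _ _ Qa (Qe w w1); have E2 := Xdot _ _ Qu (Qe w w1).
    rewrite (Xact _ _ Qu) in E1.
    have E3 := dot2_act_eker ha ht1 ht2 hT 'X^n Qu w1.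
    rewrite hornerXn in E3.
    by rewrite -uF; apply: etrans E1 _; apply: etrans E3 _; congr (_ * _); exact: esym E2.
  - by exists c.
(* The pairing of the vectors at [w] and [v] brings in [c w * conj (c v)], and the kernels are
   holomorphic in [v]; hence the conjugate. *)
have [c hc] := choice ex; exists (fun w => (c w)^*%C) => v w v1 w1.
have := Xdot _ _ (Qe w w1) (Qe v v1); rewrite !hc//.
have bv := bergman2_eker hb p1 p2 v1; have bw := bergman2_eker hb p1 p2 w1.
have E := ip_scale (bergman2_inner hb) (c w) (c v) bw bv.
have K1 := dot2_eker_eker ha t1 t2 v1 w1; have K2 := dot2_eker_eker hb p1 p2 v1 w1.
move=> D; apply: etrans (esym K1) _; apply: etrans (esym D) _; apply: etrans E _.
by rewrite K2 conjcK (mulrC (c w)).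
Qed.

End OnlyIf.

(** * Sufficiency: the isomorphism induced by a unitary matrix *)

Section If.
Context {R : realType} (al : R) (ha : -1 < al).
Local Notation dot := (bergman_dot al).
Local Notation H2 := (tensor_C2 (bergman_module al)).
Local Notation dot2 := (hm_dot H2).
Local Notation bergman2 := (hm_space H2).
Implicit Types (F G u v : H2).

Lemma bergman_definite f : bergman al f -> complex.Re (dot f f) = 0 -> f = fun=> 0.
Proof.
move=> bf f0; rewrite funeqE => z; have [z1|z1] := ltP (normc z) 1; last first.
  by rewrite (bergman_off ha bf)// diskE; apply/negP; rewrite -leNgt.
have [r [zr r1]] := between_ex z1; have [M _ HM] := point_bound ha r1.
have := HM f z bf zr; rewrite /bsq f0 mulr0 => h.
by apply/eqP; rewrite -normc_eq0 -sqrf_eq0 eq_le h sqr_ge0.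
Qed.

(** Definiteness of the inner product makes the two conditions determine the projection; this serves
    to recognize the image of a projection as a projection. *)
Lemma proj_unique (t1 t2 : R[i] -> R[i]) (ht1 : bounded_holomorphic t1)
    (ht2 : bounded_holomorphic t2) (hT : corona t1 t2) F v :
  let Q := hm_orth (M_Theta t1 t2 @` bergman al : set H2) in
  bergman2 F -> Q v -> (forall w, Q w -> dot2 (F - v) w = 0) -> hm_proj Q F = v.
Proof.
move=> Q bF Qv hv; have [Qp hp] := projP ha ht1 ht2 hT bF.
have bi := bergman2_inner ha.
have bQ w : Q w -> bergman2 w by case.
have D w : Q w -> dot2 (hm_proj Q F - v) w = 0.
  move=> Qw; have := hp w Qw; have := hv w Qw.
  rewrite !(ip_subl bi)//; try exact: bQ.
  by move=> /eqP; rewrite subr_eq0 => /eqP -> /eqP; rewrite subr_eq0 => /eqP ->; rewrite subrr.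
have bd : bergman2 (hm_proj Q F - v) by exact: (ip_sub bi (bQ _ Qp) (bQ _ Qv)).
have : dot2 (hm_proj Q F - v) (hm_proj Q F - v) = 0.
  by rewrite (ip_subr bi (bQ _ Qp) (bQ _ Qv) bd) !D// subrr.
case: bd; set x := hm_proj Q F - v => b1 b2; rewrite dot2E => /(congr1 (@complex.Re R)).
rewrite ReD => E.
have E' : complex.Re (dot x.1 x.1) + complex.Re (dot x.2 x.2) = 0 := E.
have g1 := dot_self_ge0 ha x.1; have g2 := dot_self_ge0 ha x.2.
have aux (r s : R) : r + s = 0 -> 0 <= r -> 0 <= s -> r = 0 /\ s = 0.
  by clear; move=> rs r0 s0; split; lra.
have [z1 z2] := aux _ _ E' g1 g2.
have x1 := bergman_definite b1 z1; have x2 := bergman_definite b2 z2.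
apply/eqP; rewrite -subr_eq0 -/x; apply/eqP.
by rewrite [LHS]surjective_pairing x1 x2.
Qed.

Definition mat2 (a b c e : R[i]) F : H2 :=
  (fun z => a * F.1 z + b * F.2 z, fun z => c * F.1 z + e * F.2 z).

Lemma bergman_mat2 a b c e F : bergman2 F -> bergman2 (mat2 a b c e F).
Proof.
by move=> [F1 F2]; split; apply: (bergman_lin ha) => //; exact: bergmanZ.
Qed.

Lemma mat2_lin a b c e (k : R[i]) u v : mat2 a b c e (k *: u + v) = k *: mat2 a b c e u + mat2 a b c e v.
Proof.
congr (_, _); rewrite funeqE => z.
  transitivity (a * (k * u.1 z + v.1 z) + b * (k * u.2 z + v.2 z)) => //.
  by transitivity (k * (a * u.1 z + b * u.2 z) + (a * v.1 z + b * v.2 z)) => //; ring.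
transitivity (c * (k * u.1 z + v.1 z) + e * (k * u.2 z + v.2 z)) => //.
by transitivity (k * (c * u.1 z + e * u.2 z) + (c * v.1 z + e * v.2 z)) => //; ring.
Qed.

Lemma mat2_dot a b c e u v : 
  a * a^*%C + c * c^*%C = 1 -> b * b^*%C + e * e^*%C = 1 ->
  a * b^*%C + c * e^*%C = 0 -> bergman2 u -> bergman2 v ->
  dot2 (mat2 a b c e u) (mat2 a b c e v) = dot2 u v.
Proof.
move=> h1 h2 h3 [u1 u2] [v1 v2].
have h4 : b * a^*%C + e * c^*%C = 0.
  by have := congr1 (fun z => z^*%C) h3; rewrite conjcD !conjcM !conjcK conjc0 => <-; ring.
have Z k f : bergman al f -> bergman al (fun z => k * f z) by exact: bergmanZ.
have dZl k f g : bergman al f -> bergman al g -> dot (fun z => k * f z) g = k * dot f g.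
  by move=> bf bg; have := dot_lin ha k bf (bergman0 ha) bg;
    under eq_fun do rewrite addr0; rewrite dot0l// addr0.
have D2 f g h k k' : bergman al f -> bergman al g -> bergman al h ->
    dot (fun z => k * f z + k' * g z) h = k * dot f h + k' * dot g h.
  by move=> bf bg bh; rewrite (dot_lin ha)//; [rewrite dZl|exact: Z].
have D2r f g h k k' : bergman al f -> bergman al g -> bergman al h ->
    dot h (fun z => k * f z + k' * g z) = k^*%C * dot h f + k'^*%C * dot h g.
  by move=> bf bg bh; rewrite (dot_linr ha)//; [rewrite dotZr|exact: Z].
rewrite !dot2E/= !D2//; try by apply: (bergman_lin ha) => //; exact: Z.
rewrite !D2r//.
transitivity ((a * a^*%C + c * c^*%C) * dot u.1 v.1 + (b * b^*%C + e * e^*%C) * dot u.2 v.2 +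
  (a * b^*%C + c * e^*%C) * dot u.1 v.2 + (b * a^*%C + e * c^*%C) * dot u.2 v.1).
  by ring.
by rewrite h1 h2 h3 h4 !mul1r !mul0r !addr0.
Qed.

Context (t1 t2 p1 p2 : R[i] -> R[i]).
Context (ht1 : bounded_holomorphic t1) (ht2 : bounded_holomorphic t2) (hT : corona t1 t2).
Context (hp1 : bounded_holomorphic p1) (hp2 : bounded_holomorphic p2) (hP : corona p1 p2).

(** The map [X] sends the range element of [h] for Theta to that of [d h] for Phi. As [d] and its
    inverse are bounded, multiplication by [d] is onto the Bergman space; so [X] maps range onto
    range and, being unitary, complement onto complement. *)
Lemma unitary_isomorphic (a b c e : R[i]) (d : R[i] -> R[i]) :
  unitary2 a b c e -> chol d -> (exists M : R, forall z, normc z < 1 -> normc (d z) <= M) ->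
  (exists2 m : R, 0 < m & forall z, normc z < 1 -> m <= normc (d z)) ->
  (forall z, normc z < 1 -> t1 z = a * (d z * p1 z) + b * (d z * p2 z) /\
     t2 z = c * (d z * p1 z) + e * (d z * p2 z)) ->
  hm_isomorphic (bergman_quotient al t1 t2) (bergman_quotient al p1 p2).
Proof.
move=> U hd [M HM] [m m0 Hm] tE.
(* The adjoint matrix, applied pointwise. *)
pose X : H2 -> H2 := mat2 a^*%C c^*%C b^*%C e^*%C.
pose Y : H2 -> H2 := mat2 a b c e.
have [U1 U2 U3 [U4 U5 U6]] := U.
have U3' : b * a^*%C + e * c^*%C = 0.
  by have := congr1 (fun z => z^*%C) U3; rewrite conjcD !conjcM !conjcK conjc0 => <-; ring.
have U6' : c * a^*%C + e * b^*%C = 0.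
  by have := congr1 (fun z => z^*%C) U6; rewrite conjcD !conjcM !conjcK conjc0 => <-; ring.
have YX F : Y (X F) = F.
  rewrite [RHS]surjective_pairing; congr (_, _); rewrite funeqE => z /=.
    transitivity ((a * a^*%C + b * b^*%C) * F.1 z + (a * c^*%C + b * e^*%C) * F.2 z); first by ring.
    by rewrite U4 U6 mul1r mul0r addr0.
  transitivity ((c * a^*%C + e * b^*%C) * F.1 z + (c * c^*%C + e * e^*%C) * F.2 z); first by ring.
  by rewrite U6' U5 mul1r mul0r add0r.
have XY F : X (Y F) = F.
  rewrite [RHS]surjective_pairing; congr (_, _); rewrite funeqE => z /=.
    transitivity ((a * a^*%C + c * c^*%C) * F.1 z + (b * a^*%C + e * c^*%C) * F.2 z); first by ring.
    by rewrite U1 U3' mul1r mul0r addr0.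
  transitivity ((a * b^*%C + c * e^*%C) * F.1 z + (b * b^*%C + e * e^*%C) * F.2 z); first by ring.
  by rewrite U3 U2 mul1r mul0r add0r.
have Xdot u v : bergman2 u -> bergman2 v -> dot2 (X u) (X v) = dot2 u v.
  by apply: mat2_dot; rewrite !conjcK; [rewrite -U4|rewrite -U5|rewrite -U6']; ring.
have XMT h : bergman al h -> X (M_Theta t1 t2 h) = M_Theta p1 p2 (fun z => d z * h z).
  move=> bh; rewrite /X /mat2 /M_Theta/=; congr (_, _); rewrite funeqE => z /=;
    (have [z1|z1] := ltP (normc z) 1; last
      by rewrite (bergman_off ha bh) ?mulr0 ?addr0// diskE; apply/negP; rewrite -leNgt);
    have [-> ->] := tE z z1.
    transitivity (((a * a^*%C + c * c^*%C) * p1 z + (b * a^*%C + e * c^*%C) * p2 z) * (d z * h z)); first by ring.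
    by rewrite U1 U3' mul1r mul0r addr0.
  transitivity (((a * b^*%C + c * e^*%C) * p1 z + (b * b^*%C + e * e^*%C) * p2 z) * (d z * h z)); first by ring.
  by rewrite U3 U2 mul1r mul0r add0r.
have d0 z : normc z < 1 -> d z != 0.
  by move=> z1; rewrite -normc_gt0; exact: lt_le_trans m0 (Hm z z1).
have bd h : bergman al h -> bergman al (fun z => d z * h z) by move=> bh; exact: (bergman_mul ha bh hd HM).
have surj g : bergman al g -> exists2 h, bergman al h & g = fun z => d z * h z.
  move=> bg; exists (fun z => (d z)^-1 * g z).
    apply: (bergman_mul ha (M := m^-1) bg).
      move=> z z1; have [k wk] := hd z z1; exists (- (d z) ^- 2 * k).
      exact: (wirt_cplx_chain (g := fun x => x^-1) (wirt_inv (d0 z z1)) wk).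
    by move=> z z1; rewrite normcV lef_pV2 ?posrE ?Hm// (lt_le_trans m0)// Hm.
  rewrite funeqE => z; have [z1|z1] := ltP (normc z) 1; first by rewrite mulVKf// d0.
  by rewrite (bergman_off ha bg) ?mulr0// diskE; apply/negP; rewrite -leNgt.
pose Q : set H2 := hm_orth (M_Theta t1 t2 @` bergman al : set H2).
pose Q' : set H2 := hm_orth (M_Theta p1 p2 @` bergman al : set H2).
have XQ u : Q u -> Q' (X u).
  move=> [bu hu]; split; first exact: bergman_mat2.
  move=> _ [g bg <-]; have [h bh ->] := surj g bg; rewrite -XMT//.
  have rh : (M_Theta t1 t2 @` bergman al : set H2) (M_Theta t1 t2 h) by exists h.
  by rewrite Xdot ?hu//; exact: (ran_sub ha ht1 ht2 rh).
have YQ v : Q' v -> Q (Y v).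
  move=> [bv hv]; split; first exact: bergman_mat2.
  move=> _ [h bh <-].
  have rh : (M_Theta t1 t2 @` bergman al : set H2) (M_Theta t1 t2 h) by exists h.
  rewrite -Xdot; [|exact: bergman_mat2|exact: (ran_sub ha ht1 ht2 rh)].
  by rewrite XY XMT// hv//; exists (fun z => d z * h z) => //; exact: bd.
exists X; split.
- split.
  + by move=> u Qu; exact: XQ.
  + by move=> u v _ _ /(congr1 Y); rewrite !YX.
  + by move=> v Qv; exists (Y v); [exact: YQ|exact: XY].
- by move=> k u v _ _; exact: mat2_lin.
- by move=> u v Qu Qv; exact: Xdot Qu.1 Qv.1.
move=> p u Qu; apply/esym.
have bpu : bergman2 (hm_act H2 p u) by exact: (bergman2_act ha p Qu.1).
have Xact : hm_act H2 p (X u) = X (hm_act H2 p u).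
  by congr (_, _); rewrite funeqE => z /=; ring.
have [Qp hp] := projP ha ht1 ht2 hT bpu.
(* [X] commutes with multiplication by polynomials, so it carries the defining conditions of one
   projection to those of the other. *)
apply: (proj_unique hp1 hp2 hP).
- exact: (bergman2_act ha p (XQ _ Qu).1).
- exact: XQ Qp.
move=> w Qw; rewrite -(XY w); have QYw := YQ _ Qw.
rewrite Xact.
have E v1 v2 : X v1 - X v2 = X (v1 - v2).
  by rewrite addrC -scaleN1r -mat2_lin scaleN1r addrC.
rewrite E Xdot; [exact: hp|exact: (ip_sub (bergman2_inner ha) bpu Qp.1)|exact: QYw.1].
Qed.

End If.

(** * Bounds on the data and on the factor *)

Section Bounds.
Context {R : realType}.

Lemma corona_bounds (f1 f2 : R[i] -> R[i]) : bounded_holomorphic f1 -> bounded_holomorphic f2 ->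
  corona f1 f2 -> exists e M : R, [/\ 0 < e, 0 < M &
    forall z, normc z < 1 -> e <= sqn f1 f2 z <= M].
Proof.
move=> /bounded_holomorphicP[_ [M1 M10 H1]] /bounded_holomorphicP[_ [M2 M20 H2]] [e e0 He].
exists e, (M1 ^+ 2 + M2 ^+ 2 + 1); split => //.
  by rewrite ltr_wpDl// addr_ge0 ?sqr_ge0.
move=> z z1; rewrite He ?diskE//=.
apply: (@le_trans _ _ (M1 ^+ 2 + M2 ^+ 2)); last by rewrite lerDl.
by rewrite /sqn !abs2E lerD// ler_sqr ?nnegrE ?normc_ge0// ?H1 ?H2.
Qed.

(** Together with [ge_of_sqr], turns bounds on [|d|^2] into bounds on [|d|] without square roots;
    any positive constants serve. *)
Lemma le_of_sqr (x q : R) : 0 <= x -> q <= x ^+ 2 -> Num.min 1 q <= x.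
Proof.
move=> x0 qx; rewrite ge_min; have [//|x1] := leP 1 x.
by apply: le_trans qx _; rewrite expr2 ler_piMl// ltW.
Qed.

Lemma ge_of_sqr (x q : R) : x ^+ 2 <= q -> x <= 1 + q.
Proof. by have := sqr_ge0 (x - 2^-1); nra. Qed.

End Bounds.
Theorem theorem4p5 (R : realType) (alpha beta : R)
    (theta1 theta2 phi1 phi2 : R[i] -> R[i])
    (halpha : -1 < alpha) (hbeta : -1 < beta)
    (htheta1 : bounded_holomorphic theta1)
    (htheta2 : bounded_holomorphic theta2)
    (hphi1 : bounded_holomorphic phi1)
    (hphi2 : bounded_holomorphic phi2)
    (hTheta : corona theta1 theta2)
    (hPhi : corona phi1 phi2) :
  hm_isomorphic (bergman_quotient alpha theta1 theta2)
                (bergman_quotient beta phi1 phi2) <->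
  alpha = beta /\
  (forall z : R[i], disk z ->
     laplacian (fun w : R[i] =>
       (ln ((abs2 (theta1 w) + abs2 (theta2 w)) /
            (abs2 (phi1 w) + abs2 (phi2 w))))%:C) z = 0).
Proof.
have [ht1 _] := bounded_holomorphicP htheta1; have [ht2 _] := bounded_holomorphicP htheta2.
have [hp1 _] := bounded_holomorphicP hphi1; have [hp2 _] := bounded_holomorphicP hphi2.
have [e [M [e0 M0 HT]]] := corona_bounds htheta1 htheta2 hTheta.
have [e' [M' [e'0 M'0 HP]]] := corona_bounds hphi1 hphi2 hPhi.
have Te z (z1 : normc z < 1) : e <= sqn theta1 theta2 z by case/andP: (HT z z1).
have TM z (z1 : normc z < 1) : sqn theta1 theta2 z <= M by case/andP: (HT z z1).
have Pe z (z1 : normc z < 1) : e' <= sqn phi1 phi2 z by case/andP: (HP z z1).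
have PM z (z1 : normc z < 1) : sqn phi1 phi2 z <= M' by case/andP: (HP z z1).
have tpos z (z1 : normc z < 1) : 0 < sqn theta1 theta2 z := lt_le_trans e0 (Te z z1).
have ppos z (z1 : normc z < 1) : 0 < sqn phi1 phi2 z := lt_le_trans e'0 (Pe z z1).
split=> [iso|[ab lap]].
  have [d KR] := isomorphic_kernel_rel halpha hbeta htheta1 htheta2 hTheta hphi1 hphi2 hPhi iso.
  have d0 := kernel_rel_neq0 tpos KR.
  have ab : alpha = beta.
    (* The case [beta < alpha] is excluded with the modules exchanged and [1 / d] in place of
       [d]. *)
    case: (ltgtP alpha beta) => // [ab|ba]; exfalso.
      exact: (kernel_rel_lt ht1 ht2 hp1 hp2 tpos ppos KR ab e'0 TM Pe).
    have KR' := kernel_rel_inv d0 KR.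
    exact: (kernel_rel_lt hp1 hp2 ht1 ht2 ppos tpos KR' ba e0 PM Te).
  split=> // z; rewrite diskE => z1.
  have hd := kernel_rel_chol ht1 ht2 hp1 hp2 tpos ppos KR.
  exact: (laplacian_log_abs2 hd d0 (kernel_rel_ratio ppos KR ab) z1).
have lap' z : normc z < 1 ->
    laplacian (fun w => (ln (sqn theta1 theta2 w / sqn phi1 phi2 w))%:C) z = 0.
  by rewrite -diskE; exact: lap.
have [d [hd d0 E]] := factor_exists ht1 ht2 hp1 hp2 tpos ppos lap'.
have z1 : normc (0 : R[i]) < 1 by rewrite Normc.normc0.
have [||z zz|a [b [c [k [U tE]]]]] :=
  @unitary_exists R theta1 theta2 (fun z => d z * phi1 z) (fun z => d z * phi2 z) ht1 ht2 _ _ (tpos 0 z1).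
- exact: chol_mul.
- exact: chol_mul.
- by rewrite E// /sqn !abs2M; ring.
(* Hence [|d|^2] lies between [e / M'] and [M / e'], which bounds [d] and its inverse. *)
have dsq z : normc z < 1 -> normc (d z) ^+ 2 = sqn theta1 theta2 z / sqn phi1 phi2 z.
  by move=> zz; rewrite E// mulfK ?abs2E// lt0r_neq0// ppos.
rewrite -ab; apply: (unitary_isomorphic halpha htheta1 htheta2 hTheta hphi1 hphi2 hPhi U hd) => //.
- exists (1 + M / e') => z zz; apply: ge_of_sqr; rewrite dsq//.
  by rewrite ler_pM ?invr_ge0 ?(ltW (tpos _ _)) ?(ltW (ppos _ _)) ?TM// lef_pV2 ?posrE ?ppos ?Pe.
- exists (Num.min 1 (e / M')); first by rewrite lt_min ltr01 divr_gt0.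
  move=> z zz; apply: le_of_sqr; first exact: normc_ge0.
  rewrite dsq// ler_pM ?invr_ge0 ?(ltW e0) ?(ltW M'0) ?Te// lef_pV2 ?posrE ?ppos ?PM//.
Qed.
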